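(* For all $\alpha,\beta\ge\tfrac12$ and for all $\varepsilon\in(0,1)$, the $\varepsilon$-mixing time of the TASEP with open boundaries on $[N]$ with parameters $\alpha,\beta$ satisfies $$\liminf_{N\to\infty}\frac{t^N_{\mathrm{mix}}(\varepsilon)}{N^{3/2}}\ge C_3$$ for some constant $C_3=C_3(\varepsilon)>0$.
   Context: For $N\in\mathbb N=\{1,2,\dots\}$ write $[N]=\{1,\dots,N\}$. The TASEP with open boundaries on $[N]$ with parameters $\alpha,\beta>0$ is the continuous-time Markov chain $(\eta_t)_{t\ge 0}$ on $\Omega_N=\{0,1\}^N$ with generator $$\mathcal L f(\eta)=\sum_{x=1}^{N-1}\eta(x)(1-\eta(x+1))[f(\eta^{x,x+1})-f(\eta)]+\alpha(1-\eta(1))[f(\eta^{1})-f(\eta)]+\beta\,\eta(N)[f(\eta^{N})-f(\eta)],$$ where $\eta^{x,y}$ is $\eta$ with the values at sites $x$ and $y$ exchanged, and $\eta^{x}$ is $\eta$ with the value at site $x$ replaced by $1-\eta(x)$. The chain is irreducible; let $\mu_N$ be its unique stationary distribution. For a probability measure $\nu$ on $\Omega_N$, $\|\nu-\mu_N\|_{TV}=\frac12\sum_{x\in\Omega_N}|\nu(x)-\mu_N(x)|$. The $\varepsilon$-mixing time is $$t^N_{\mathrm{mix}}(\varepsilon)=\inf\Big\{t\ge0:\ \max_{\eta\in\Omega_N}\|\mathbb P(\eta_t\in\cdot\mid\eta_0=\eta)-\mu_N\|_{TV}<\varepsilon\Big\}.$$ *)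

(* Defs.v *)
From mathcomp Require Import all_boot all_order all_algebra perm.
From mathcomp Require Import all_classical all_reals all_analysis.

Set Implicit Arguments.
Unset Strict Implicit.
Unset Printing Implicit Defensive.

Import Order.TTheory GRing.Theory Num.Theory.
Import numFieldNormedType.Exports.

Local Open Scope classical_set_scope.
Local Open Scope ring_scope.

(* The segment [N] is represented with N = n.+1 by the ordinals 'I_n.+1, so   *)
(* that the sites 1, ..., N of the mathematical text are 0, ..., n here.      *)
Definition config (n : nat) := {ffun 'I_n.+1 -> bool}.

Definition swap (n : nat) (x y : 'I_n.+1) (eta : config n) : config n :=
  [ffun z => eta (tperm x y z)].

Definition flip (n : nat) (x : 'I_n.+1) (eta : config n) : config n :=
  [ffun z => if z == x then ~~ eta z else eta z].

Section Tasep.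
Variables (R : realType) (n : nat) (alpha beta : R).
Implicit Types (f : config n -> R) (mu nu : config n -> R).
Implicit Types (eta xi : config n).

Definition generator f eta : R :=
  \sum_(x < n)
     (eta (inord x))%:R * (1 - (eta (inord x.+1))%:R) *
     (f (swap (inord x) (inord x.+1) eta) - f eta)
  + alpha * (1 - (eta ord0)%:R) * (f (flip ord0 eta) - f eta)
  + beta * (eta ord_max)%:R * (f (flip ord_max eta) - f eta).

(* The Markov semigroup exp (t * generator); the exponential series converges *)
(* because the generator is a linear operator on a finite-dimensional space.  *)
Definition semigroup (t : R) f eta : R :=
  limn (series (fun k : nat => t ^+ k / k`!%:R * iter k generator f eta)).

(* transition t eta xi is the probability of being in xi at time t for the    *)
(* chain started from eta at time 0.                                          *)
Definition transition (t : R) eta xi : R :=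
  semigroup t (fun zeta => (zeta == xi)%:R) eta.

Definition is_distribution mu : Prop :=
  (forall eta, 0 <= mu eta) /\ \sum_(eta : config n) mu eta = 1.

Definition is_stationary mu : Prop :=
  is_distribution mu /\
  forall t : R, 0 <= t ->
    forall xi, \sum_(eta : config n) mu eta * transition t eta xi = mu xi.

(* For 0 < alpha and 0 < beta the chain is irreducible, so that exactly one   *)
(* function satisfies is_stationary and get selects it.                       *)
Definition stationary_distribution : config n -> R :=
  get [set mu | is_stationary mu].

Definition tv_distance nu mu : R :=
  2^-1 * \sum_(eta : config n) `|nu eta - mu eta|.

(* The neutral element 0 is harmless since total variation is nonnegative.    *)
Definition max_tv (t : R) : R :=
  \big[Num.max/0]_(eta : config n)
     tv_distance (transition t eta) stationary_distribution.

(* Extended-real-valued, with the convention that the infimum of the empty    *)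
(* set is +oo.                                                                *)
Definition mixing_time (eps : R) : \bar R :=
  ereal_inf [set t%:E | t in [set t : R | 0 <= t /\ max_tv t < eps]].

End Tasep.

Arguments mixing_time {R} n alpha beta eps.

(* Main.v *)
(* Let q be the square root of the number N of sites.  For k different values of
   r, start from independent sites of density 1/2, raised to 1/2 + r / q in the
   middle third.  The initial number of particles is then N / 2 + r q / 3 up to
   O(q).  Up to time c q ^ 3 the bump is not felt at the boundaries: the currents
   through both ends are t / 4 + O(q), with an error independent of r.  Hence the
   number of particles stays within O(q) of its initial mean, and for k values of
   r which are far enough apart this gives k disjoint events, one of which has
   stationary probability at most 1 / k.

   The semigroup exp (t L) is the limit of (1 + t L / m) ^ m, a finite mixture of
   compositions of random maps, for which couplings are elementary.  By
   monotonicity in the rates and by the particle-hole symmetry it is enough to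
   bound the number of particles from below for the rates 1/2 and beta >= 1.
   This needs a lower bound on the entrance current for these rates and, after
   reflection, an upper bound on the entrance current for the rates beta and 1/2.
   - Lower bound: the height process is self-dual, so one may start from the empty
     configuration; this is compared with the rates 1/2 and 1/2 + x, for which a
     product measure is an eigenvector of the generator tilted by the current.
   - Upper bound: for the rates 1 and 1/2 the stationary weights count lattice
     paths, so the mean current from the stationary measure is explicit, and by
     Harris' inequality it controls the current from density 1/2.  An arbitrary
     configuration outside the first block changes this only by O(q), since the
     height process is an envelope of two processes started from product
     measures. *)
Require Import Defs.
From mathcomp Require Import all_boot all_order all_algebra perm.
From mathcomp Require Import all_classical all_reals all_analysis.
From mathcomp Require Import ring lra zify.

Set Implicit Arguments.
Unset Strict Implicit.
Unset Printing Implicit Defensive.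

Import Order.TTheory GRing.Theory Num.Theory.
Import numFieldNormedType.Exports.

Local Open Scope classical_set_scope.
Local Open Scope ring_scope.

(** * Chains of random maps and their couplings *)

(** The obstacle is precision: over a time of order q ^ 3 the clocks at the boundary alone fluctuate
    by q ^ (3/2), whereas the currents must be known up to O(q). Exact eigenvectors provide this.
    Tilting a current by an exponent s of order 1 / q controls it up to O(q), and what is left is
    the discrepancy, per unit of time, between the eigenvalue and s / 4. Since [tilt x] is 4 x + O(x
    ^ 3) without quadratic term, this discrepancy is of order q ^ (-3), and its product with t stays
    bounded up to times of order q ^ 3. This is the origin of the exponent 3/2. Comparison of rates
    transfers lower tails of the current to faster boundaries, but not upper tails. The latter come
    from an upper bound on the mean together with a lower tail, through Markov's inequality, so that
    the errors are of order 1 / K instead of exponentially small. The estimates involve only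
    reference rates, so C3 depends on eps alone; alpha and beta merely limit the step size [tau]. *)

Section Chain.
Variables (R : realFieldType) (I : finType).

(** The backward operator on test functions: for [a] equal to [tau] times the rates it is 1 + tau L,
    and couplings become inequalities between functions. *)
Definition step (a : I -> R) S (U : I -> S -> S) (f : S -> R) : S -> R :=
  fun s => f s + \sum_i a i * (f (U i s) - f s).

Definition chain a S (U : I -> S -> S) m (f : S -> R) : S -> R :=
  iter m (step a U) f.

(* The basic coupling: common rings move both states, surplus rings only one. *)
Lemma chain_couple (a1 a2 : I -> R) S1 S2 (U1 : I -> S1 -> S1)
    (U2 : I -> S2 -> S2) (r : S1 -> S2 -> Prop) f1 f2 :
  (forall i, 0 <= a1 i) -> (forall i, 0 <= a2 i) ->
  \sum_i Num.max (a1 i) (a2 i) <= 1 ->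
  (forall i s1 s2, r s1 s2 -> r (U1 i s1) (U2 i s2)) ->
  (forall i s1 s2, a1 i < a2 i -> r s1 s2 -> r s1 (U2 i s2)) ->
  (forall i s1 s2, a2 i < a1 i -> r s1 s2 -> r (U1 i s1) s2) ->
  (forall s1 s2, r s1 s2 -> f1 s1 <= f2 s2) ->
  forall m s1 s2, r s1 s2 -> chain a1 U1 m f1 s1 <= chain a2 U2 m f2 s2.
Proof.
move=> a1_ge0 a2_ge0 a_le1 rUU rU2 rU1 f12; elim=> [|m IH] s1 s2 r12 /=.
  exact: f12.
rewrite /chain in IH; set F1 := iter m (step a1 U1) f1 in IH *; set F2 := iter m (step a2 U2) f2 in IH *.
rewrite -subr_ge0.
have -> : F2 s2 + \sum_i a2 i * (F2 (U2 i s2) - F2 s2) -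
    (F1 s1 + \sum_i a1 i * (F1 (U1 i s1) - F1 s1)) =
    (F2 s2 - F1 s1) + \sum_i (a2 i * (F2 (U2 i s2) - F2 s2) -
                             a1 i * (F1 (U1 i s1) - F1 s1)).
  by rewrite sumrB; ring.
have d0 : 0 <= F2 s2 - F1 s1 by rewrite subr_ge0; exact: IH.
(* The maxima sum to at most 1, so the present difference can be shared out among the rings; one
   nonnegativity check per ring remains. *)
apply: (@le_trans _ _ ((F2 s2 - F1 s1) +
    \sum_i - (Num.max (a1 i) (a2 i) * (F2 s2 - F1 s1)))).
  rewrite sumrN -mulr_suml -{1}[F2 s2 - F1 s1]mul1r -mulrBl mulr_ge0//.
  by rewrite subr_ge0.
rewrite lerD2l; apply: ler_sum => i _.
have dU : 0 <= F2 (U2 i s2) - F1 (U1 i s1).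
  by rewrite subr_ge0; apply: IH; exact: rUU.
have a1i := a1_ge0 i; have a2i := a2_ge0 i.
case: (ltrgtP (a1 i) (a2 i)) => h.
- have dU2 : 0 <= F2 (U2 i s2) - F1 s1.
    by rewrite subr_ge0; apply: IH; apply: rU2.
  have := mulr_ge0 a1i dU.
  have : 0 <= (a2 i - a1 i) * (F2 (U2 i s2) - F1 s1).
    by rewrite mulr_ge0// subr_ge0 ltW.
  nra.
- have dU1 : 0 <= F2 s2 - F1 (U1 i s1).
    by rewrite subr_ge0; apply: IH; apply: rU1.
  have := mulr_ge0 a2i dU.
  have : 0 <= (a1 i - a2 i) * (F2 s2 - F1 (U1 i s1)).
    by rewrite mulr_ge0// subr_ge0 ltW.
  nra.
- by have := mulr_ge0 a1i dU; rewrite -h; nra.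
Qed.

(** This translates between the encodings of the same dynamics: heights, currents with
    configurations, and configurations. *)
Lemma chain_rel (a : I -> R) S1 S2 (U1 : I -> S1 -> S1)
    (U2 : I -> S2 -> S2) (r : S1 -> S2 -> Prop) f1 f2 :
  (forall i s1 s2, r s1 s2 -> r (U1 i s1) (U2 i s2)) ->
  (forall s1 s2, r s1 s2 -> f1 s1 = f2 s2) ->
  forall m s1 s2, r s1 s2 -> chain a U1 m f1 s1 = chain a U2 m f2 s2.
Proof.
move=> rU f12; elim=> [|m IH] s1 s2 r12 /=; first exact: f12.
rewrite /step (IH _ _ r12); congr (_ + _).
by apply: eq_bigr => i _; rewrite (IH _ _ (rU i _ _ r12)).
Qed.

Section Basic.
Variables (a : I -> R) (S : Type) (U : I -> S -> S).

Lemma chainS m f s : chain a U m.+1 f s =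
  chain a U m f s + \sum_i a i * (chain a U m f (U i s) - chain a U m f s).
Proof. by []. Qed.

Lemma eq_chain m f g : f =1 g -> chain a U m f =1 chain a U m g.
Proof. by move=> fg s; apply: (@chain_rel a _ _ U U eq) => [i ? ? ->|? ? ->|]. Qed.

Lemma chain_lin m (k : R) f g s :
  chain a U m (fun x => k * f x + g x) s =
  k * chain a U m f s + chain a U m g s.
Proof.
elim: m s => [|m IH] s //; rewrite !chainS IH mulrDr mulr_sumr.
rewrite addrACA -big_split /=; congr (_ + _).
by apply: eq_bigr => i _; rewrite IH; ring.
Qed.

Lemma chainD m f g s :
  chain a U m (fun x => f x + g x) s = chain a U m f s + chain a U m g s.
Proof.
rewrite -[chain a U m f s]mul1r -chain_lin.
by apply: eq_chain => x; rewrite mul1r.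
Qed.

Lemma chain_cst m (k : R) s : chain a U m (fun=> k) s = k.
Proof.
elim: m s => [|m IH] s //; rewrite chainS IH big1 ?addr0// => i _.
by rewrite IH subrr mulr0.
Qed.

Lemma chainZ m (k : R) f s : chain a U m (fun x => k * f x) s = k * chain a U m f s.
Proof.
rewrite -[RHS]addr0 -[X in _ = _ + X](chain_cst m 0 s) -chain_lin.
by apply: eq_chain => x; rewrite addr0.
Qed.

Lemma chainSr m f s : chain a U m.+1 f s = chain a U m (step a U f) s.
Proof. by rewrite /chain iterSr. Qed.

Lemma chain_sum J (l : seq J) m (F : J -> S -> R) s :
  chain a U m (fun x => \sum_(j <- l) F j x) s =
  \sum_(j <- l) chain a U m (F j) s.
Proof.
elim: l => [|j l IH].
  rewrite big_nil -[RHS](chain_cst m 0 s).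
  by apply: eq_chain => x; rewrite big_nil.
rewrite big_cons -IH -chainD; apply: eq_chain => x; by rewrite big_cons.
Qed.

Hypotheses (a_ge0 : forall i, 0 <= a i) (a_le1 : \sum_i a i <= 1).

Lemma chain_le (P : S -> Prop) f g :
  (forall i s, P s -> P (U i s)) -> (forall s, P s -> f s <= g s) ->
  forall m s, P s -> chain a U m f s <= chain a U m g s.
Proof.
move=> PU fg m s Ps.
apply: (@chain_couple a a _ _ U U (fun x y => P x /\ x = y)) => //.
- by under eq_bigr do rewrite maxxx.
- by move=> i s1 _ [Ps1 <-]; split=> //; exact: PU.
- by move=> i ? ?; rewrite ltxx.
- by move=> i ? ?; rewrite ltxx.
- by move=> s1 _ [Ps1 <-]; exact: fg.
Qed.

End Basic.

(** The first ring seen by [s] becomes the last ring seen by [g]. All steps having the same law, the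
    reversed order cannot be noticed. *)
Lemma chain_dual (a : I -> R) S (U : I -> S -> S) (P : S -> Prop)
    (F : S -> S -> R) :
  (forall i s, P s -> P (U i s)) ->
  (forall i s g, P s -> P g -> F (U i s) g = F s (U i g)) ->
  forall m s g, P s -> P g ->
    chain a U m (fun x => F x g) s = chain a U m (F s) g.
Proof.
move=> PU FU; elim=> [//|m IH] s g Ps Pg.
rewrite chainS chainSr IH//.
have -> : chain a U m (step a U (F s)) g = chain a U m
    (fun x => F s x + \sum_(i <- index_enum I) (a i * (F s (U i x) - F s x))) g.
  by [].
rewrite chainD chain_sum; congr (_ + _); apply: eq_bigr => i _.
rewrite chainZ IH//; last exact: PU.
congr (_ * _); rewrite -[- _]mulN1r addrC -chain_lin.
apply: (@chain_rel a _ _ U U (fun x y => P x /\ x = y)) => //.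
- by move=> j s1 _ [Ps1 <-]; split=> //; exact: PU.
- by move=> x _ [Px <-]; rewrite FU// addrC mulN1r.
Qed.

End Chain.

(** * The height process *)

Definition height := nat -> int.

(* [n x] is the number of particles that have crossed bond [x] minus the number
   of particles initially in the first [x] sites; a ring of bond [x] raises it
   by one unless exclusion forbids the jump. *)
Definition upd (N x : nat) (n : height) : height := fun v =>
  if v == x then
    Num.min (n x + 1) (Num.min (if x == 0 then n x + 1 else n x.-1)
                               (if x == N then n x + 1 else n x.+1 + 1))
  else n v.

(** The decrement of the height across a site is the occupation number of that site. *)
Definition valid N (n : height) : Prop :=
  forall x, (x < N)%N -> n x.+1 <= n x <= n x.+1 + 1.

Definition below N (n n' : height) : Prop := forall v, (v <= N)%N -> n v <= n' v.

Lemma upd_mono N x n n' : (x <= N)%N -> below N n n' ->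
  below N (upd N x n) (upd N x n').
Proof.
move=> xN nn' v vN; rewrite /upd; case: eqP => _; last exact: nn'.
have h := nn' x xN.
have h1 : x != 0 -> n x.-1 <= n' x.-1 by move=> ?; apply: nn'; lia.
have h2 : x != N -> n x.+1 <= n' x.+1 by move=> ?; apply: nn'; lia.
move: h1 h2; case: (x == 0); case: (x == N) => /= h1 h2; lia.
Qed.

Lemma upd_shift N x n (c : int) : upd N x (fun v => n v + c) =1
  (fun v => upd N x n v + c).
Proof. by move=> v; rewrite /upd; do 3?case: eqP => ? //; lia. Qed.

Lemma upd_min N x n n' : upd N x (fun v => Num.min (n v) (n' v)) =1
  (fun v => Num.min (upd N x n v) (upd N x n' v)).
Proof. by move=> v; rewrite /upd; do 3?case: eqP => ? //; lia. Qed.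

(** Surplus rings only raise heights, which makes the height process monotone in the rates. *)
Lemma upd_ge N x n : (x <= N)%N -> valid N n -> below N n (upd N x n).
Proof.
move=> xN nv v vN; rewrite /upd; case: eqP => [->|_]//.
have h1 : x != 0 -> n x <= n x.-1.
  by case: x xN => // x xN _; case/andP: (nv x xN).
have h2 : x != N -> n x <= n x.+1 + 1.
  by move=> ?; have /andP[] : n x.+1 <= n x <= n x.+1 + 1 by apply: nv; lia.
move: h1 h2; case: (x == 0); case: (x == N) => /= h1 h2; lia.
Qed.

Lemma upd_valid N x n : (x <= N)%N -> valid N n -> valid N (upd N x n).
Proof.
move=> xN nv v vN; have hv := nv v vN; rewrite /upd.
case: (eqVneq v x) => [vx|vx]; case: (eqVneq v.+1 x) => [vx'|vx']; try lia.
- subst v; have -> : (x == N) = false by lia.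
  case: (eqVneq x 0%N) => [x0|x0]; first lia.
  have := nv x.-1; rewrite prednK; last lia.
  by move=> /(_ ltac:(lia)); lia.
- have -> : (x == 0%N) = false by lia.
  have -> : x.-1 = v by lia.
  rewrite vx' in hv *.
  case: (eqVneq x N) => [xN'|xN']; first lia.
  by have := nv x ltac:(lia); lia.
Qed.

(* The minimum over [v] of [n v + g v + v] is below [y]: [upd] is self-adjoint for
   this pairing, which is the duality of the height process. *)
Definition crosses N (y : int) (n g : height) : bool :=
  has (fun v => n v + g v + v%:Z < y) (iota 0 N.+1).

Lemma crosses_sym N y n g : crosses N y n g = crosses N y g n.
Proof. by apply: eq_has => v; rewrite (addrC (n v)). Qed.

Lemma crossesP N y n g :
  reflect (exists2 v, (v <= N)%N & n v + g v + v%:Z < y) (crosses N y n g).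
Proof.
apply: (iffP hasP) => -[v vN h]; exists v => //.
  by move: vN; rewrite mem_iota ltnS.
by rewrite mem_iota ltnS.
Qed.

(** If the new value at [x] comes from a neighbour, the witness moves to that neighbour. The term
    [v] of the pairing compensates the variation of [g], which rises by at most one to the left and
    not at all to the right. *)
Lemma crosses_upd_half N x y n g : (x <= N)%N -> valid N n -> valid N g ->
  crosses N y (upd N x n) g -> crosses N y n (upd N x g).
Proof.
move=> xN nv gv /crossesP[v vN]; rewrite {1}/upd.
case: (eqVneq v x) => [->|vx] h; last first.
  by apply/crossesP; exists v => //; rewrite /upd (negbTE vx).
have [h1|[h1|h1]] : n x + 1 + g x + x%:Z < y \/
    (x != 0 /\ n x.-1 + g x + x%:Z < y) \/ (x != N /\ n x.+1 + 1 + g x + x%:Z < y).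
  move: h; case: (x == 0%N); case: (x == N) => /= h; lia.
- apply/crossesP; exists x => //; rewrite /upd eqxx; lia.
- apply/crossesP; exists x.-1; first lia.
  rewrite /upd; have -> : (x.-1 == x) = false by lia.
  have := gv x.-1; rewrite prednK; last lia.
  move=> /(_ ltac:(lia)); lia.
- apply/crossesP; exists x.+1; first lia.
  rewrite /upd; have -> : (x.+1 == x) = false by lia.
  have := gv x ltac:(lia); lia.
Qed.

Lemma crosses_upd N x y n g : (x <= N)%N -> valid N n -> valid N g ->
  crosses N y (upd N x n) g = crosses N y n (upd N x g).
Proof.
move=> xN nv gv; apply/idP/idP; first exact: crosses_upd_half.
rewrite crosses_sym => h; rewrite crosses_sym; exact: crosses_upd_half.
Qed.

(* Reflection of the segment, exchanging particles and holes. *)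
Definition mirror N (c : int) (n : height) : height :=
  fun v => n (N - v)%N - v%:Z + c.

Lemma upd_mirror N x c n v : (x <= N)%N -> (v <= N)%N ->
  upd N (N - x) (mirror N c n) v = mirror N c (upd N x n) v.
Proof.
move=> xN vN; rewrite /upd /mirror.
case: (eqVneq v (N - x)%N) => [->|vx]; last first.
  by have -> : ((N - v)%N == x) = false by lia.
have -> : (N - (N - x) = x)%N by lia.
rewrite eqxx.
case: (eqVneq x 0%N) => [x0|x0]; case: (eqVneq x N) => [xN'|xN'].
- by subst; rewrite !subn0 eqxx /=; lia.
- have -> : ((N - x)%N == 0%N) = false by lia.
  have -> : ((N - x)%N == N) by lia.
  have -> : (N - (N - x).-1 = x.+1)%N by lia.
  lia.
- have -> : ((N - x)%N == 0%N) by lia.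
  have -> : ((N - x)%N == N) = false by lia.
  have -> : (N - (N - x).+1 = x.-1)%N by lia.
  lia.
- have -> : ((N - x)%N == 0%N) = false by lia.
  have -> : ((N - x)%N == N) = false by lia.
  have -> : (N - (N - x).+1 = x.-1)%N by lia.
  have -> : (N - (N - x).-1 = x.+1)%N by lia.
  lia.
Qed.

Section Rates.
Variable R : realFieldType.

Definition rate N (alpha beta tau : R) (i : 'I_N.+1) : R :=
  tau * (if i == 0 :> nat then alpha else if i == N :> nat then beta else 1).

Lemma rate_ge0 N alpha beta tau i :
  0 <= alpha -> 0 <= beta -> 0 <= tau -> 0 <= rate (N := N) alpha beta tau i.
Proof. by move=> ? ? ?; rewrite /rate mulr_ge0//; do 2?case: eqP. Qed.

Lemma sum_rate N alpha beta tau :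
  \sum_i rate (N := N.+1) alpha beta tau i = tau * (alpha + beta + N%:R).
Proof.
rewrite -mulr_sumr big_ord_recl big_ord_recr /= eqxx; congr (_ * _).
rewrite (eq_bigr (fun=> 1)) => [|i _].
  by rewrite sumr_const card_ord; ring.
by rewrite /bump /= add1n eqSS; have := ltn_ord i; rewrite ltn_neqAle => /andP[/negbTE->].
Qed.

Lemma max_rate N alpha beta alpha' beta' tau i : 0 <= tau ->
  Num.max (rate (N := N) alpha beta tau i) (rate (N := N) alpha' beta' tau i) =
  rate (N := N) (Num.max alpha alpha') (Num.max beta beta') tau i.
Proof.
move=> t0; rewrite /rate -maxr_pMr//; congr (_ * _).
by case: eqP => // _; case: eqP => // _; rewrite maxxx.
Qed.

End Rates.
Arguments rate {R} N alpha beta tau i.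

(** * Configurations as lists, their jumps and their heights *)

Definition inj (s : seq bool) := if s is _ :: s' then true :: s' else s.

(** Sorting the pair moves a particle to the right exactly when exclusion allows it, and is visibly
    monotone. *)
Fixpoint bond k (s : seq bool) := match k, s with
  | 0, a :: b :: s' => (a && b) :: (a || b) :: s'
  | k'.+1, a :: s' => a :: bond k' s'
  | _, _ => s
  end.

Fixpoint out (s : seq bool) := match s with
  | [::] => [::]
  | [:: _] => [:: false]
  | a :: s' => a :: out s'
  end.

Definition cupd N (i : nat) s :=
  if i == 0%N then inj s else if i == N then out s else bond i.-1 s.

(** The number of entrances is carried along, since a configuration determines its height only up to
    a constant. *)
Definition jupd N (i : nat) (js : nat * seq bool) : nat * seq bool :=
  ((js.1 + ((i == 0) && ~~ head true js.2))%N, cupd N i js.2).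

Definition parts v (s : seq bool) : nat := count id (take v s).

Definition hgt (js : nat * seq bool) : height :=
  fun v => js.1%:Z - (parts v js.2)%:Z.

Lemma size_inj s : size (inj s) = size s. Proof. by case: s. Qed.

Lemma size_bond k s : size (bond k s) = size s.
Proof. by elim: k s => [|k IH] [|a [|b s]] //=; rewrite IH. Qed.

Lemma size_out s : size (out s) = size s.
Proof. by elim: s => [//|a [//|b s] /= ->]. Qed.

Lemma size_cupd N i s : size (cupd N i s) = size s.
Proof. by rewrite /cupd; do 2?case: eqP => _; rewrite ?size_inj ?size_bond ?size_out. Qed.

Lemma parts0 s : parts 0 s = 0%N. Proof. by rewrite /parts take0. Qed.

Lemma parts_cons v a s : parts v.+1 (a :: s) = (a + parts v s)%N.
Proof. by []. Qed.

Lemma partsS v s : parts v.+1 s = (parts v s + nth false s v)%N.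
Proof.
elim: v s => [|v IH] [|a s] //; first by rewrite parts_cons !parts0 add0n addn0.
by rewrite !parts_cons IH addnA.
Qed.

Lemma parts_bond v k s : (k.+1 < size s)%N ->
  parts v (bond k s) = if v == k.+1 then (parts k s + (nth false s k && nth false s k.+1))%N
                       else parts v s.
Proof.
elim: k v s => [|k IH] v [|a [|b s]] //= ks.
- case: v => [|[|v]]; rewrite ?parts0//= !parts_cons ?parts0 ?addn0//.
  by rewrite !addnA; congr (_ + _)%N; case: a; case: b.
- by case: v => [|v]; rewrite ?parts0// !parts_cons IH// eqSS; case: ifP; rewrite ?addnA.
Qed.

Lemma parts_inj v s : (0 < size s)%N ->
  parts v (inj s) = if v == 0%N then 0%N else (parts v s + ~~ head true s)%N.
Proof.
case: s => // a s _; case: v => [|v]; first by rewrite parts0.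
by rewrite !parts_cons /=; case: a; lia.
Qed.

Lemma parts_out v s : (v <= size s)%N ->
  parts v (out s) = if v == size s then parts v.-1 s else parts v s.
Proof.
elim: s v => [|a [|b s] IH] v //; first by case: v.
  by case: v => [|[|v]].
case: v => [|v] vs; first by rewrite !parts0.
have -> : out [:: a, b & s] = a :: out (b :: s) by [].
rewrite !parts_cons IH//= !eqSS; case: eqP => // ->; by case: s {IH vs}.
Qed.

Lemma hgt_upd N i js v : size js.2 = N -> (0 < N)%N -> (i <= N)%N -> (v <= N)%N ->
  hgt (jupd N i js) v = upd N i (hgt js) v.
Proof.
case: js => J s /= sN N0 iN vN; rewrite /hgt /upd /jupd /= /cupd.
case: (eqVneq i 0%N) => [->|i0].
  rewrite parts_inj ?sN// parts0; case: (eqVneq v 0%N) => [_|v0] /=; last by lia.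
  have -> : (0%N == N) = false by lia.
  rewrite partsS parts0 add0n nth0.
  case: s sN => [|a s] sN; first by rewrite -sN in N0.
  by case: a sN => _ /=; case: (0 == N)%N => /=; lia.
case: (eqVneq i N) => [->|iN'].
  rewrite /= addn0 parts_out ?sN//; case: (eqVneq v N) => // ->.
  have -> : parts N s = (parts N.-1 s + nth false s N.-1)%N by rewrite -{1}(prednK N0) partsS.
  by case: (nth _ _ _); lia.
rewrite /= addn0 parts_bond ?sN; last by lia.
have -> : i.-1.+1 = i by lia.
case: eqVneq => // _.
have e1 : parts i s = (parts i.-1 s + nth false s i.-1)%N.
  by rewrite -partsS prednK//; lia.
rewrite partsS e1; case: (i == N); case: (nth _ _ i.-1); case: (nth _ _ i) => /=; lia.
Qed.

Lemma hgt_valid N js : valid N (hgt js).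
Proof. by move=> x xN; rewrite /hgt partsS; case: (nth _ _ _); lia. Qed.

(** * Sums over configurations and matrix product relations *)

Section Sums.
Variable R : realFieldType.
Implicit Types (F G w : seq bool -> R).

Fixpoint sumb N F : R :=
  if N is N'.+1 then sumb N' (F \o cons true) + sumb N' (F \o cons false)
  else F [::].

Lemma eq_sumb N F G : (forall s, size s = N -> F s = G s) -> sumb N F = sumb N G.
Proof.
elim: N F G => [|N IH] F G FG /=; first exact: FG.
by congr (_ + _); apply: IH => s sN; rewrite /= FG//= sN.
Qed.

Lemma sumbD N F G : sumb N (fun s => F s + G s) = sumb N F + sumb N G.
Proof. by elim: N F G => [//|N IH] F G /=; rewrite !IH; ring. Qed.

Lemma sumbB N F G : sumb N (fun s => F s - G s) = sumb N F - sumb N G.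
Proof. by elim: N F G => [//|N IH] F G /=; rewrite !IH; ring. Qed.

Lemma sumbZ N (k : R) F : sumb N (fun s => k * F s) = k * sumb N F.
Proof. by elim: N F => [//|N IH] F /=; rewrite !IH; ring. Qed.

Lemma sumb_cst N (k : R) : sumb N (fun=> k) = 2 ^+ N * k.
Proof. by elim: N => [|N IH] /=; rewrite ?expr0 ?mul1r// /comp IH exprS; ring. Qed.

Lemma sumb_le N F G : (forall s, size s = N -> F s <= G s) -> sumb N F <= sumb N G.
Proof.
elim: N F G => [|N IH] F G FG /=; first exact: FG.
by apply: lerD; apply: IH => s sN; apply: FG; rewrite /= sN.
Qed.

Lemma sumb_big N I (l : seq I) (H : I -> seq bool -> R) :
  sumb N (fun s => \sum_(i <- l) H i s) = \sum_(i <- l) sumb N (H i).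
Proof.
elim: l => [|i l IH].
  rewrite big_nil -[RHS](mulr0 (2 ^+ N)) -sumb_cst.
  by apply: eq_sumb => s _; rewrite big_nil.
rewrite big_cons -IH -sumbD; by apply: eq_sumb => s _; rewrite big_cons.
Qed.

(** The assumptions on [w] are the matrix product relations D E = D + E and beta D V = V. They make
    the bulk and exit terms telescope, leaving one term at the left boundary. *)
Lemma sumb_bulk beta N w F :
  (forall u v, w (u ++ true :: false :: v) = w (u ++ true :: v) + w (u ++ false :: v)) ->
  (forall u, beta * w (rcons u true) = w u) ->
  \sum_(k < N) sumb N.+1 (fun s => w s * (F (bond k s) - F s)) +
    beta * sumb N.+1 (fun s => w s * (F (out s) - F s)) =
  sumb N (fun v => w v * (F (false :: v) - F (true :: v))).
Proof.
elim: N w F => [|N IH] w F w10 w1.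
  by rewrite big_ord0 /= -(w1 [::]) /=; ring.
rewrite big_ord_recl.
have IHa a := IH (w \o cons a) (F \o cons a) (fun u v => w10 (a :: u) v) (fun u => w1 (a :: u)).
set b0 := sumb _ _.
have -> : \sum_(k < N) sumb N.+2 (fun s => w s * (F (bond (lift ord0 k) s) - F s)) =
  \sum_(k < N) sumb N.+1 (fun s => w (true :: s) * (F (true :: bond k s) - F (true :: s))) +
  \sum_(k < N) sumb N.+1 (fun s => w (false :: s) * (F (false :: bond k s) - F (false :: s))).
  by rewrite -big_split.
have -> : sumb N.+2 (fun s => w s * (F (out s) - F s)) =
  sumb N.+1 (fun s => w (true :: s) * (F (true :: out s) - F (true :: s))) +
  sumb N.+1 (fun s => w (false :: s) * (F (false :: out s) - F (false :: s))).
  by congr (_ + _); apply: eq_sumb => -[|a s].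
move: (IHa true) (IHa false); rewrite /comp => E1 E2.
rewrite mulrDr -addrA [X in b0 + X]addrACA E1 E2 /b0 /= /comp /=.
rewrite -!sumbD; apply: eq_sumb => v _.
have /= -> := w10 [::] v.
ring.
Qed.

(** Common to the product weights [wBer] and the path weights [wt]: what happens at the left
    boundary then decides between a tilted eigenvector and stationarity. *)
Lemma sumb_step alpha beta tau N w (f : nat * seq bool -> R) J :
  (forall u v, w (u ++ true :: false :: v) = w (u ++ true :: v) + w (u ++ false :: v)) ->
  (forall u, beta * w (rcons u true) = w u) ->
  sumb N.+1 (fun s => w s * step (rate N.+1 alpha beta tau) (fun i : 'I_N.+2 => jupd N.+1 i) f (J, s)) =
  sumb N.+1 (fun s => w s * f (J, s)) +
  tau * sumb N (fun v => alpha * w (false :: v) * (f (J.+1, true :: v) - f (J, false :: v))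
                 + w v * (f (J, false :: v) - f (J, true :: v))).
Proof.
move=> w10 w1; rewrite sumbD -(sumb_bulk N (fun s => f (J, s)) w10 w1) /step.
rewrite (eq_sumb (G := fun s => w s * f (J, s) +
    \sum_i rate N.+1 alpha beta tau i * (w s * (f (jupd N.+1 i (J, s)) - f (J, s))))); last first.
  move=> s _; rewrite mulrDr mulr_sumr; congr (_ + _).
  by apply: eq_bigr => i _; ring.
rewrite sumbD sumb_big; congr (_ + _).
rewrite big_ord_recl big_ord_recr [RHS]mulrDr [X in _ = _ + X]mulrDr.
congr (_ + _).
- rewrite sumbZ /rate -mulrA; congr (_ * _); rewrite -sumbZ -[RHS]add0r /=.
  congr (_ + _); last first.
    by apply: eq_sumb => v _; rewrite /jupd /cupd /= addn1; ring.
  rewrite -[RHS](mulr0 (2 ^+ N)) -sumb_cst; apply: eq_sumb => v _.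
  by rewrite /jupd /cupd /= addn0 subrr !mulr0.
congr (_ + _).
- rewrite mulr_sumr; apply: eq_bigr => k _.
  have kN : (k.+1 == N.+1) = false by have := ltn_ord k; lia.
  rewrite sumbZ (_ : rate _ _ _ _ _ = tau); last by rewrite /rate lift0 kN mulr1.
  congr (_ * _).
  by apply: eq_sumb => s _; rewrite lift0 /jupd /cupd /= kN addn0.
- rewrite sumbZ (_ : rate _ _ _ _ _ = tau * beta); last by rewrite /rate lift0 eqxx.
  rewrite -mulrA; congr (_ * (_ * _)).
  by apply: eq_sumb => s _; rewrite lift0 /jupd /cupd /= eqxx addn0.
Qed.

End Sums.

(** * Product measures *)

Section Bernoulli.
Variable R : realFieldType.
Implicit Types (F G : seq bool -> R) (rs : seq R).

Fixpoint bern rs F : R :=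
  if rs is r :: rs' then
    r * bern rs' (F \o cons true) + (1 - r) * bern rs' (F \o cons false)
  else F [::].

Definition dens rs := all (fun r => 0 <= r <= 1) rs.

Lemma bern_lin rs k F G :
  bern rs (fun s => k * F s + G s) = k * bern rs F + bern rs G.
Proof. by elim: rs F G => [//|r rs IH] F G /=; rewrite !IH; ring. Qed.

Lemma bernD rs F G : bern rs (fun s => F s + G s) = bern rs F + bern rs G.
Proof. by elim: rs F G => [//|r rs IH] F G /=; rewrite !IH; ring. Qed.

Lemma bernZ rs k F : bern rs (fun s => k * F s) = k * bern rs F.
Proof. by elim: rs F => [//|r rs IH] F /=; rewrite !IH; ring. Qed.

Lemma bern_cst rs k : bern rs (fun=> k) = k.
Proof. by elim: rs => [//|r rs IH] /=; rewrite /comp !IH; ring. Qed.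

Lemma eq_bern rs F G :
  (forall s, size s = size rs -> F s = G s) -> bern rs F = bern rs G.
Proof.
elim: rs F G => [|r rs IH] F G FG /=; first exact: FG.
by congr (_ * _ + _ * _); apply: IH => s sN; rewrite /= FG//= sN.
Qed.

Lemma bern_le rs F G : dens rs ->
  (forall s, size s = size rs -> F s <= G s) -> bern rs F <= bern rs G.
Proof.
elim: rs F G => [|r rs IH] F G /= => [_ ->//|/andP[/andP[r0 r1] rrs] FG].
by apply: lerD; rewrite ler_wpM2l ?subr_ge0// IH// => s sN; rewrite /= FG//= sN.
Qed.

Lemma bern_cat rs rs' F :
  bern (rs ++ rs') F = bern rs (fun s => bern rs' (fun s' => F (s ++ s'))).
Proof. by elim: rs F => [//|r rs IH] F /=; rewrite !IH. Qed.

Lemma bern_rev rs F : bern (rev rs) F = bern rs (F \o rev).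
Proof.
elim: rs F => [//|r rs IH] F; rewrite rev_cons -cats1 bern_cat IH /=.
rewrite -!bernZ -bernD; apply: eq_bern => s _ /=.
by rewrite !rev_cons !cats1.
Qed.

Lemma bern_negb rs F :
  bern [seq 1 - r | r <- rs] F = bern rs (F \o map negb).
Proof. by elim: rs F => [//|r rs IH] F /=; rewrite !IH/=; ring. Qed.

Definition le_seq : seq bool -> seq bool -> bool := all2 implb.

Definition incr N F := forall s s', size s = N -> le_seq s s' -> F s <= F s'.

Lemma le_seq_refl s : le_seq s s.
Proof. by elim: s => //= a s ->; case: a. Qed.

Lemma bern_mono rs rs' F : dens rs -> dens rs' -> all2 <=%R rs rs' ->
  incr (size rs) F -> bern rs F <= bern rs' F.
Proof.
elim: rs rs' F => [|r rs IH] [|r' rs'] F //=.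
move=> /andP[/andP[r0 r1] rrs] /andP[/andP[r0' r1'] rrs'] /andP[rr rsrs] iF.
have iFa a : incr (size rs) (F \o cons a).
  by move=> s s' sN ss' /=; apply: iF; rewrite /= ?sN ?ss'//; case: a.
have h0 : bern rs (F \o cons false) <= bern rs (F \o cons true).
  by apply: bern_le => // s sN /=; apply: iF; rewrite /= ?sN// le_seq_refl.
have h1 := IH rs' _ rrs rrs' rsrs (iFa true).
have h2 := IH rs' _ rrs rrs' rsrs (iFa false).
apply: (@le_trans _ _ (r' * bern rs (F \o cons true) + (1 - r') * bern rs (F \o cons false))).
  rewrite -subr_ge0.
  have : 0 <= (r' - r) * (bern rs (F \o cons true) - bern rs (F \o cons false)).
    by rewrite mulr_ge0 ?subr_ge0.
  by nra.
by apply: lerD; rewrite ler_wpM2l// subr_ge0.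
Qed.

Definition pcount (s : seq bool) : R := (count id s)%:R.

Lemma bern_var rs : dens rs ->
  bern rs (fun s => (pcount s - \sum_(r <- rs) r) ^+ 2) <= (size rs)%:R / 4.
Proof.
move=> rrs.
(* The shift [c] absorbs the centred first coordinate in the induction. *)
suff H c : bern rs (fun s => (pcount s - \sum_(r <- rs) r + c) ^+ 2) <=
    (size rs)%:R / 4 + c ^+ 2.
  by have := H 0; under eq_bern do rewrite addr0; rewrite expr0n addr0.
elim: rs rrs c => [|r rs IH] /= => [_ c|/andP[/andP[r0 r1] rrs] c].
  by rewrite big_nil /pcount /=; nra.
rewrite big_cons /comp.
rewrite (eq_bern (G := fun s => (pcount s - \sum_(j <- rs) j + (c + 1 - r)) ^+ 2)); last first.
  by move=> s _; rewrite /pcount /= natrD; congr (_ ^+ 2); rewrite [true%:R]mulr1n; ring.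
rewrite [X in _ + (_ * X)](eq_bern (G := fun s => (pcount s - \sum_(j <- rs) j + (c - r)) ^+ 2)); last first.
  by move=> s _; rewrite /pcount /= add0n; congr (_ ^+ 2); ring.
have h1 := ler_wpM2l r0 (IH rrs (c + 1 - r)).
have r1' : 0 <= 1 - r by lra.
have h2 := ler_wpM2l r1' (IH rrs (c - r)).
rewrite -(addn1 (size rs)) natrD.
apply: le_trans (lerD h1 h2) _; have := sqr_ge0 (r - 2^-1); nra.
Qed.

Lemma bern_cheb rs (H : R) : dens rs -> 0 < H ->
  bern rs (fun s => (H <= `|pcount s - \sum_(r <- rs) r|)%R%:R) <= (size rs)%:R / (4 * H ^+ 2).
Proof.
move=> rrs H0; have H2 : 0 < H ^+ 2 by rewrite exprn_gt0.
apply: (@le_trans _ _ (bern rs (fun s => (H ^+ 2)^-1 * (pcount s - \sum_(r <- rs) r) ^+ 2))).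
  apply: bern_le => // s _; case: (lerP H) => h; last by rewrite mulr_ge0 ?sqr_ge0 ?invr_ge0 ?ltW.
  rewrite mulrC ler_pdivlMr// mul1r -[leRHS]real_normK ?num_real//.
  by rewrite lerXn2r ?nnegrE// ltW.
have Hi : 0 <= (H ^+ 2)^-1 by rewrite invr_ge0 ltW.
rewrite bernZ; apply: le_trans (ler_wpM2l Hi (bern_var rrs)) _.
by rewrite le_eqVlt; apply/orP; left; apply/eqP; field; rewrite gt_eqF.
Qed.

(** The maximum over prefixes of Y ^ 2, where Y is the product of [z] along the prefix. If Y ^ 3 is
    a supermartingale, the maximal inequality bounds the probability of exceeding l by l ^ (-3/2),
    hence the mean by 1 plus the integral of l ^ (-3/2) over l > 1, which is 3. *)
Fixpoint gmax (z : bool -> R) s : R :=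
  if s is a :: s' then Num.max 1 (z a ^+ 2 * gmax z s') else 1.

Lemma gmax_ge1 z s : 1 <= gmax z s.
Proof. by case: s => //= a s; rewrite le_max lexx. Qed.

Lemma gmaxP z s v : (v <= size s)%N ->
  z true ^+ (2 * parts v s) * z false ^+ (2 * (v - parts v s)) <= gmax z s.
Proof.
elim: s v => [|a s IH] [|v] //=; rewrite ?parts0 ?expr0 ?mulr1// ?le_max ?lexx//.
rewrite ltnS => vs; apply/orP; right.
have pv : (parts v s <= v)%N.
  by rewrite /parts (leq_trans (count_size _ _))// size_take_min geq_minl.
rewrite parts_cons; apply: le_trans (ler_wpM2l (sqr_ge0 (z a)) (IH v vs)).
case: a.
  rewrite mulrA -exprD; have -> : (2 + 2 * parts v s = 2 * (true + parts v s))%N by lia.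
  by have -> : (v.+1 - (true + parts v s) = v - parts v s)%N by rewrite /=; lia.
rewrite mulrCA -exprD add0n.
by have -> : (2 + 2 * (v - parts v s) = 2 * (v.+1 - parts v s))%N by lia.
Qed.

(* The potential [x ^ 2 + 2 y ^ 3 / x] of a running maximum [x ^ 2] and a current
   value [y ^ 2]: a new maximum does not increase it, since
   [3 r ^ 2 <= 1 + 2 r ^ 3]. *)
Lemma bern_gmax z rs : (forall a, 0 < z a) -> dens rs ->
  all (fun r => r * z true ^+ 3 + (1 - r) * z false ^+ 3 <= 1) rs ->
  bern rs (gmax z) <= 3.
Proof.
move=> z0 rrs zrs.
suff H x y : 0 < y -> y <= x ->
    bern rs (fun s => Num.max (x ^+ 2) (y ^+ 2 * gmax z s)) <= x ^+ 2 + 2 * y ^+ 3 / x.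
  have := H 1 1 ltr01 (lexx _); rewrite !expr1n divr1 mulr1 => h.
  apply: le_trans (le_trans _ h) _; last by lra.
  by apply: bern_le => // s _; rewrite mul1r le_max lexx orbT.
elim: rs rrs zrs x y => [|r rs IH] /=.
  move=> _ _ x y y0 yx; rewrite mulr1 ge_max.
  have x0 : 0 < x by apply: lt_le_trans yx.
  rewrite lerDl; have p0 : 0 <= 2 * y ^+ 3 / x by rewrite divr_ge0 ?mulr_ge0 ?exprn_ge0 ?ltW.
  rewrite p0 /= -[leLHS]addr0 lerD// lerXn2r// nnegrE ltW//.
move=> /andP[/andP[r0 r1] rrs] /andP[zr zrs] x y y0 yx.
have x0 : 0 < x by apply: lt_le_trans yx.
have H a : bern rs ((fun s => Num.max (x ^+ 2) (y ^+ 2 * gmax z s)) \o cons a) <=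
    x ^+ 2 + 2 * (y ^+ 3 * z a ^+ 3) / x.
  have yz0 : 0 < y * z a by rewrite mulr_gt0.
  have -> : bern rs ((fun s => Num.max (x ^+ 2) (y ^+ 2 * gmax z s)) \o cons a) =
      bern rs (fun s => Num.max (x ^+ 2) ((y * z a) ^+ 2 * gmax z s)).
    apply: eq_bern => s _ /=; rewrite maxr_pMr ?exprn_ge0 ?ltW// mulr1 maxA.
    rewrite (max_l (x := x ^+ 2)) ?lerXn2r ?nnegrE ?(ltW x0) ?(ltW y0)//.
    by rewrite mulrA -exprMn.
  rewrite -exprMn; case: (lerP (y * z a) x) => h; first exact: IH.
  apply: (@le_trans _ _ ((y * z a) ^+ 2 + 2 * (y * z a) ^+ 3 / (y * z a))).
    apply: le_trans (IH rrs zrs (y * z a) (y * z a) yz0 (lexx _)).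
    apply: bern_le => // s _; rewrite ge_max !le_max lexx orbT andbT.
    by rewrite lerXn2r// ?nnegrE// ltW.
  set w := y * z a in h yz0 *.
  have -> : 2 * w ^+ 3 / w = 2 * w ^+ 2 by field; rewrite gt_eqF.
  rewrite -subr_ge0.
  have -> : x ^+ 2 + 2 * w ^+ 3 / x - (w ^+ 2 + 2 * w ^+ 2) =
    (w - x) ^+ 2 * (2 * w + x) / x by field; rewrite gt_eqF.
  apply: divr_ge0; last exact: ltW.
  by apply: mulr_ge0; [exact: sqr_ge0|lra].
apply: (@le_trans _ _ (x ^+ 2 + 2 * y ^+ 3 / x * (r * z true ^+ 3 + (1 - r) * z false ^+ 3))).
  have h1 := ler_wpM2l r0 (H true).
  have r1' : 0 <= 1 - r by lra.
  have h2 := ler_wpM2l r1' (H false).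
  apply: le_trans (lerD h1 h2) _; rewrite le_eqVlt; apply/orP; left; apply/eqP; ring.
rewrite lerD2l ler_piMr// divr_ge0 ?mulr_ge0 ?exprn_ge0 ?ltW//.
Qed.

(** Given the first site both factors are covered by induction; their two conditional sums are
    ordered in the same way, and Chebyshev's sum inequality for two values concludes. *)
Lemma sumb_harris N F G : incr N F -> incr N G ->
  sumb N F * sumb N G <= 2 ^+ N * sumb N (fun s => F s * G s).
Proof.
elim: N F G => [|N IH] F G iF iG /=; first by rewrite expr0 mul1r.
have ia a H : incr N.+1 H -> incr N (H \o cons a).
  by move=> iH s s' sN ss' /=; apply: iH; rewrite /= ?sN ?ss'//; case: a.
have le01 H : incr N.+1 H -> sumb N (H \o cons false) <= sumb N (H \o cons true).
  by move=> iH; apply: sumb_le => s sN /=; apply: iH; rewrite /= ?sN// le_seq_refl.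
have h1 := IH _ _ (ia true _ iF) (ia true _ iG).
have h0 := IH _ _ (ia false _ iF) (ia false _ iG).
have hF := le01 _ iF; have hG := le01 _ iG.
rewrite -subr_ge0 in hF; rewrite -subr_ge0 in hG; have := mulr_ge0 hF hG.
move: h1 h0; rewrite exprS /comp /=.
move: (sumb N _) (sumb N _) (sumb N _) (sumb N _) (sumb N _) (sumb N _) (2 ^+ N).
by move=> *; nra.
Qed.

End Bernoulli.

(** * Tilted and stationary weights *)

Section Tilt.
Variable R : realFieldType.
Implicit Types (g : seq bool -> R).

Definition jchain N (alpha beta tau : R) m (f : nat * seq bool -> R) :=
  chain (rate N alpha beta tau) (fun i : 'I_N.+1 => jupd N i) m f.

Lemma jchain_shift N alpha beta tau m y g J s :
  jchain N alpha beta tau m (fun x => y ^+ x.1 * g x.2) (J.+1, s) =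
  y * jchain N alpha beta tau m (fun x => y ^+ x.1 * g x.2) (J, s).
Proof.
rewrite /jchain -chainZ.
apply: (@chain_rel _ _ _ _ _ _ _ (fun x z => x = (z.1.+1, z.2))) => //.
  by move=> i _ z ->; rewrite /jupd /= addSn.
by move=> _ z -> /=; rewrite exprS mulrA.
Qed.

(** The one-dimensional solution D = 1 / beta, E = 1 / (1 - beta) of D E = D + E, proportional to
    the product measure of density 1 - beta. *)
Definition wBer (beta : R) (s : seq bool) : R :=
  foldr (fun a p => (if a then beta^-1 else (1 - beta)^-1) * p) 1 s.

Lemma wBer_cat beta u v : wBer beta (u ++ v) = wBer beta u * wBer beta v.
Proof. by elim: u => [|a u IH] /=; rewrite ?mul1r// IH mulrA. Qed.

Lemma bern_wBer beta N F : 0 < beta < 1 ->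
  bern (nseq N (1 - beta)) F = (beta * (1 - beta)) ^+ N * sumb N (fun s => wBer beta s * F s).
Proof.
move=> /andP[b0 b1]; have b0' : beta != 0 by rewrite gt_eqF.
have b1' : 1 - beta != 0 by rewrite subr_eq0 gt_eqF.
elim: N F => [|N IH] F /=; first by rewrite expr0 mul1r mul1r.
rewrite !IH exprS /comp /=.
rewrite (eq_sumb (N := N) (F := fun s => beta^-1 * wBer beta s * F (true :: s))
  (G := fun s => beta^-1 * (wBer beta s * F (true :: s)))); last by move=> s _; rewrite mulrA.
rewrite (eq_sumb (N := N) (F := fun s => (1 - beta)^-1 * wBer beta s * F (false :: s))
  (G := fun s => (1 - beta)^-1 * (wBer beta s * F (false :: s)))); last by move=> s _; rewrite mulrA.
rewrite !sumbZ; field; by rewrite b0' b1'.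
Qed.

(* With [y] the tilt of one jump through the left boundary, the product measure
   of density [1 - beta] is a left eigenvector of the tilted generator, with
   eigenvalue [1 - alpha - beta], whatever [alpha] is. *)
Lemma bern_tilt N alpha beta tau m y g :
  0 < alpha -> 0 < beta < 1 -> y = (1 - alpha) * (1 - beta) / (alpha * beta) ->
  bern (nseq N.+1 (1 - beta)) (fun s => jchain N.+1 alpha beta tau m
     (fun x => y ^+ x.1 * g x.2) (0%N, s)) =
  (1 + (1 - alpha - beta) * tau) ^+ m * bern (nseq N.+1 (1 - beta)) g.
Proof.
move=> a0 b01 yE; have /andP[b0 b1] := b01.
have b0' : beta != 0 by rewrite gt_eqF.
have b1' : 1 - beta != 0 by rewrite subr_eq0 gt_eqF.
have a0' : alpha != 0 by rewrite gt_eqF.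
elim: m => [|m IH].
  by rewrite expr0 mul1r; apply: eq_bern => s _; rewrite /= expr0 mul1r.
rewrite exprS -mulrA -IH {IH} !bern_wBer// mulrCA; congr (_ * _).
set f := (fun x : nat * seq bool => _).
have fS s : jchain N.+1 alpha beta tau m f (1%N, s) = y * jchain N.+1 alpha beta tau m f (0%N, s).
  exact: jchain_shift.
rewrite (eq_sumb (G := fun s => wBer beta s * step (rate N.+1 alpha beta tau)
  (fun i : 'I_N.+2 => jupd N.+1 i) (jchain N.+1 alpha beta tau m f) (0%N, s))); last by [].
rewrite (@sumb_step R alpha beta tau N (wBer beta)); first last.
- by move=> u; rewrite -cats1 wBer_cat /=; field; rewrite b0'.
- by move=> u v; rewrite !wBer_cat /=; field; rewrite b0' b1'.
rewrite mulrDl mul1r; congr (_ + _); rewrite [_ * tau]mulrC -mulrA; congr (_ * _).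
(* The coefficient of a hole at the first site already has the eigenvalue 1 - alpha - beta; matching
   the coefficient of a particle determines [y]. *)
rewrite /= -sumbD -sumbZ; apply: eq_sumb => v _ /=.
rewrite fS /= yE; field; by rewrite a0' b0' b1'.
Qed.

End Tilt.

(** * Stationary weights for the rates 1 and 1/2 *)

Section Meander.
Variable R : realFieldType.

(* [wt s h] counts the paths from [h] staying nonnegative whose [i]-th step is
   [0] or [1] if [s_i] holds and [0] or [-1] otherwise; [wt s 0] is the matrix
   product weight of [s] for the boundary rates [1] and [1/2]. *)
Fixpoint wt (s : seq bool) (h : nat) : R := match s with
  | [::] => 1
  | true :: s' => wt s' h + wt s' h.+1
  | false :: s' => wt s' h + (if h is h'.+1 then wt s' h' else 0)
  end.

Lemma wt_ge0 s h : 0 <= wt s h.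
Proof. by elim: s h => [|[] s IH] [|h] //=; rewrite ?addr_ge0. Qed.

(** Here D = 1 + up and E = 1 + down. A step up followed by a step down is always allowed and is the
    identity, so D E = 2 + up + down = D + E. *)
Lemma wt10 u v h : wt (u ++ true :: false :: v) h =
  wt (u ++ true :: v) h + wt (u ++ false :: v) h.
Proof.
elim: u h => [|[] u IH] [|h] /=; rewrite ?IH; ring.
Qed.

Lemma wt_rcons u h : 2^-1 * wt (rcons u true) h = wt u h.
Proof.
elim: u h => [|[] u IH] [|h] /=; rewrite ?mulrDr ?IH ?mulr0//; by field.
Qed.

Lemma wt_leS s h : wt s h <= wt s h.+1.
Proof.
elim: s h => [|[] s IH] h //=; first by rewrite lerD.
by case: h => [|h]; rewrite lerD// wt_ge0.
Qed.

(** By Harris' inequality an increasing function then has a larger mean under the stationary measure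
    than under density 1/2. *)
Lemma wt_incr N h : incr N (wt^~ h).
Proof.
elim: N h => [|N IH] h [|a s] [|b s'] //= [sN] /andP[ab ss'].
have h1 k := IH k s s' sN ss'.
have h2 : (if h is h'.+1 then wt s h' else 0) <= wt s h.+1.
  by case: h => [|h]; rewrite ?wt_ge0// (le_trans (wt_leS _ _)) ?wt_leS.
case: a b ab => [] [] // _; rewrite lerD//; last by case: (h).
exact: le_trans (h1 _).
Qed.

Definition wtsum N h : R := sumb N (wt^~ h).

Definition lap (g : nat -> R) (h : nat) : R :=
  2 * g h + g h.+1 + (if h is h'.+1 then g h' else 0).

Lemma wtsumS N h : wtsum N.+1 h = lap (wtsum N) h.
Proof.
rewrite /wtsum /lap /= /comp /= !sumbD.
case: h => [|h]; last by ring.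
by rewrite sumb_cst; ring.
Qed.

(** The function [h.+1] is an eigenfunction of [lap] of eigenvalue 4, and the commutator of [lap]
    with multiplication by [h.+1] cancels the contribution of the first site. At h = 0 this gives
    the mean number of particles of the stationary measure. *)
Lemma wtsum_height N h :
  sumb N (fun s => wt s h * (2 * pcount R s - N%:R)) = (4 ^+ N - wtsum N h) * h.+1%:R.
Proof.
elim: N h => [|N IH] h; first by rewrite /wtsum /pcount /= expr0 subrr mul0r mul1r mulr0 subrr.
rewrite wtsumS /= /comp /=.
rewrite (eq_sumb (G := fun s => (wt s h * (2 * pcount R s - N%:R) + wt s h.+1 * (2 * pcount R s - N%:R))
  + (wt s h + wt s h.+1))); last first.
  by move=> s _; rewrite /pcount /= natrD -(natr1 N); ring.
rewrite [X in _ + X](eq_sumb (G := fun s => (wt s h * (2 * pcount R s - N%:R)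
   + (if h is h'.+1 then wt s h' else 0) * (2 * pcount R s - N%:R))
  - (wt s h + (if h is h'.+1 then wt s h' else 0)))); last first.
  by move=> s _; rewrite /pcount /= add0n -(natr1 N); case: (h) => [|k]; ring.
rewrite sumbB !sumbD !IH exprS -!/(wtsum _ _) /lap.
case: h => [|h].
  rewrite (eq_sumb (G := fun=> 0)) ?sumb_cst; last by move=> s _; rewrite mul0r.
  ring.
by rewrite IH -/(wtsum _ _) -(natr1 h.+1) -(natr1 h); ring.
Qed.

(** Reflection principle: splitting each step into two half steps gives a simple walk of length 2 N
    from 0 to 2 h, reflected at the forbidden level -2. *)
Definition ballot N h : R := 'C(2 * N, N + h)%:R - 'C(2 * N, N + h.+2)%:R.

Lemma ballot_gt N h : (N < h)%N -> ballot N h = 0.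
Proof. by move=> Nh; rewrite /ballot !bin_small ?subrr//; lia. Qed.

Lemma ballotS N h : ballot N.+1 h =
  2 * ballot N h + ballot N h.+1 + (if h is h'.+1 then ballot N h' else 0).
Proof.
rewrite /ballot; have -> : (2 * N.+1 = (2 * N).+2)%N by lia.
case: h => [|h].
  rewrite !addn0 !addnS !addn0 !binS.
  have e : ('C((2 * N).+1, N) = 'C((2 * N).+1, N.+1))%N.
    by rewrite -[LHS]bin_sub; [congr ('C(_, _)); lia|lia].
  rewrite !binS in e *; rewrite !natrD.
  have e' := congr1 (fun k => k%:R : R) e.
  rewrite /= in e'.
  move: e'; rewrite ?natrD => e'.
  lra.
rewrite !addSn !addnS !binS !natrD; ring.
Qed.

Lemma iter_lap N g : iter N lap g 0%N = \sum_(h < N.+1) ballot N h * g h.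
Proof.
elim: N g => [|N IH] g.
  by rewrite big_ord1 /= /ballot bin0 bin_small// subr0 mul1r.
rewrite iterSr IH /lap.
have -> : \sum_(h < N.+2) ballot N.+1 h * g h =
  \sum_(h < N.+2) 2 * ballot N h * g h + \sum_(h < N.+2) ballot N h.+1 * g h +
  \sum_(h < N.+2) (if h : nat is h'.+1 then ballot N h' else 0) * g h.
  by rewrite -!big_split /=; apply: eq_bigr => h _; rewrite ballotS; case: (nat_of_ord h) => [|k]; ring.
have -> : \sum_(h < N.+2) 2 * ballot N h * g h = \sum_(h < N.+1) 2 * ballot N h * g h.
  by rewrite big_ord_recr /= ballot_gt// mulr0 mul0r addr0.
have -> : \sum_(h < N.+2) ballot N h.+1 * g h =
  \sum_(h < N.+1) ballot N h * (if h : nat is h'.+1 then g h' else 0).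
  rewrite [RHS]big_ord_recl mulr0 add0r big_ord_recr big_ord_recr /=.
  rewrite !ballot_gt ?mul0r ?addr0; [|lia|lia].
  by apply: eq_bigr => h _ /=; rewrite /bump add1n.
rewrite [X in _ = _ + X]big_ord_recl mul0r add0r /=.
rewrite -!big_split /=; apply: eq_bigr => h _; case: (nat_of_ord h) => [|k]; ring.
Qed.

Lemma wtsum_bin N : wtsum N 0 = 'C((2 * N).+1, N.+1)%:R.
Proof.
have -> : wtsum N 0 = iter N lap (fun=> 1) 0.
  have : wtsum N =1 iter N lap (fun=> 1).
    elim: N => [|N IH] h //; rewrite wtsumS /= /lap !IH; by case: h => // h; rewrite !IH.
  exact.
rewrite iter_lap (eq_bigr (fun h : 'I_N.+1 => - ('C(2 * N, N + h.+2)%:R - 'C(2 * N, N + h)%:R))); last first.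
  by move=> h _; rewrite mulr1 opprB.
rewrite sumrN.
have -> : forall n, \sum_(h < n) ('C(2 * N, N + h.+2)%:R - 'C(2 * N, N + h)%:R) =
   'C(2 * N, N + n.+1)%:R + 'C(2 * N, N + n)%:R - 'C(2 * N, N + 1)%:R - 'C(2 * N, N)%:R :> R.
  elim=> [|n IH]; first by rewrite big_ord0 addn0 addn1; ring.
  by rewrite big_ord_recr IH /= !addnS; ring.
rewrite (@bin_small (2 * N) (N + N.+2)) ?(@bin_small (2 * N) (N + N.+1)); [|lia|lia].
rewrite binS natrD addn1; ring.
Qed.

Lemma wtsum_rec N : N.+2%:R * wtsum N.+1 0 = (2 * (2 * N + 3))%:R * wtsum N 0.
Proof.
rewrite !wtsum_bin -!natrM; congr _%:R.
have e1 := mul_bin_diag (2 * N).+3 N.+1.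
have e2 : ('C((2 * N).+2, N.+1) = 2 * 'C((2 * N).+1, N.+1))%N.
  rewrite binS [RHS]mul2n -addnn; congr (_ + _)%N.
  by rewrite -[LHS]bin_sub; [congr ('C(_, _)); lia|lia].
have -> : ((2 * N.+1).+1 = (2 * N).+3)%N by lia.
rewrite -e1 /= e2; lia.
Qed.

Lemma wtsum_gt0 N : 0 < wtsum N 0.
Proof. by rewrite wtsum_bin ltr0n bin_gt0; lia. Qed.

(** A weak Stirling bound, by induction on the exact ratio; it keeps the excess of particles of the
    stationary measure of order the square root of N. *)
Lemma wtsum_sqr N : 16 ^+ N <= N.+1%:R * wtsum N 0 ^+ 2.
Proof.
elim: N => [|N IH]; first by rewrite wtsum_bin /= bin1; lra.
have e := wtsum_rec N.
have p2 : 0 < N.+2%:R :> R by rewrite ltr0n.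
have p1 : 0 < N.+1%:R :> R by rewrite ltr0n.
rewrite -(ler_pM2l p2) exprS.
have -> : N.+2%:R * (N.+2%:R * wtsum N.+1 0 ^+ 2) = (N.+2%:R * wtsum N.+1 0) ^+ 2 by ring.
rewrite e exprMn.
have e2 : 16 * N.+2%:R * N.+1%:R <= (2 * (2 * N + 3))%:R ^+ 2 :> R.
  by rewrite -natrX -!natrM ler_nat; lia.
rewrite -(ler_pM2l p1).
apply: (@le_trans _ _ ((16 * N.+2%:R * N.+1%:R) * (N.+1%:R * wtsum N 0 ^+ 2))).
  have -> : N.+1%:R * (N.+2%:R * (16 * 16 ^+ N)) = (16 * N.+2%:R * N.+1%:R) * 16 ^+ N :> R by ring.
  by rewrite ler_pM2l// !mulr_gt0.
rewrite [leRHS]mulrCA; apply: ler_wpM2r => //.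
by rewrite mulr_ge0 ?sqr_ge0.
Qed.

(* The current of the stationary state is [wtsum N 0 / wtsum N.+1 0]. *)
Lemma wt_current N tau m :
  sumb N.+1 (fun s => wt s 0 * jchain N.+1 1 2^-1 tau m (fun x => x.1%:R) (0%N, s)) =
  m%:R * tau * wtsum N 0.
Proof.
elim: m => [|m IH].
  rewrite !mul0r (eq_sumb (G := fun=> 0)) ?sumb_cst ?mulr0// => s _.
  by rewrite /jchain /= mulr0.
have fS s : jchain N.+1 1 2^-1 tau m (fun x => x.1%:R) (1%N, s) =
   1 + jchain N.+1 1 2^-1 tau m (fun x => x.1%:R) (0%N, s).
  rewrite /jchain -[X in X + _](@chain_cst R _ (rate N.+1 1 2^-1 tau) _ (fun i : 'I_N.+2 => jupd N.+1 i) m 1 (0%N, s)) -chainD.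
  apply: (@chain_rel _ _ _ _ _ _ _ (fun x z => x = (z.1.+1, z.2))) => //.
    by move=> i _ z ->; rewrite /jupd /= addSn.
  by move=> _ z -> /=; rewrite -nat1r.
rewrite (eq_sumb (G := fun s => wt s 0 * step (rate N.+1 1 2^-1 tau)
  (fun i : 'I_N.+2 => jupd N.+1 i) (jchain N.+1 1 2^-1 tau m (fun x => x.1%:R)) (0%N, s))); last by [].
rewrite (@sumb_step R 1 2^-1 tau N (wt^~ 0%N)); first last.
- by move=> u; exact: wt_rcons.
- by move=> u v; exact: wt10.
rewrite IH -(natr1 m) 2![in RHS]mulrDl mul1r; congr (_ + _ * _).
by apply: eq_sumb => v _ /=; rewrite fS; ring.
Qed.

End Meander.

(** * Elementary bounds on the exponential *)

Section Exp.
Variable R : realType.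
Implicit Types (x y u : R).

Lemma expR_le_quad y : y <= 2^-1 -> expR y <= 1 + y + 2 * y ^+ 2.
Proof.
move=> y2; have h := expR_ge1Dx (- y).
have y1 : 0 < 1 - y by lra.
have e0 := expR_gt0 (- y).
rewrite -[y in expR y]opprK expRN.
apply: (@le_trans _ _ (1 - y)^-1); first by rewrite lef_pV2 ?posrE.
rewrite -(ler_pM2l y1) mulfV ?gt_eqF//.
have : 0 <= y ^+ 2 * (1 - 2 * y) by rewrite mulr_ge0 ?sqr_ge0//; lra.
by move=> ?; nra.
Qed.

Lemma expR_ge_cubic x : 0 <= x -> 1 + x + x ^+ 2 / 2 + x ^+ 3 / 6 <= expR x.
Proof.
move=> x0; rewrite /expR.
apply: le_trans (nondecreasing_cvgn_le _ _ 4%N); last 2 first.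
- by apply: nondecreasing_series => n _ _; exact: exp_coeff_ge0.
- exact: is_cvg_series_exp_coeff.
rewrite /series /= !big_nat_recr//= big_geq// /exp_coeff /=.
by rewrite !factS fact0; lra.
Qed.

(** With [expR_artanh] this brackets artanh u between u and u + 2 u ^ 3; the tilt is 2 artanh (2
    x). *)
Lemma expR_tanh u : 0 <= u < 1 -> expR (2 * u) * (1 - u) <= 1 + u.
Proof.
move=> /andP[u0 u1]; have u1' : 0 < 1 - u by lra.
rewrite -ler_pdivlMr// /expR; apply: limr_le; first exact: is_cvg_series_exp_coeff.
exists 1%N => // n /= n1; rewrite ler_pdivlMr//.
(* The right-hand side is 1 - u times the partial sum of 1 + 2 u + 2 u ^ 2 + ..., and the terms are
   compared through 2 ^ n <= 2 n!. *)
suff : series (exp_coeff (2 * u)) n * (1 - u) <= 1 + u - 2 * u ^+ n.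
  by have := exprn_ge0 n u0; lra.
elim: n n1 => // -[|n] IH _.
  by rewrite /series /= big_nat1 /exp_coeff /= expr0 fact0; lra.
have {}IH := IH isT.
rewrite seriesSr mulrDl.
have h : exp_coeff (2 * u) n.+1 <= 2 * u ^+ n.+1.
  rewrite /exp_coeff /= exprMn ler_pdivrMr ?ltr0n ?fact_gt0// mulrAC.
  apply: ler_wpM2r; first exact: exprn_ge0.
  rewrite -natrX -natrM ler_nat.
  by elim: n {IH} => // n IH; rewrite expnS factS; nia.
have := ler_wpM2r (ltW u1') h; rewrite [u ^+ n.+2]exprS; lra.
Qed.

Lemma expR_artanh u : 0 <= u <= 2^-1 -> 1 + u <= (1 - u) * expR (2 * u + 4 * u ^+ 3).
Proof.
move=> /andP[u0 u1].
have h := @expR_ge_cubic (2 * u + 4 * u ^+ 3) ltac:(by rewrite addr_ge0 ?mulr_ge0 ?exprn_ge0).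
have u1' : 0 <= 1 - u by lra.
apply: le_trans (ler_wpM2l u1' h).
set c := u ^+ 3.
have c0 : 0 <= c by rewrite exprn_ge0.
have h1 : 1 + (2 * u + 4 * c) + (2 * u) ^+ 2 / 2 + (2 * u) ^+ 3 / 6 <=
  1 + (2 * u + 4 * c) + (2 * u + 4 * c) ^+ 2 / 2 + (2 * u + 4 * c) ^+ 3 / 6.
  rewrite lerD// ?lerD// ler_pM2r//.
    by rewrite lerXn2r ?nnegrE; lra.
  by rewrite lerXn2r ?nnegrE; lra.
apply: le_trans (ler_wpM2l u1' h1).
have -> : (2 * u) ^+ 3 / 6 = 4 / 3 * c by rewrite /c; field.
have e : u ^+ 3 = c by [].
have : 0 <= c * (1 - 2 * u) by rewrite mulr_ge0//; lra.
have -> : (2 * u) ^+ 2 / 2 = 2 * u ^+ 2 by field.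
move=> ?; have e4 : u * u ^+ 2 = c by rewrite /c exprS.
nra.
Qed.

Lemma pow_le_expR x m : 0 <= 1 + x -> (1 + x) ^+ m <= expR (m%:R * x).
Proof.
move=> x0; rewrite mulrC expRM_natr; apply: lerXn2r; rewrite ?nnegrE ?expR_ge0//.
exact: expR_ge1Dx.
Qed.

End Exp.

(** * Comparison of height processes *)

Section HChain.
Variable R : realFieldType.

Definition hchain N (alpha beta tau : R) m (f : height -> R) :=
  chain (rate N alpha beta tau) (fun i : 'I_N.+1 => upd N i) m f.

Definition start (s : seq bool) : height := hgt (0%N, s).

(** Heights are functions on all integers but describe the bonds 0, ..., N only, so observables must
    not look further. *)
Definition local N (f : height -> R) :=
  forall n n', (forall v, (v <= N)%N -> n v = n' v) -> f n = f n'.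

Lemma upd_local N x n n' : (x <= N)%N -> (forall v, (v <= N)%N -> n v = n' v) ->
  forall v, (v <= N)%N -> upd N x n v = upd N x n' v.
Proof.
move=> xN nn' v vN; apply/eqP; rewrite eq_le; apply/andP; split;
  by apply: (@upd_mono N) => // w wN; rewrite nn'.
Qed.

Lemma hchain_jchain N alpha beta tau m f s n : local N f -> (0 < N)%N ->
  size s = N -> (forall v, (v <= N)%N -> n v = start s v) ->
  hchain N alpha beta tau m f n = jchain N alpha beta tau m (f \o hgt) (0%N, s).
Proof.
move=> fN N0 sN ns.
apply: (@chain_rel _ _ _ _ _ _ _ (fun x (z : nat * seq bool) => size z.2 = N /\
   forall v, (v <= N)%N -> x v = hgt z v)) => //.
  move=> i x z [zN xz]; rewrite size_cupd zN; split=> // v vN.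
  have iN : (i <= N)%N by rewrite -ltnS.
  by rewrite hgt_upd//; apply: upd_local.
by move=> x z [_ xz]; apply: fN.
Qed.

Lemma sum_rate_le N (alpha beta tau : R) : (0 < N)%N -> 0 <= tau ->
  tau * (alpha + beta + N%:R) <= 1 -> \sum_i rate N alpha beta tau i <= 1.
Proof.
case: N => // N _ t0; rewrite sum_rate; apply: le_trans.
by rewrite ler_wpM2l// lerD2l ler_nat.
Qed.

(** Unlike configurations, heights are increasing in both boundary rates. The shift [D] allows for
    different initial numbers of particles. *)
Lemma hchain_le N (alpha1 beta1 alpha2 beta2 tau : R) m f1 f2 n1 n2 (D : int) :
  (0 < N)%N -> 0 <= alpha1 <= alpha2 -> 0 <= beta1 <= beta2 -> 0 <= tau ->
  tau * (alpha2 + beta2 + N%:R) <= 1 ->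
  valid N n1 -> valid N n2 -> below N n1 (fun v => n2 v + D) ->
  (forall n1 n2, below N n1 (fun v => n2 v + D) -> f1 n1 <= f2 n2) ->
  hchain N alpha1 beta1 tau m f1 n1 <= hchain N alpha2 beta2 tau m f2 n2.
Proof.
move=> N0 /andP[a0 a12] /andP[b0 b12] t0 t1 v1 v2 n12 f12.
apply: (@chain_couple _ _ _ _ _ _ _ _ (fun n1 n2 => [/\ valid N n1, valid N n2 &
   below N n1 (fun v => n2 v + D)])) => //.
- by move=> i; apply: rate_ge0.
- by move=> i; apply: rate_ge0 => //; [exact: le_trans a12|exact: le_trans b12].
- under eq_bigr do rewrite max_rate//.
  by rewrite (max_r a12) (max_r b12); exact: sum_rate_le.
- move=> i x1 x2 [u1 u2 x12]; have iN : (i <= N)%N by rewrite -ltnS.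
  split; [exact: upd_valid|exact: upd_valid|].
  by move=> v vN; rewrite -upd_shift; exact: upd_mono.
- move=> i x1 x2 _ [u1 u2 x12]; have iN : (i <= N)%N by rewrite -ltnS.
  split; [by []|exact: upd_valid|].
  by move=> v vN; apply: le_trans (x12 v vN) _; rewrite lerD2r; exact: upd_ge.
- move=> i x1 x2; rewrite ltNge /rate ler_wpM2l//.
  by do 2?case: eqP.
- by move=> x1 x2 [_ _ x12]; exact: f12.
Qed.

Lemma hchain_ge N (alpha1 beta1 alpha2 beta2 tau : R) m f1 f2 n1 n2 (D : int) :
  (0 < N)%N -> 0 <= alpha1 <= alpha2 -> 0 <= beta1 <= beta2 -> 0 <= tau ->
  tau * (alpha2 + beta2 + N%:R) <= 1 ->
  valid N n1 -> valid N n2 -> below N n1 (fun v => n2 v + D) ->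
  (forall n1 n2, below N n1 (fun v => n2 v + D) -> f2 n2 <= f1 n1) ->
  hchain N alpha2 beta2 tau m f2 n2 <= hchain N alpha1 beta1 tau m f1 n1.
Proof.
move=> N0 a12 b12 t0 t1 v1 v2 n12 f12.
rewrite -lerN2 -[leLHS]mulN1r -[leRHS]mulN1r /hchain -!chainZ.
by apply: hchain_le (n12) _ => // x1 x2 /f12; rewrite !mulN1r lerN2.
Qed.

Lemma hchain_pw N (alpha beta tau : R) m f g n :
  (0 < N)%N -> 0 <= alpha -> 0 <= beta -> 0 <= tau ->
  tau * (alpha + beta + N%:R) <= 1 -> (forall n, f n <= g n) ->
  hchain N alpha beta tau m f n <= hchain N alpha beta tau m g n.
Proof.
move=> N0 a0 b0 t0 t1 fg.
have r0 i : 0 <= rate N alpha beta tau i by exact: rate_ge0.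
by apply: (chain_le r0 (sum_rate_le N0 t0 t1) (P := fun=> True)).
Qed.

Lemma jchain_pw N (alpha beta tau : R) m f g J s :
  (0 < N)%N -> 0 <= alpha -> 0 <= beta -> 0 <= tau ->
  tau * (alpha + beta + N%:R) <= 1 ->
  (forall x, size x.2 = N -> f x <= g x) -> size s = N ->
  jchain N alpha beta tau m f (J, s) <= jchain N alpha beta tau m g (J, s).
Proof.
move=> N0 a0 b0 t0 t1 fg sN.
have r0 i : 0 <= rate N alpha beta tau i by exact: rate_ge0.
apply: (chain_le r0 (sum_rate_le N0 t0 t1) (P := fun x => size x.2 = N)) => //.
by move=> i x; rewrite size_cupd.
Qed.

Lemma hchain_cst N (alpha beta tau : R) m k n :
  hchain N alpha beta tau m (fun=> k) n = k.
Proof. exact: chain_cst. Qed.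

Lemma start_valid N s : valid N (start s).
Proof. exact: hgt_valid. Qed.

Lemma start_le0 s v : start s v <= 0.
Proof. by rewrite /start /hgt /=; lia. Qed.

End HChain.
Arguments hchain {R} N alpha beta tau m f n.

(** * The current through the left boundary *)

Section LowerTail.
Variable R : realType.

(* For the rates [1/2] and [1/2 + x], the tilt [y] of [bern_tilt] is
   [expR (- tilt x)]. *)
Definition tilt (x : R) : R := ln ((2^-1 + x) / (2^-1 - x)).

Lemma expR_tilt x : - 2^-1 < x < 2^-1 -> expR (tilt x) = (2^-1 + x) / (2^-1 - x).
Proof. by move=> /andP[x0 x1]; rewrite lnK// posrE divr_gt0; lra. Qed.

Lemma tilt_ge x : 0 <= x -> x < 2^-1 -> 4 * x <= tilt x.
Proof.
move=> x0 x1; rewrite -ler_expR expR_tilt; last by lra.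
rewrite ler_pdivlMr; last by lra.
have := @expR_tanh R (2 * x) ltac:(lra).
have -> : 2 * (2 * x) = 4 * x by ring.
lra.
Qed.

Lemma tilt_le x : 0 <= x -> x <= 4^-1 -> tilt x <= 4 * x + 32 * x ^+ 3.
Proof.
move=> x0 x1; rewrite -ler_expR expR_tilt; last by lra.
rewrite ler_pdivrMr; last by lra.
have := @expR_artanh R (2 * x) ltac:(lra).
have -> : 2 * (2 * x) + 4 * (2 * x) ^+ 3 = 4 * x + 32 * x ^+ 3 by ring.
lra.
Qed.

(** The parameter [r] sets the density and the matching exit rate, [a] the entrance rate; the tilt
    of [bern_tilt] then becomes the exponential of [tilt r - tilt a]. *)
Lemma tail_gen n (a r tau y : R) m g :
  - 4^-1 <= r <= 4^-1 -> 0 <= a <= 4^-1 -> 0 <= tau ->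
  tau * (1 + n.+1%:R) <= 1 -> (forall s, 0 <= g s) ->
  bern (nseq n.+1 (2^-1 + r)) (fun s => jchain n.+1 (2^-1 + a) (2^-1 - r) tau m
    (fun x => expR (- (tilt a - tilt r) * (x.1%:R - y)) * g x.2) (0%N, s)) <=
  expR ((tilt a - tilt r) * y + (r - a) * (m%:R * tau)) * bern (nseq n.+1 (2^-1 + r)) g.
Proof.
move=> r4 /andP[a0 a4] t0 t1 g0; set s := tilt a - tilt r.
have n0 : 0 <= n.+1%:R :> R by [].
have -> : 2^-1 + r = 1 - (2^-1 - r) by field.
rewrite (eq_bern (G := fun z => expR (s * y) * jchain n.+1 (2^-1 + a) (2^-1 - r) tau m
   (fun x => expR (- s) ^+ x.1 * g x.2) (0%N, z))); last first.
  move=> z _; rewrite /jchain -chainZ; apply: eq_chain => x.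
  by rewrite mulrA -expRM_natr -expRD; congr (expR _ * _); ring.
rewrite bernZ bern_tilt; [|lra|lra|]; last first.
  rewrite /s opprB expRB !expR_tilt; [|lra|lra].
  field; do ?[apply/andP; split]; apply/eqP; lra.
have -> : 1 - (2^-1 + a) - (2^-1 - r) = r - a by field.
rewrite [leLHS]mulrA [in leRHS]expRD; apply: ler_wpM2r.
  rewrite -[leLHS](bern_cst (nseq n.+1 (1 - (2^-1 - r))) 0).
  by apply: bern_le => //; rewrite /dens all_nseq /=; lra.
apply: ler_wpM2l; first exact: expR_ge0.
have -> : (r - a) * (m%:R * tau) = m%:R * ((r - a) * tau) by ring.
apply: pow_le_expR.
have : 0 <= tau * (2^-1 + (r - a)) by rewrite mulr_ge0//; lra.
have : 0 <= tau * n.+1%:R by rewrite mulr_ge0.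
lra.
Qed.

Lemma oppr_tilt x : - 2^-1 < x < 2^-1 -> tilt (- x) = - tilt x.
Proof.
move=> x1; apply: expR_inj; rewrite expRN !expR_tilt; [|lra|lra].
by rewrite opprK invf_div.
Qed.

Lemma tilt0 : tilt 0 = 0.
Proof. by rewrite /tilt subr0 addr0 divff ?ln1. Qed.

(** With p the exponential of tilt x / 4, the weights p ^ 4 and p ^ (-4) have mean 1, while p ^ 2
    and p ^ (-2) have mean sqrt (1 - 4 x ^ 2). The cubes needed by [bern_gmax] lie in between, and
    the gain x ^ 2 pays for the drift [x / 8]. *)
Lemma gmax_tilt n x : 0 <= x <= 6^-1 ->
  bern (nseq n (2^-1 - x))
    (gmax (fun a => expR (tilt x / 2 * (a%:R - 2^-1 + x / 8)))) <= 3.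
Proof.
move=> /andP[x0 x6]; set s := tilt x.
have s1 : s <= 5 * x.
  have := @tilt_le x x0 ltac:(lra).
  have : 0 <= x * (6^-1 - x) * (6^-1 + x) by rewrite !mulr_ge0; lra.
  by rewrite -/s; nra.
have s0 : 0 <= s by have := @tilt_ge x x0 ltac:(lra); rewrite -/s; lra.
apply: bern_gmax.
- by move=> a; exact: expR_gt0.
- by rewrite /dens all_nseq; apply/orP; right; lra.
rewrite all_nseq; apply/orP; right.
rewrite -!expRM_natr.
set p := expR (s / 4); have p0 : 0 < p by exact: expR_gt0.
have p4 : p ^+ 4 = (2^-1 + x) / (2^-1 - x).
  by rewrite -expRM_natr -expR_tilt; [congr expR; rewrite -/s; field|lra].
have -> : s / 2 * (true%:R - 2^-1 + x / 8) * 3%:R = s / 4 * 3%:R + 3 / 16 * s * x.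
  by rewrite mulr1n; field.
have -> : s / 2 * (false%:R - 2^-1 + x / 8) * 3%:R = - (s / 4 * 3%:R) + 3 / 16 * s * x.
  by rewrite mulr0n; field.
rewrite !expRD expRN !expRM_natr -/p.
set e := expR _.
have e1 : e * (1 - x ^+ 2) <= 1.
  have h : 1 - x ^+ 2 <= expR (- x ^+ 2) by exact: expR_ge1Dx.
  have x1 : 0 <= 1 - x ^+ 2 by nra.
  apply: (@le_trans _ _ (expR (x ^+ 2) * expR (- x ^+ 2))); last by rewrite -expRD subrr expR0.
  by apply: ler_pM => //; [exact: expR_ge0|rewrite ler_expR; nra].
suff h : (2^-1 - x) * p ^+ 3 + (1 - (2^-1 - x)) * (p ^+ 3)^-1 <= 1 - x ^+ 2.
  have e0 : 0 <= e by exact: expR_ge0.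
  have := ler_wpM2l e0 h; nra.
(* The weight of the AM-GM inequality, close to optimal: k (1/2 - x ^ 2) = 1/2 - 2 x ^ 4, and 1 / (2
   k) provides the gain x ^ 2. *)
set k := 1 + 2 * x ^+ 2; have k0 : 0 < k by rewrite /k; nra.
have am (w : R) : 0 < w -> w ^+ 3 <= 2^-1 * (k * w ^+ 2 + w ^+ 4 / k).
  move=> w0; rewrite -subr_ge0.
  have -> : 2^-1 * (k * w ^+ 2 + w ^+ 4 / k) - w ^+ 3 = 2^-1 * (w ^+ 2 * (k - w) ^+ 2 / k).
    by field; rewrite gt_eqF.
  apply: mulr_ge0; first lra.
  by apply: divr_ge0; [apply: mulr_ge0; exact: sqr_ge0|exact: ltW].
have h1 := am p p0; have h2 := am p^-1 ltac:(by rewrite invr_gt0).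
have c1 : 0 <= 2^-1 - x by lra.
have c2 : 0 <= 1 - (2^-1 - x) by lra.
rewrite -exprVn.
apply: le_trans (lerD (ler_wpM2l c1 h1) (ler_wpM2l c2 h2)) _.
have -> : p^-1 ^+ 4 = (2^-1 - x) / (2^-1 + x) by rewrite exprVn p4 invf_div.
rewrite p4.
set A := (2^-1 - x) * p ^+ 2.
have A0 : 0 <= A by apply: mulr_ge0 => //; exact: sqr_ge0.
have A2 : A ^+ 2 = 4^-1 - x ^+ 2.
  have -> : A ^+ 2 = (2^-1 - x) ^+ 2 * p ^+ 4 by rewrite /A; ring.
  by rewrite p4; field; apply/eqP; lra.
have AV : (1 - (2^-1 - x)) * p^-1 ^+ 2 = A.
  have -> : p^-1 ^+ 2 = p ^+ 2 * p^-1 ^+ 4 by field; rewrite gt_eqF.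
  have -> : p^-1 ^+ 4 = (2^-1 - x) / (2^-1 + x) by rewrite exprVn p4 invf_div.
  by rewrite /A; field; apply/eqP; lra.
have Ax : A <= 2^-1 - x ^+ 2.
  rewrite -(@ler_pXn2r _ 2%N)// ?nnegrE//; last by nra.
  by rewrite A2; nra.
have -> : (2^-1 - x) * (2^-1 * (k * p ^+ 2 + (2^-1 + x) / (2^-1 - x) / k)) +
  (1 - (2^-1 - x)) * (2^-1 * (k * p^-1 ^+ 2 + (2^-1 - x) / (2^-1 + x) / k)) =
  2^-1 * k * (A + (1 - (2^-1 - x)) * p^-1 ^+ 2) + 2^-1 / k.
  by rewrite /A; field; do ?[apply/andP; split]; apply/eqP; lra.
rewrite AV.
have ik : k^-1 <= 1 - 2 * x ^+ 2 + 4 * x ^+ 4.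
  rewrite -(ler_pM2l k0) mulfV ?gt_eqF// /k.
  have : 0 <= x ^+ 6 by rewrite exprn_ge0.
  have -> : (1 + 2 * x ^+ 2) * (1 - 2 * x ^+ 2 + 4 * x ^+ 4) = 1 + 8 * x ^+ 6 by ring.
  lra.
have := ler_wpM2l (ltW k0) Ax.
have : k * (2^-1 - x ^+ 2) = 2^-1 - 2 * x ^+ 4 by rewrite /k; field.
lra.
Qed.

(** The densities exceed 1/2 by at most half of the subtracted drift [x / 8]; the other half absorbs
    the second-order term. *)
Lemma gmax_excess (rs : seq R) x : 0 <= x <= 6^-1 ->
  all (fun r => 0 <= r <= 2^-1 + x / 16) rs ->
  bern rs (gmax (fun a => expR (x / 24 * (a%:R - 2^-1 - x / 8)))) <= 3.
Proof.
move=> /andP[x0 x6] rx; apply: bern_gmax.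
- by move=> a; exact: expR_gt0.
- by apply: sub_all rx => r; lra.
apply: sub_all rx => r /andP[r0 r1].
rewrite -!expRM_natr.
have -> : x / 24 * (true%:R - 2^-1 - x / 8) * 3%:R = x / 16 - x ^+ 2 / 64.
  by rewrite mulr1n; field.
have -> : x / 24 * (false%:R - 2^-1 - x / 8) * 3%:R = - (x / 16) - x ^+ 2 / 64.
  by rewrite mulr0n; field.
rewrite !expRD.
have h1 := @expR_le_quad R (x / 16) ltac:(lra).
have h2 := @expR_le_quad R (- (x / 16)) ltac:(lra).
have r1' : 0 <= 1 - r by lra.
set e := expR (- (x ^+ 2 / 64)).
rewrite 2!mulrA -mulrDl.
have e0 : 0 <= e by exact: expR_ge0.
apply: (@le_trans _ _ (expR (x ^+ 2 / 64) * e)); last by rewrite -expRD subrr expR0.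
apply: ler_wpM2r => //.
have h3 := expR_ge1Dx (x ^+ 2 / 64).
apply: le_trans (lerD (ler_wpM2l r0 h1) (ler_wpM2l r1' h2)) _.
apply: le_trans h3.
have : 0 <= x * (2^-1 + x / 16 - r) by rewrite mulr_ge0//; lra.
nra.
Qed.

End LowerTail.

Section LeftLower.
Variable R : realType.

Lemma gmax_expR (c d : R) s v : (v <= size s)%N ->
  expR (2 * c * ((parts v s)%:R - v%:R * (2^-1 - d))) <=
  gmax (fun a : bool => expR (c * (a%:R - 2^-1 + d))) s.
Proof.
move=> vs; apply: le_trans (gmaxP _ vs).
have pv : (parts v s <= v)%N.
  by rewrite /parts (leq_trans (count_size _ _))// size_take_min geq_minl.
rewrite -!expRM_natr -expRD ler_expR !natrM natrB//.
by rewrite /= mulr1n mulr0n le_eqVlt; apply/orP; left; apply/eqP; field.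
Qed.

(** The slope [x / 8] is the drift that [gmax_tilt] tolerates in the dual process. *)
Definition excess N (x H : R) (s : seq bool) : bool :=
  has (fun v => v%:R / 2 + H + x / 8 * v%:R < (parts v s)%:R) (iota 0 N.+1).

Lemma bern_excess (rs : seq R) x H : 0 <= x <= 6^-1 ->
  all (fun r => 0 <= r <= 2^-1 + x / 16) rs ->
  bern rs (fun s => (excess (size rs) x H s)%:R) <= 3 * expR (- (x * H / 12)).
Proof.
move=> x06 rx; have /andP[x0 x6] := x06.
rewrite mulrC; apply: le_trans (ler_wpM2l (expR_ge0 _) (gmax_excess x06 rx)).
rewrite -bernZ; apply: bern_le; first by apply: sub_all rx => r; lra.
move=> s sN; rewrite /excess; case: hasP => [[v]|_]; last first.
  by rewrite mulr_ge0 ?expR_ge0// (le_trans ler01)// gmax_ge1.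
rewrite mem_iota ltnS => /andP[_ vN] h.
have := @gmax_expR (x / 24) (- (x / 8)) s v; rewrite sN => /(_ vN) h1.
apply: le_trans (ler_wpM2l (expR_ge0 _) h1); rewrite -expRD -[leLHS]expR0 ler_expR.
have : 0 <= x * ((parts v s)%:R - (v%:R / 2 + H + x / 8 * v%:R)) by rewrite mulr_ge0//; lra.
lra.
Qed.

(* By duality the dynamics may be started from the empty configuration, which is
   then compared with the product measure of density [1/2 - x], invariant up to
   the tilt for the rates [1/2] and [1/2 + x]. *)
Lemma left_lower n (x H tau t : R) m (beta : R) (y : int) (rs : seq R) :
  t = m%:R * tau ->
  0 <= x <= 6^-1 -> 2^-1 + x <= beta -> 0 <= H -> 0 <= tau ->
  tau * (2^-1 + beta + n.+1%:R) <= 1 -> size rs = n.+1 ->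
  all (fun r => 0 <= r <= 2^-1 + x / 16) rs ->
  y%:~R <= t / 4 - 2 * H ->
  bern rs (fun s => hchain n.+1 2^-1 beta tau m (fun n' => (n' 0%N < y)%R%:R) (start s)) <=
  3 * expR (- (x * H / 12)) + 3 * expR (8 * x ^+ 3 * t - 4 * x * H).
Proof.
move=> tE x06 xb H0 t0 t1 rsN rx yt; have /andP[x0 x6] := x06.
pose B : R := 3 * expR (8 * x ^+ 3 * t - 4 * x * H).
have tt0 : 0 <= t by rewrite tE mulr_ge0.
have t2 : tau * (1 + n.+1%:R) <= 1.
  have : 0 <= tau * (beta - 2^-1) by rewrite mulr_ge0//; lra.
  lra.
have t3 : tau * (2^-1 + (2^-1 + x) + n.+1%:R) <= 1.
  have : 0 <= tau * (beta - (2^-1 + x)) by rewrite mulr_ge0//; lra.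
  lra.
set s := tilt x.
have s0 : 4 * x <= s by apply: tilt_ge => //; lra.
have s1 : s <= 4 * x + 32 * x ^+ 3 by apply: tilt_le => //; lra.
have B0 : 0 <= B by rewrite mulr_ge0 ?expR_ge0.
have drs : dens rs by apply: sub_all rx => r; lra.
have dx : dens (nseq n.+1 (2^-1 - x)) by rewrite /dens all_nseq /=; lra.
(* Of the margin [2 * H], one half covers the fluctuations of the initial configuration and the
   other half those of the dual current. *)
have key eta : size eta = n.+1 -> ~~ excess n.+1 x H eta ->
    hchain n.+1 2^-1 beta tau m (fun n' => (n' 0%N < y)%R%:R) (start eta) <= B.
  move=> etaN ge.
  pose g0 : height := fun=> 0.
  have vg0 : valid n.+1 g0 by move=> v _; rewrite /g0.
  have ve : valid n.+1 (start eta) := @start_valid n.+1 eta.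
  pose F (a b : height) : R := (crosses n.+1 y a b)%:R.
  have -> : B = bern (nseq n.+1 (2^-1 - x)) (fun=> B) by rewrite bern_cst.
  have a01 : (0 <= (2^-1 : R)) && ((2^-1 : R) <= 2^-1) by rewrite lexx andbT invr_ge0.
  have b01 : 0 <= 2^-1 + x <= beta by rewrite xb andbT addr_ge0.
  (* A small current is a crossing at v = 0 with the height [g0] of the empty configuration. *)
  apply: (@le_trans _ _ (hchain n.+1 2^-1 beta tau m (fun n' => F n' g0) (start eta))).
    apply: hchain_pw => //; [lra|move=> n'; rewrite /F].
    case: (ltP (n' 0%N) y) => h; last by case: crosses.
    suff -> : crosses n.+1 y n' g0 by [].
    by apply/crossesP; exists 0%N => //; rewrite /g0 !addr0.
  rewrite /hchain (@chain_dual _ _ _ _ _ (valid n.+1)) //; first last.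
  - by move=> i v1 v2 vv1 vv2; rewrite /F crosses_upd// -ltnS.
  - by move=> i v; apply: upd_valid; rewrite -ltnS.
  rewrite -[X in X <= _](bern_cst (nseq n.+1 (2^-1 - x))).
  apply: (@le_trans _ _ (bern (nseq n.+1 (2^-1 - x)) (fun z => jchain n.+1 2^-1 (2^-1 + x) tau m
      (fun js => expR (- s * (js.1%:R - (t / 4 - H))) *
         gmax (fun a : bool => expR (s / 2 * (a%:R - 2^-1 + x / 8))) js.2) (0%N, z)))).
    apply: bern_le => // z; rewrite size_nseq => zN.
    (* Initial particles and a smaller exit rate lower the height, which makes crossings more
       likely. *)
    apply: (@le_trans _ _ (hchain n.+1 2^-1 (2^-1 + x) tau m (F (start eta)) (start z))).
      apply: (@hchain_ge _ _ _ _ _ _ _ _ _ _ _ _ 0) => //.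
        exact: start_valid.
        by move=> v _; exact: (start_le0 z v).
      move=> n1 n2 n12; rewrite /F; case: crossesP => [[v vN h]|_]; last by case: crosses.
      suff -> : crosses n.+1 y (start eta) n1 by [].
      apply/crossesP; exists v => //; apply: le_lt_trans h.
      by rewrite lerD2r lerD2l; have := n12 v vN; rewrite addr0.
    rewrite (@hchain_jchain _ _ _ _ _ _ _ z)//; last first.
      move=> n1 n2 n12; rewrite /F; congr (_%:R); congr (nat_of_bool _).
      apply/crossesP/crossesP => -[v vN h]; exists v => //; first by rewrite -n12.
      by rewrite n12.
    apply: jchain_pw => //; first lra.
    move=> [J w] /= wN; rewrite /F; case: crossesP => [[v vN]|_]; last first.
      by rewrite mulr_ge0 ?expR_ge0// (le_trans ler01)// gmax_ge1.
    rewrite /start /hgt /= => hy.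
    have := @gmax_expR (s / 2) (x / 8) w v; rewrite wN => /(_ vN) h1.
    apply: le_trans (ler_wpM2l (expR_ge0 _) h1); rewrite -expRD -[leLHS]expR0 ler_expR.
    have hv : (parts v eta)%:R <= v%:R / 2 + H + x / 8 * v%:R.
      rewrite leNgt; apply: contra ge => ge; apply/hasP; exists v => //.
      by rewrite mem_iota ltnS.
    have hy' : J%:R - (parts v eta)%:R - (parts v w)%:R + v%:R < y%:~R :> R.
      have : (J%:Z - (parts v eta)%:Z - (parts v w)%:Z + v%:Z)%:~R < y%:~R :> R.
        by rewrite ltr_int; apply: le_lt_trans hy; rewrite le_eqVlt; apply/orP; left; apply/eqP; ring.
      by rewrite !rmorphD !rmorphN.
    have s0' : 0 <= s by lra.
    have : 0 <= s * (t / 4 - H - (J%:R - (parts v w)%:R + v%:R / 2 - x / 8 * v%:R)).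
      by rewrite mulr_ge0//; lra.
    lra.
  have gm0 z : 0 <= gmax (fun a : bool => expR (s / 2 * (a%:R - 2^-1 + x / 8))) z.
    exact: le_trans ler01 (gmax_ge1 _ _).
  have := @tail_gen R n 0 (- x) tau (t / 4 - H) m _ ltac:(lra) ltac:(lra) t0 t2 gm0.
  rewrite addr0 opprK oppr_tilt; last by lra.
  rewrite tilt0 opprK add0r -/s -tE => /le_trans; apply.
  rewrite mulrC.
  apply: le_trans (ler_wpM2r (expR_ge0 _) (@gmax_tilt R n.+1 x x06)) _.
  rewrite bern_cst; apply: ler_wpM2l => //; rewrite ler_expR.
  have : 0 <= (4 * x + 32 * x ^+ 3 - s) * t by rewrite mulr_ge0//; lra.
  have : 0 <= (s - 4 * x) * H by rewrite mulr_ge0//; lra.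
  lra.
apply: (@le_trans _ _ (bern rs (fun z => (excess n.+1 x H z)%:R + B))).
  apply: bern_le => // z zN; rewrite rsN in zN.
  case: (boolP (excess n.+1 x H z)) => [_|ne]; last by rewrite add0r; exact: key.
  apply: (@le_trans _ _ 1); last by rewrite lerDl.
  rewrite -[leRHS](hchain_cst n.+1 2^-1 beta tau m 1 (start z)).
  by apply: hchain_pw => //; [lra|move=> n'; case: (_ < _)].
rewrite bernD bern_cst lerD2r -rsN; exact: bern_excess.
Qed.

End LeftLower.

Lemma size_le_seq s s' : le_seq s s' -> size s = size s'.
Proof. by elim: s s' => [|a s IH] [|b s'] //= /andP[_ /IH ->]. Qed.

Lemma parts_le_seq v s s' : le_seq s s' -> (parts v s <= parts v s')%N.
Proof.
elim: s s' v => [|a s IH] [|b s'] [|v] //= /andP[ab ss]; rewrite ?parts0//.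
by rewrite !parts_cons leq_add ?IH//; case: a b ab => [] [].
Qed.

Lemma parts_diff v s s' : le_seq s s' ->
  (parts v s' + count id s <= parts v s + count id s')%N.
Proof.
elim: s s' v => [|a s IH] [|b s'] [|v] //= /andP[ab ss]; rewrite ?parts0 ?parts_cons.
  have := IH _ 0%N ss; rewrite !parts0 => h.
  by case: a b ab => [] [] //= _; lia.
by have := IH _ v ss; case: a b ab => [] [] //= _; lia.
Qed.

(** * The current started from density 1/2 *)

Section MeanCurrent.
Variable R : realType.

Lemma local_le N (y : int) : local N (fun n => (n 0%N <= y)%R%:R : R).
Proof. by move=> n n' nn; rewrite nn. Qed.

Lemma local_lt N (y : int) : local N (fun n => (y < n 0%N)%R%:R : R).
Proof. by move=> n n' nn; rewrite nn. Qed.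

(** The mean current [psi] decreases when particles are added, so Harris' inequality is applied to
    [psi] plus the number of particles. The price is the excess of particles of the stationary
    measure, given by [wtsum_height]. *)
Lemma mean_current n tau m : 0 <= tau -> tau * (1 + 2^-1 + n.+1%:R) <= 1 ->
  bern (nseq n.+1 2^-1) (fun s => jchain n.+1 1 2^-1 tau m (fun x => x.1%:R) (0%N, s)) <=
  m%:R * tau * (wtsum R n 0 / wtsum R n.+1 0) + 4 ^+ n.+1 / wtsum R n.+1 0 / 2.
Proof.
move=> t0 t1.
set psi := fun s => _.
have bernE F : bern (nseq n.+1 (2^-1 : R)) F = 2^-1 ^+ n.+1 * sumb n.+1 F.
  elim: (n.+1) F => [|k IH] F /=; first by rewrite expr0 mul1r.
  by rewrite !IH exprS; field.
have Z0 := wtsum_gt0 R n.+1.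
have i1 : incr n.+1 (fun s => psi s + pcount R s).
  move=> s s' sN ss'; rewrite /psi.
  have s'N : size s' = n.+1 by rewrite -(size_le_seq ss').
  have loc : local n.+1 (fun n' => (n' 0%N)%:~R : R) by move=> n1 n2 n12; rewrite n12.
  have e w : size w = n.+1 -> jchain n.+1 1 2^-1 tau m (fun x => x.1%:R) (0%N, w) =
    hchain n.+1 1 2^-1 tau m (fun n' => (n' 0%N)%:~R) (start w).
    move=> wN; rewrite (hchain_jchain _ _ _ _ loc (s := w))//.
    by apply: eq_chain => -[J z]; rewrite /hgt /= parts0 subr0.
  (* Adding [D] particles lowers the current by at most [D]. *)
  rewrite !e//; set D : int := (count id s')%:Z - (count id s)%:Z.
  rewrite -lerBrDr -addrA -[X in _ <= _ + X](hchain_cst n.+1 1 2^-1 tau m _ (start s')).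
  rewrite /hchain -chainD.
  apply: (@hchain_le _ _ _ _ _ _ _ _ _ _ _ _ D) => //.
  - by rewrite ler01 lexx.
  - by rewrite lexx andbT.
  - exact: start_valid.
  - exact: start_valid.
  - move=> v _; rewrite /start /hgt /D /=.
    by have := parts_diff v ss'; lia.
  - move=> n1 n2 n12; have := n12 0%N isT.
    by rewrite -(ler_int R) rmorphD /D rmorphB /pcount.
have i2 : incr n.+1 (fun s => wt R s 0) by exact: wt_incr.
have := sumb_harris i2 i1.
rewrite -/(wtsum R n.+1 0) => H.
have mP : sumb n.+1 (@pcount R) = 2 ^+ n.+1 * (n.+1%:R / 2).
  elim: (n.+1) => [|k IH]; first by rewrite /pcount /= expr0; field.
  rewrite /= (eq_sumb (G := fun s => 1 + pcount R s)); last first.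
    by move=> s _; rewrite /pcount /= natrD.
  rewrite [X in _ + X](eq_sumb (G := @pcount R)); last first.
    by move=> s _; rewrite /pcount /= add0n.
  by rewrite sumbD sumb_cst IH exprS -(natr1 k); field.
have wP : sumb n.+1 (fun s => wt R s 0 * pcount R s) =
    (n.+1%:R * wtsum R n.+1 0 + 4 ^+ n.+1 - wtsum R n.+1 0) / 2.
  have := wtsum_height R n.+1 0.
  rewrite (eq_sumb (G := fun s => 2 * (wt R s 0 * pcount R s) + (- n.+1%:R) * wt R s 0)); last first.
    by move=> s _; ring.
  rewrite sumbD !sumbZ -/(wtsum R n.+1 0) mulr1 => h.
  apply: (@mulfI _ 2); first by rewrite pnatr_eq0.
  by rewrite [RHS]mulrC divfK ?pnatr_eq0//; lra.
move: H; rewrite sumbD mP.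
rewrite (eq_sumb (F := fun s => wt R s 0 * (psi s + pcount R s))
  (G := fun s => wt R s 0 * psi s + wt R s 0 * pcount R s)); last by move=> s _; rewrite mulrDr.
rewrite sumbD wP wt_current bernE => H.
have p2 : 0 < 2 ^+ n.+1 :> R by rewrite exprn_gt0.
rewrite -(ler_pM2l p2) [leLHS]mulrA -exprMn mulfV ?pnatr_eq0// expr1n mul1r -(ler_pM2l Z0).
set P := 2 ^+ n.+1 in H p2 *; set Z := wtsum R n.+1 0 in H Z0 *.
have -> : Z * (P * (m%:R * tau * (wtsum R n 0 / Z) + 4 ^+ n.+1 / Z / 2)) =
  P * (m%:R * tau * wtsum R n 0 + 4 ^+ n.+1 / 2).
  by field; rewrite gt_eqF.
have : 0 <= P * Z by rewrite mulr_ge0 ?ltW.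
lra.
Qed.

Lemma wtsum_ratio n : wtsum R n 0 / wtsum R n.+1 0 <= 4^-1 + (8 * n.+1%:R)^-1.
Proof.
have Z0 := wtsum_gt0 R n.+1; have e := wtsum_rec R n.
rewrite ler_pdivrMr//.
have p : 0 < (2 * (2 * n + 3))%:R :> R by rewrite ltr0n; lia.
rewrite -(ler_pM2l p) -e mulrA ler_pM2r//.
rewrite natrM natrD natrM -(natr1 n.+1) -(natr1 n).
have n0 : 0 <= n%:R :> R by [].
rewrite -subr_ge0.
have -> : 2 * (2 * n%:R + 3) * (4^-1 + (8 * (n%:R + 1))^-1) - (n%:R + 1 + 1) =
  (4 * (n%:R + 1))^-1 :> R by field; rewrite gt_eqF// ltr_wpDl.
by rewrite invr_ge0 mulr_ge0 ?addr_ge0.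
Qed.

Lemma wtsum_lb n (q : R) : 0 < q -> q ^+ 2 = n.+1%:R -> 4 ^+ n.+1 / wtsum R n.+1 0 <= 2 * q.
Proof.
move=> q0 qE; have Z0 := wtsum_gt0 R n.+1.
rewrite ler_pdivrMr// -(@ler_pXn2r _ 2%N)// ?nnegrE ?exprn_ge0//; last first.
  by rewrite mulr_ge0 ?ltW// mulr_gt0.
have -> : (4 ^+ n.+1) ^+ 2 = 16 ^+ n.+1 :> R.
  by rewrite -exprM mulnC exprM; congr (_ ^+ _); ring.
rewrite !exprMn qE.
apply: le_trans (wtsum_sqr R n.+1) _; apply: ler_wpM2r; first exact: sqr_ge0.
by rewrite -natrX -natrM ler_nat; lia.
Qed.

Lemma mean_current' n tau m t (q : R) : t = m%:R * tau -> 0 <= tau ->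
  tau * (1 + 2^-1 + n.+1%:R) <= 1 -> 0 < q -> q ^+ 2 = n.+1%:R -> t <= q ^+ 3 ->
  bern (nseq n.+1 2^-1) (fun s => jchain n.+1 1 2^-1 tau m (fun x => x.1%:R) (0%N, s)) <=
  t / 4 + 2 * q.
Proof.
move=> tE t0 t1 q0 qE tq.
apply: le_trans (mean_current m t0 t1) _.
have h1 := wtsum_ratio n; have h2 := wtsum_lb q0 qE.
have tt0 : 0 <= t by rewrite tE mulr_ge0.
have h3 : t * (8 * n.+1%:R)^-1 <= q / 8.
  rewrite -qE ler_pdivrMr ?mulr_gt0 ?exprn_gt0//.
  by have -> : q / 8 * (8 * q ^+ 2) = q ^+ 3 by field.
have h4 := ler_wpM2l tt0 h1; rewrite mulrDr in h4.
move: h4 h3 h2; rewrite -tE.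
move: (wtsum R n 0 / _) (4 ^+ _ / _) (t * (_)^-1) => a b c ? ? ?.
lra.
Qed.

End MeanCurrent.

Section CurrentTails.
Variable R : realType.

(** Truncation at 0 keeps the map monotone, as the comparison of heights in [jchain_rate]
    requires. *)
Definition nat_part (k : int) : nat := if k is Posz j then j else 0%N.

Lemma hchain_current N (alpha beta tau : R) m (f : nat -> R) s :
  (0 < N)%N -> size s = N ->
  hchain N alpha beta tau m (fun n => f (nat_part (n 0%N))) (start s) =
  jchain N alpha beta tau m (fun x => f x.1) (0%N, s).
Proof.
move=> N0 sN; rewrite (@hchain_jchain _ _ _ _ _ _ _ s)//; last by move=> ? ? ->.
by apply: eq_chain => -[J z]; rewrite /hgt /= parts0 subr0.
Qed.

Lemma jchain_rate N (alpha1 beta1 alpha2 beta2 tau : R) m (f : nat -> R) s :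
  (0 < N)%N -> 0 <= alpha1 <= alpha2 -> 0 <= beta1 <= beta2 -> 0 <= tau ->
  tau * (alpha2 + beta2 + N%:R) <= 1 -> size s = N ->
  (forall a b, (a <= b)%N -> f b <= f a) ->
  jchain N alpha2 beta2 tau m (fun x => f x.1) (0%N, s) <=
  jchain N alpha1 beta1 tau m (fun x => f x.1) (0%N, s).
Proof.
move=> N0 a12 b12 t0 t1 sN fd; rewrite -!hchain_current//.
apply: (@hchain_ge _ _ _ _ _ _ _ _ _ _ _ _ 0) => //.
- exact: start_valid.
- exact: start_valid.
- by move=> v _; rewrite addr0.
- move=> n1 n2 n12; apply: fd; have := n12 0%N isT; rewrite addr0.
  by case: (n1 0%N) => [j|j]; case: (n2 0%N) => [k|k].
Qed.

Lemma mgf_current n (x tau t : R) m : t = m%:R * tau -> 0 <= x <= 4^-1 ->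
  0 <= tau -> tau * (1 + 2^-1 + n.+1%:R) <= 1 -> 16 * x ^+ 3 * t <= 1 ->
  bern (nseq n.+1 2^-1) (fun s => jchain n.+1 1 2^-1 tau m
    (fun z => expR (- tilt x * (z.1%:R - t / 4))) (0%N, s)) <= 2.
Proof.
move=> tE /andP[x0 x4] t0 t1 xt.
have tt0 : 0 <= t by rewrite tE mulr_ge0.
have s0 : 4 * x <= tilt x by apply: tilt_ge => //; lra.
have s1 : tilt x <= 4 * x + 32 * x ^+ 3 by apply: tilt_le => //; lra.
have t2 : tau * (1 + n.+1%:R) <= 1 by lra.
apply: (@le_trans _ _ (bern (nseq n.+1 2^-1) (fun s => jchain n.+1 (2^-1 + x) 2^-1 tau m
    (fun z => expR (- tilt x * (z.1%:R - t / 4)) * 1) (0%N, s)))).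
  apply: bern_le; first by rewrite /dens all_nseq; apply/orP; right; lra.
  move=> s; rewrite size_nseq => sN.
  apply: (@le_trans _ _ (jchain n.+1 1 2^-1 tau m
     (fun z => expR (- tilt x * (z.1%:R - t / 4)) * 1) (0%N, s))).
    by rewrite le_eqVlt; apply/orP; left; apply/eqP/eq_chain => z; rewrite mulr1.
  apply: (@jchain_rate _ _ _ _ _ _ _ (fun j => expR (- tilt x * (j%:R - t / 4)) * 1)) => //.
  - by lra.
  - by lra.
  - move=> a b ab; rewrite !mulr1 ler_expR !mulNr lerN2; apply: ler_wpM2l; first lra.
    by rewrite lerD2r ler_nat.
have := @tail_gen R n x 0 tau (t / 4) m (fun=> 1) ltac:(lra) ltac:(lra) t0 t2 (fun=> ler01).
rewrite addr0 subr0 tilt0 subr0 bern_cst mulr1 sub0r -tE => /le_trans; apply.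
apply: (@le_trans _ _ (expR 2^-1)).
  rewrite ler_expR; have : 0 <= (4 * x + 32 * x ^+ 3 - tilt x) * t by rewrite mulr_ge0//; lra.
  lra.
by apply: le_trans (expR_le_quad (lexx _)) _; lra.
Qed.

(** Markov's inequality for X + (q / 4) exp (- tilt x X), where X is the current minus t / 4 and x =
    1 / q. This is nonnegative because tilt x >= 4 / q, and its mean is O(q) by [mean_current'] and
    [mgf_current]. *)
Lemma ber_upper n (q tau t H : R) m (y : int) : t = m%:R * tau -> 0 <= tau ->
  tau * (1 + 2^-1 + n.+1%:R) <= 1 -> 4 <= q -> q ^+ 2 = n.+1%:R ->
  16 * t <= q ^+ 3 -> 0 < H -> t / 4 + H <= y%:~R ->
  bern (nseq n.+1 2^-1) (fun s => jchain n.+1 1 2^-1 tau m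
    (fun z => (y < z.1%:Z)%R%:R) (0%N, s)) <= 3 * q / H.
Proof.
move=> tE t0 t1 q4 qE tq H0 ty.
have q0 : 0 < q by lra.
set x := q^-1; have x0 : 0 < x by rewrite invr_gt0.
have x4 : x <= 4^-1 by rewrite lef_pV2 ?posrE.
have tt0 : 0 <= t by rewrite tE mulr_ge0.
have xt : 16 * x ^+ 3 * t <= 1.
  rewrite mulrAC -ler_pdivlMr ?exprn_gt0// mul1r /x exprVn invrK.
  exact: tq.
have tq1 : t <= q ^+ 3 by lra.
have s0 : 4 * x <= tilt x by apply: tilt_ge; lra.
have h1 := mean_current' tE t0 t1 q0 qE tq1.
have h2 := @mgf_current n x tau t m tE ltac:(lra) t0 t1 xt.
set J := fun z : nat * seq bool => z.1%:R : R in h1.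
set E := (fun z : nat * seq bool => expR _) in h2.
apply: (@le_trans _ _ (bern (nseq n.+1 2^-1) (fun s =>
    H^-1 * jchain n.+1 1 2^-1 tau m J (0%N, s) +
    (- (H^-1 * (t / 4)) + H^-1 * (q / 4) * jchain n.+1 1 2^-1 tau m E (0%N, s))))).
  apply: bern_le; first by rewrite /dens all_nseq; apply/orP; right; lra.
  move=> s; rewrite size_nseq => sN.
  apply: (@le_trans _ _ (jchain n.+1 1 2^-1 tau m
      (fun z => H^-1 * J z + (- (H^-1 * (t / 4)) + H^-1 * (q / 4) * E z)) (0%N, s))); last first.
    by rewrite /jchain chainD chainZ chainD chainZ chain_cst.
  apply: jchain_pw => //.
  move=> [j w] _ /=; rewrite /J /E /=.
  have -> : H^-1 * j%:R + (- (H^-1 * (t / 4)) + H^-1 * (q / 4) * expR (- tilt x * (j%:R - t / 4))) =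
    H^-1 * ((j%:R - t / 4) + q / 4 * expR (- tilt x * (j%:R - t / 4))) by ring.
  rewrite mulrC ler_pdivlMr//.
  have e0 : 0 <= expR (- tilt x * (j%:R - t / 4)) by exact: expR_ge0.
  have e1 := expR_ge1Dx (- tilt x * (j%:R - t / 4)).
  have qx : q * x = 1 by rewrite /x mulfV// gt_eqF.
  case: (ltP y) => [yj|_]; last first.
    rewrite mul0r; case: (lerP 0 (j%:R - t / 4)) => hz.
      by rewrite addr_ge0// mulr_ge0// divr_ge0// ltW.
    have : 0 <= (tilt x - 4 * x) * (t / 4 - j%:R) by rewrite mulr_ge0//; lra.
    move: (expR _) e0 e1 => e e0 e1 h.
    have : 0 <= q * (e - 4 * x * (t / 4 - j%:R)) by rewrite mulr_ge0//; lra.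
    have -> : q * (e - 4 * x * (t / 4 - j%:R)) = q * e - 4 * (q * x) * (t / 4 - j%:R) by ring.
    rewrite qx; lra.
  rewrite mul1r.
  have : y%:~R < j%:R :> R by rewrite -[j%:R]/(j%:Z%:~R) ltr_int.
  have : 0 <= q / 4 * expR (- tilt x * (j%:R - t / 4)) by rewrite mulr_ge0// divr_ge0// ltW.
  lra.
rewrite bern_lin bernD bern_cst bernZ.
have Hi : 0 < H^-1 by rewrite invr_gt0.
move: h1 h2; move: (bern _ _) (bern _ _) => B A h1 h2.
have -> : H^-1 * A + (- (H^-1 * (t / 4)) + H^-1 * (q / 4) * B) =
  (A - t / 4 + q / 4 * B) / H by field; rewrite gt_eqF.
rewrite ler_pM2r//; have := ler_wpM2l (ltW q0) h2; lra.
Qed.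

(* The reservoir of rate [1] injects faster than the tilted one of rate
   [1/2 + a]. *)
Lemma dense_lower n (a r tau t H : R) m (y : int) : t = m%:R * tau -> 0 <= tau ->
  tau * (1 + 2^-1 + n.+1%:R) <= 1 -> 0 <= r <= a -> a <= 4^-1 ->
  y%:~R <= t / 4 - H -> 0 <= H ->
  bern (nseq n.+1 (2^-1 + r)) (fun s => jchain n.+1 1 2^-1 tau m
    (fun z => (z.1%:Z <= y)%R%:R) (0%N, s)) <= expR (8 * a ^+ 3 * t - 2 * (a - r) * H).
Proof.
move=> tE t0 t1 /andP[r0 ra] a4 yt H0.
have tt0 : 0 <= t by rewrite tE mulr_ge0.
set s := tilt a - tilt r.
have s1 : s / 4 - (a - r) <= 8 * a ^+ 3.
  have := @tilt_ge R r r0 ltac:(lra); have := @tilt_le R a ltac:(lra) a4; rewrite /s; lra.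
have s0 : 2 * (a - r) <= s.
  rewrite -ler_expR /s expRB !expR_tilt; [|lra|lra].
  apply: (@le_trans _ _ (1 + 4 * (a - r))).
    apply: le_trans (@expR_le_quad R (2 * (a - r)) ltac:(lra)) _.
    have : 0 <= (a - r) * (4^-1 - (a - r)) by rewrite mulr_ge0//; lra.
    nra.
  have -> : (2^-1 + a) / (2^-1 - a) / ((2^-1 + r) / (2^-1 - r)) =
    1 + (a - r) / ((2^-1 - a) * (2^-1 + r)).
    by field; do ?[apply/andP; split]; apply/eqP; lra.
  rewrite lerD2l ler_pdivlMr; last by rewrite mulr_gt0; lra.
  have : 0 <= (a - r) * (4^-1 - (2^-1 - a) * (2^-1 + r)).
    by rewrite mulr_ge0; nra.
  lra.
have s00 : 0 <= s by lra.
apply: (@le_trans _ _ (bern (nseq n.+1 (2^-1 + r)) (fun w => jchain n.+1 (2^-1 + a) (2^-1 - r) tau m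
    (fun z => expR (- s * (z.1%:R - y%:~R)) * 1) (0%N, w)))).
  apply: bern_le; first by rewrite /dens all_nseq; apply/orP; right; lra.
  move=> w; rewrite size_nseq => wN.
  apply: (@le_trans _ _ (jchain n.+1 1 2^-1 tau m
     (fun z => expR (- s * (z.1%:R - y%:~R)) * 1) (0%N, w))).
    apply: jchain_pw => //.
    move=> [j z] _ /=; rewrite mulr1; case: (lerP j%:Z y) => h; last exact: expR_ge0.
    rewrite -[leLHS]expR0 ler_expR mulNr -mulrN mulr_ge0//.
    by have : j%:R <= y%:~R :> R by [rewrite -[j%:R]/(j%:Z%:~R) ler_int|]; lra.
  apply: (@jchain_rate _ _ _ _ _ _ _ (fun j => expR (- s * (j%:R - y%:~R)) * 1)) => //.
  - by lra.
  - by lra.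
  - move=> c b cb; rewrite !mulr1 ler_expR !mulNr lerN2; apply: ler_wpM2l; first lra.
    by rewrite lerD2r ler_nat.
have t2 : tau * (1 + n.+1%:R) <= 1 by lra.
have := @tail_gen R n a r tau (y%:~R) m (fun=> 1) ltac:(lra) ltac:(lra) t0 t2 (fun=> ler01).
rewrite bern_cst mulr1 -tE -/s => /le_trans; apply.
rewrite ler_expR.
have : 0 <= s * (t / 4 - H - y%:~R) by rewrite mulr_ge0//; lra.
have : 0 <= (8 * a ^+ 3 - (s / 4 - (a - r))) * t by rewrite mulr_ge0//; lra.
have : 0 <= (s - 2 * (a - r)) * H by rewrite mulr_ge0//; lra.
lra.
Qed.

End CurrentTails.

Lemma parts_cat v u w : parts v (u ++ w) = (parts v u + parts (v - size u) w)%N.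
Proof.
rewrite /parts take_cat; case: ltnP => h; last by rewrite count_cat (@take_oversize _ v u).
have -> : (v - size u = 0)%N by lia.
by rewrite take0 addn0.
Qed.

Lemma parts_size v u : (size u <= v)%N -> parts v u = count id u.
Proof. by move=> h; rewrite /parts take_oversize. Qed.

Lemma parts_nseq_false v k : parts v (nseq k false) = 0%N.
Proof.
rewrite /parts; elim: k v => [|k IH] [|v] //=; exact: IH.
Qed.

Lemma startE s v : start s v = - (parts v s)%:Z.
Proof. by rewrite /start /hgt sub0r. Qed.

(** * From density 1/2 to arbitrary configurations outside the first block *)

Section Envelope.
Variable R : realType.

Lemma int_between (x : R) : exists y : int, x <= y%:~R <= x + 1.
Proof.
exists (Num.ceil x); have /andP[h ->] := Num.Theory.ceil_itv x.
by move: h; rewrite rmorphB /=; lra.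
Qed.

(* [upd] commutes with minima, so the assumption on the initial heights persists. *)
Lemma envelope N (alpha beta tau : R) m (y : int) n1 nB nV : (0 < N)%N ->
  0 <= alpha -> 0 <= beta -> 0 <= tau -> tau * (alpha + beta + N%:R) <= 1 ->
  (forall v, (v <= N)%N -> Num.min (n1 v) (nV v) <= nB v) ->
  hchain N alpha beta tau m (fun n => (y < n 0%N)%R%:R) n1 <=
  hchain N alpha beta tau m (fun n => (y < n 0%N)%R%:R) nB +
  hchain N alpha beta tau m (fun n => (n 0%N <= y)%R%:R) nV.
Proof.
move=> N0 a0 b0 t0 t1 h.
pose U2 (i : 'I_N.+1) (x : height * height) := (upd N i x.1, upd N i x.2).
have e1 : hchain N alpha beta tau m (fun n => (y < n 0%N)%R%:R) nB =
    chain (rate N alpha beta tau) U2 m (fun x => (y < x.1 0%N)%R%:R) (nB, nV).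
  by apply: (@chain_rel _ _ _ _ _ _ _ (fun a b => a = b.1)) => // [i a b ->|a b ->].
have e2 : hchain N alpha beta tau m (fun n => (n 0%N <= y)%R%:R) nV =
    chain (rate N alpha beta tau) U2 m (fun x => (x.2 0%N <= y)%R%:R) (nB, nV).
  by apply: (@chain_rel _ _ _ _ _ _ _ (fun a b => a = b.2)) => // [i a b ->|a b ->].
rewrite e1 e2 -chainD.
apply: (@chain_couple _ _ _ _ _ _ _ _ (fun a b => forall v, (v <= N)%N ->
   Num.min (a v) (b.2 v) <= b.1 v)) => //.
- by move=> i; apply: rate_ge0.
- by move=> i; apply: rate_ge0.
- by under eq_bigr do rewrite maxxx; exact: sum_rate_le.
- move=> i a [b c] /= abc v vN; rewrite -upd_min; apply: (@upd_mono N) => //.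
  by rewrite -ltnS.
- by move=> i a b; rewrite ltxx.
- by move=> i a b; rewrite ltxx.
- move=> a [b c] /= /(_ 0%N isT) abc.
  case: (ltP y (a 0%N)) => ya; last by rewrite addr_ge0.
  case: (ltP y (b 0%N)) => yb; first by rewrite lerDl.
  suff -> : c 0%N <= y by rewrite add0r.
  by move: abc; rewrite ge_min leNgt (le_lt_trans yb ya) /= => /le_trans; apply.
Qed.

(** An idle ring gives the shorter system the same index set as the longer one, so that
    [chain_couple] applies. *)
Lemma chain_skip n S (a : 'I_n.+1 -> R) (U : 'I_n -> S -> S) m f s :
  chain a (fun i => if unlift ord0 i is Some j then U j else id) m f s =
  chain (a \o lift ord0) U m f s.
Proof.
elim: m s => [|m IH] s //; rewrite !chainS !IH; congr (_ + _).
rewrite big_ord_recl unlift_none /= IH subrr mulr0 add0r.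
by apply: eq_bigr => i _; rewrite liftK !IH.
Qed.

(* Without the constraint coming from the first site, the second bond is a
   reservoir of rate [1]. *)
Lemma cut_first n (alpha beta tau : R) m (y : int) n1 n2 :
  0 <= alpha -> 0 <= beta -> 0 <= tau -> tau * (alpha + beta + n.+2%:R) <= 1 ->
  valid n.+2 n1 -> (forall v, (v <= n.+1)%N -> n1 v.+1 <= n2 v) ->
  hchain n.+2 alpha beta tau m (fun n => (y + 1 < n 0%N)%R%:R) n1 <=
  hchain n.+1 1 beta tau m (fun n => (y < n 0%N)%R%:R) n2.
Proof.
move=> a0 b0 t0 t1 v1 n12.
have -> : hchain n.+1 1 beta tau m (fun n => (y < n 0%N)%R%:R) n2 =
   chain (rate n.+2 alpha beta tau) (fun i : 'I_n.+3 => if unlift ord0 i is Some j then upd n.+1 j else id)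
     m (fun n => (y < n 0%N)%R%:R) n2.
  rewrite chain_skip /hchain.
  have -> // : rate n.+2 alpha beta tau \o lift ord0 = rate n.+1 1 beta tau.
  apply/funext => i; rewrite /= /rate lift0 eqSS; congr (_ * _).
  by case: eqP => [->|] //; case: eqP.
apply: (@chain_couple _ _ _ _ _ _ _ _ (fun a b : height => valid n.+2 a /\
   forall v, (v <= n.+1)%N -> a v.+1 <= b v)) => //.
- by move=> i; apply: rate_ge0.
- by move=> i; apply: rate_ge0.
- by under eq_bigr do rewrite maxxx; exact: sum_rate_le.
- move=> i a b [va ab]; split; first by apply: upd_valid; rewrite // -ltnS.
  move=> v vn; case: unliftP => [[j jn] ->|->] /=; last by rewrite /upd /=; exact: ab.
  rewrite ltnS in jn.
  rewrite /bump /= add1n /upd eqSS; case: eqP => [_|_]; last exact: ab.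
  have h0 := ab _ jn.
  have h1 : j != 0%N -> a j <= b j.-1.
    by move=> j0; have := ab j.-1 ltac:(lia); rewrite prednK ?lt0n.
  have h2 : j != n.+1 -> a j.+2 <= b j.+1 by move=> ?; apply: ab; lia.
  have -> : (j.+1 == 0)%N = false by [].
  rewrite eqSS; move: h1 h2; case: (j == 0)%N; case: (j == n.+1)%N => /= h1 h2; lia.
- by move=> i a b; rewrite ltxx.
- by move=> i a b; rewrite ltxx.
- move=> a b [va ab].
  (* The heights at the first two bonds differ by at most one, hence the threshold [y + 1]. *)
  have := ab 0%N isT; have := va 0%N isT.
  case: (ltP (y + 1) (a 0%N)) => // ya h1 h2.
  by have -> : y < b 0%N by lia.
Qed.

End Envelope.

Section LeftUpperRate1.
Variable R : realType.

(* Emptying [r0] only increases the current.  The minimum of the resulting height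
   and of the height, shifted by [D], of a configuration denser by [20 K / q] in
   the first block lies below the height of a configuration of density [1/2]; the
   shifted height being large at the origin, [envelope] bounds the first one. *)
Lemma left_upper_rate1 n v0 (K q tau t : R) m (y : int) r0 :
  t = m%:R * tau -> 0 <= tau -> tau * (1 + 2^-1 + n.+1%:R) <= 1 ->
  q ^+ 2 = n.+1%:R -> 1 <= K -> 4 * (20 * K + 1) <= q ->
  8 * (20 * K + 1) ^+ 3 * t <= q ^+ 3 ->
  (v0 <= n.+1 <= 4 * v0)%N -> size r0 = (n.+1 - v0)%N ->
  t / 4 + K * q <= y%:~R <= t / 4 + K * q + 1 ->
  bern (nseq v0 2^-1) (fun u => hchain n.+1 1 2^-1 tau m
    (fun n' => (y < n' 0%N)%R%:R) (start (u ++ r0))) <= 5 / K.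
Proof.
move=> tE t0 t1 qE K1 qK tq /andP[v0n nv0] r0N /andP[y1 y2].
have K0 : 0 < K by lra.
have q84 : 84 <= q by lra.
have q0 : 0 < q by lra.
have Kq0 : 0 < K * q by rewrite mulr_gt0.
have Kq2 : 2 <= K * q by nra.
have tt0 : 0 <= t by rewrite tE mulr_ge0.
(* An excess [kap] on at least q ^ 2 / 4 sites is 5 K q particles; two fluctuations of K q leave 3 K
   q >= [D0], and y - D0 <= t / 4 - K q. The gap 1 / q between [a] and [kap] yields the factor exp
   (- 2 K) in [dense_lower]. *)
set kap := 20 * K / q; set a := (20 * K + 1) / q.
have kap0 : 0 <= kap by rewrite divr_ge0 ?mulr_ge0 ?ltW.
have a4 : a <= 4^-1 by rewrite ler_pdivrMr//; lra.
have akap : a - kap = q^-1 by rewrite /a /kap; field; rewrite gt_eqF.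
have qi0 : 0 < q^-1 by rewrite invr_gt0.
have kap4 : kap <= 4^-1 by lra.
have [D0 D1 D2] : exists2 D0 : int, 2 * (K * q) + 1 <= D0%:~R & D0%:~R <= 3 * (K * q) :> R.
  have [D0 /andP[D1 D2]] := int_between (2 * (K * q) + 1).
  by exists D0 => //; lra.
set v1 := (n.+1 - v0)%N in r0N.
pose A s := hchain n.+1 1 2^-1 tau m (fun n' => (y < n' 0%N)%R%:R : R) (start s).
pose C s := hchain n.+1 1 2^-1 tau m (fun n' => (n' 0%N <= y - D0)%R%:R : R) (start s).
pose d (u : seq bool) (c : R) : R := (K * q <= `|pcount R u - c|)%R%:R.
have t1' : tau * (1 + 2^-1 + n.+1%:R) <= 1 by [].
have A1 s : A s <= 1.
  rewrite -[leRHS](hchain_cst n.+1 1 2^-1 tau m 1 (start s)).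
  by apply: hchain_pw => // n'; case: (_ < _).
have A0 s : 0 <= A s.
  rewrite -[leLHS](hchain_cst n.+1 1 2^-1 tau m 0 (start s)).
  by apply: hchain_pw => // n'; case: (_ < _).
have C0 s : 0 <= C s.
  rewrite -[leLHS](hchain_cst n.+1 1 2^-1 tau m 0 (start s)).
  by apply: hchain_pw => // n'; case: (_ <= _).
have aa : (0 <= (1 : R)) && ((1 : R) <= 1) by rewrite ler01 lexx.
have bb : (0 <= (2^-1 : R)) && ((2^-1 : R) <= 2^-1) by rewrite lexx andbT invr_ge0.
have v0R : q ^+ 2 <= 4 * v0%:R by rewrite qE -natrM ler_nat.
have v0R' : v0%:R <= q ^+ 2 by rewrite qE ler_nat.
set c := v0%:R * 2^-1 : R; set c' := v0%:R * (2^-1 + kap).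
have key u u' r : size u = v0 -> size u' = v0 -> size r = v1 ->
    A (u ++ r0) <= A (u ++ r) + C (u' ++ r) + (d u c + d u' c').
  move=> uN u'N rN.
  have dn w k : 0 <= d w k by [].
  case: (boolP (K * q <= `|pcount R u - c|)) => du.
    have -> : d u c = 1 by rewrite /d du.
    have := A1 (u ++ r0); have := A0 (u ++ r); have := C0 (u' ++ r); have := dn u' c'.
    lra.
  have -> : d u c = 0 by rewrite /d (negbTE du).
  case: (boolP (K * q <= `|pcount R u' - c'|)) => du'.
    have -> : d u' c' = 1 by rewrite /d du'.
    have := A1 (u ++ r0); have := A0 (u ++ r); have := C0 (u' ++ r); lra.
  have -> : d u' c' = 0 by rewrite /d (negbTE du').
  rewrite -ltNge in du; rewrite -ltNge in du'.
  rewrite !addr0.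
  set D : int := (count id u')%:Z - (count id u)%:Z.
  have DD0 : D0 <= D.
    rewrite -(ler_int R).
    have -> : D%:~R = pcount R u' - pcount R u by rewrite /D rmorphB.
    move: du du'; rewrite !ltr_norml => /andP[_ du] /andP[du' _].
    have : 5 * (K * q) <= c' - c.
      have -> : c' - c = kap * v0%:R by rewrite /c' /c; ring.
      have : 0 <= kap * (4 * v0%:R - q ^+ 2) by rewrite mulr_ge0//; lra.
      have -> : kap * (4 * v0%:R - q ^+ 2) = 4 * (kap * v0%:R) - 20 * (K * q).
        by rewrite /kap; field; rewrite gt_eqF.
      lra.
    lra.
  apply: (@le_trans _ _ (A (u ++ nseq v1 false))).
    apply: (@hchain_le _ _ _ _ _ _ _ _ _ _ _ _ 0) => //; [exact: start_valid|exact: start_valid| |].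
      move=> v _; rewrite !startE !parts_cat parts_nseq_false.
      by move: (parts v u) (parts _ r0); clear; lia.
    move=> n1 n2 /(_ 0%N isT); rewrite addr0.
    case: (ltP y (n1 0%N)) => // h1 h2.
    by rewrite (lt_le_trans h1 h2).
  pose nV : height := fun v => start (u' ++ r) v + D.
  (* On the first block the first height equals that of [u ++ r]; beyond it [nV] does, since [D]
     balances the counts of [u] and [u']. *)
  have h : forall v, (v <= n.+1)%N ->
      Num.min (start (u ++ nseq v1 false) v) (nV v) <= start (u ++ r) v.
    move=> v _; rewrite /nV !startE !parts_cat parts_nseq_false uN u'N.
    case: (leqP v v0) => vv.
      have -> : (v - v0 = 0)%N by apply/eqP; rewrite subn_eq0.
      rewrite !parts0; move: (parts v u) (parts v u') (D); clear; lia.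
    rewrite (@parts_size v u) ?uN 1?ltnW// (@parts_size v u') ?u'N 1?ltnW// /D.
    by move: (count id u) (count id u') (parts _ r); clear; lia.
  have hh : 0 <= 2^-1 :> R by rewrite invr_ge0.
  have e := @envelope R n.+1 1 2^-1 tau m y _ _ _ isT ler01 hh t0 t1' h.
  apply: (le_trans e); rewrite lerD2l.
  apply: (@hchain_ge _ _ _ _ _ _ _ _ _ _ _ _ (- D0)) => //.
  - exact: start_valid.
  - move=> v vN; have := @start_valid n.+1 (u' ++ r) v vN.
    by rewrite /nV; move: (start _ v) (start _ v.+1) (D); clear; lia.
  - by move=> v _; rewrite /nV -addrA lerDl subr_ge0.
  - move=> n1 n2 /(_ 0%N isT) h12.
    case: (lerP (n2 0%N) y) => // h2.
    by rewrite (le_trans h12) ?lerD2r.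
have dh : dens (nseq v0 (2^-1 : R)) by rewrite /dens all_nseq; apply/orP; right; lra.
have dh1 : dens (nseq v1 (2^-1 : R)) by rewrite /dens all_nseq; apply/orP; right; lra.
have dk : dens (nseq v0 (2^-1 + kap)) by rewrite /dens all_nseq; apply/orP; right; lra.
(* Averaging over independent [u'] and [r], on which the left-hand side does not depend, produces
   product measures on the right. *)
apply: (@le_trans _ _ (bern (nseq v0 2^-1) (fun u => bern (nseq v0 (2^-1 + kap)) (fun u' =>
   bern (nseq v1 2^-1) (fun r => A (u ++ r) + C (u' ++ r) + (d u c + d u' c')))))).
  apply: bern_le => // u; rewrite size_nseq => uN.
  rewrite -[leLHS](bern_cst (nseq v0 (2^-1 + kap))).
  apply: bern_le => // u'; rewrite size_nseq => u'N.
  rewrite -[leLHS](bern_cst (nseq v1 (2^-1 : R))).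
  by apply: bern_le => // r; rewrite size_nseq => rN; exact: key.
have -> : bern (nseq v0 2^-1) (fun u => bern (nseq v0 (2^-1 + kap)) (fun u' =>
   bern (nseq v1 2^-1) (fun r => A (u ++ r) + C (u' ++ r) + (d u c + d u' c')))) =
   bern (nseq v0 2^-1 ++ nseq v1 2^-1) A + bern (nseq v0 (2^-1 + kap) ++ nseq v1 2^-1) C +
   (bern (nseq v0 2^-1) (d^~ c) + bern (nseq v0 (2^-1 + kap)) (d^~ c')).
  rewrite !bern_cat -[X in _ + X + _](bern_cst (nseq v0 (2^-1 : R))) -[X in _ + (_ + X)](bern_cst (nseq v0 (2^-1 : R))).
  rewrite -!bernD; apply: eq_bern => u _.
  rewrite -[X in X + _ + _](bern_cst (nseq v0 (2^-1 + kap))) -[X in _ + (X + _)](bern_cst (nseq v0 (2^-1 + kap))).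
  rewrite -!bernD; apply: eq_bern => u' _.
  by rewrite -[X in _ + _ + X](bern_cst (nseq v1 (2^-1 : R))) -!bernD.
have Kinv : 0 < K^-1 by rewrite invr_gt0.
have v01 : (v0 + v1 = n.+1)%N by rewrite /v1 subnKC.
have tq' : 16 * t <= q ^+ 3.
  apply: le_trans tq; apply: ler_wpM2r => //.
  have K21 : 21 <= 20 * K + 1 by lra.
  by rewrite !exprS expr0; nra.
have hA : bern (nseq v0 2^-1 ++ nseq v1 2^-1) A <= 3 / K.
  rewrite -nseqD v01.
  apply: (@le_trans _ _ (3 * q / (K * q))); last by rewrite -mulf_div divff ?mulr1// gt_eqF.
  rewrite (eq_bern (G := fun s => jchain n.+1 1 2^-1 tau m
     (fun z => (y < z.1%:Z)%R%:R) (0%N, s))); last first.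
    move=> s; rewrite size_nseq => sN; rewrite /A (@hchain_jchain _ _ _ _ _ _ _ s)//.
      by apply: eq_chain => -[J z]; rewrite /hgt /= parts0 subr0.
    exact: local_lt.
  by apply: (ber_upper tE) => //; lra.
have hC : bern (nseq v0 (2^-1 + kap) ++ nseq v1 2^-1) C <= 1 / K.
  (* Raising the density elsewhere only lowers the current, and the flat profile fits
     [dense_lower]. *)
  apply: (@le_trans _ _ (bern (nseq n.+1 (2^-1 + kap)) C)).
    rewrite -v01 nseqD; apply: bern_mono.
    - by rewrite /dens all_cat; apply/andP; split.
    - by rewrite /dens -nseqD all_nseq; apply/orP; right; lra.
    - have hk : 2^-1 <= 2^-1 + kap by rewrite lerDl.
      elim: (v0) => [|k IH] /=; last by rewrite lexx.
      by elim: (v1) => //= k ->; rewrite hk.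
    - move=> s s' _ ss'.
      apply: (@hchain_ge _ _ _ _ _ _ _ _ _ _ _ _ 0) => //; [exact: start_valid|exact: start_valid| |].
        move=> v _; rewrite !startE; have := parts_le_seq v ss'.
        by move: (parts v s) (parts v s'); clear; lia.
      move=> n1 n2 /(_ 0%N isT); rewrite addr0 => h1.
      case: (lerP (n2 0%N) (y - D0)) => // h2.
      by rewrite (le_trans h1 h2).
  rewrite (eq_bern (G := fun s => jchain n.+1 1 2^-1 tau m
     (fun z => (z.1%:Z <= y - D0)%R%:R) (0%N, s))); last first.
    move=> s; rewrite size_nseq => sN; rewrite /C (@hchain_jchain _ _ _ _ _ _ _ s)//.
      by apply: eq_chain => -[J z]; rewrite /hgt /= parts0 subr0.
    exact: local_le.
  apply: le_trans (@dense_lower R n a kap tau t (K * q) m (y - D0) tE t0 t1 _ a4 _ (ltW Kq0)) _.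
  - by rewrite kap0 /=; lra.
  - by rewrite rmorphB /=; lra.
  rewrite akap.
  have -> : 2 * q^-1 * (K * q) = 2 * K by field; rewrite gt_eqF.
  have at1 : 8 * a ^+ 3 * t <= 1.
    rewrite /a expr_div_n mulrA mulrAC ler_pdivrMr ?exprn_gt0// mul1r.
    by rewrite mulrAC in tq *.
  apply: (@le_trans _ _ (expR (- K))); first by rewrite ler_expR; lra.
  rewrite expRN mul1r lef_pV2 ?posrE ?expR_gt0//.
  by have := expR_ge1Dx K; lra.
have hd : bern (nseq v0 2^-1) (d^~ c) <= (4 * K)^-1.
  have := @bern_cheb R (nseq v0 2^-1) (K * q) dh Kq0.
  rewrite big_nseq iter_addr_0 -(mulr_natl _ v0) size_nseq.
  move=> e. apply: (le_trans e).
  rewrite ler_pdivrMr ?mulr_gt0 ?exprn_gt0//.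
  have -> : (4 * K)^-1 * (4 * (K * q) ^+ 2) = K * q ^+ 2 by field; rewrite gt_eqF.
  by nra.
have hd' : bern (nseq v0 (2^-1 + kap)) (d^~ c') <= (4 * K)^-1.
  have := @bern_cheb R (nseq v0 (2^-1 + kap)) (K * q) dk Kq0.
  rewrite big_nseq iter_addr_0 -(mulr_natl _ v0) size_nseq.
  move=> e; apply: (le_trans e).
  rewrite ler_pdivrMr ?mulr_gt0 ?exprn_gt0//.
  have -> : (4 * K)^-1 * (4 * (K * q) ^+ 2) = K * q ^+ 2 by field; rewrite gt_eqF.
  by nra.
have : (4 * K)^-1 = 4^-1 * K^-1 by rewrite invfM.
lra.
Qed.

End LeftUpperRate1.

Section LeftUpperTail.
Variable R : realType.

(** One site is sacrificed to replace an arbitrary entrance rate by 1; its initial value is averaged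
    out. *)
Lemma left_upper n v0 (K q alpha tau t : R) m (y : int) r0 :
  t = m%:R * tau -> 0 <= alpha -> 0 <= tau -> tau * (alpha + 2^-1 + n.+2%:R) <= 1 ->
  q ^+ 2 = n.+1%:R -> 1 <= K -> 4 * (20 * K + 1) <= q ->
  8 * (20 * K + 1) ^+ 3 * t <= q ^+ 3 ->
  (v0 <= n.+1 <= 4 * v0)%N -> size r0 = (n.+1 - v0)%N ->
  t / 4 + K * q <= y%:~R <= t / 4 + K * q + 1 ->
  bern (nseq v0.+1 2^-1) (fun u => hchain n.+2 alpha 2^-1 tau m
    (fun n' => (y + 1 < n' 0%N)%R%:R) (start (u ++ r0))) <= 5 / K.
Proof.
move=> tE a0 t0 t1 qE K1 qK tq v0n r0N yt.
have h0 : 0 <= 2^-1 :> R by rewrite invr_ge0.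
have t1' : tau * (1 + 2^-1 + n.+1%:R) <= 1.
  apply: le_trans t1; rewrite ler_wpM2l// -(natr1 n.+1); lra.
have dh : dens (nseq v0 (2^-1 : R)) by rewrite /dens all_nseq; apply/orP; right; lra.
have h b : bern (nseq v0 2^-1) (fun u => hchain n.+2 alpha 2^-1 tau m
    (fun n' => (y + 1 < n' 0%N)%R%:R) (start ((b :: u) ++ r0))) <= 5 / K.
  apply: le_trans (left_upper_rate1 tE t0 t1' qE K1 qK tq v0n r0N yt).
  apply: bern_le => // u _; apply: cut_first => //; first exact: start_valid.
  move=> v _; rewrite cat_cons !startE /parts /=.
  by move: (count id _); clear; case: b; lia.
have := h true; have := h false; rewrite /comp /=; lra.
Qed.

End LeftUpperTail.

(** * Concentration of the number of particles *)

Lemma le_seq_bond k s s' : le_seq s s' -> le_seq (bond k s) (bond k s').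
Proof.
rewrite /le_seq; elim: k s s' => [|k IH] [|a s] [|a' s'] //=.
  case: s s' => [|b s] [|b' s'] //=; first by rewrite !andbF.
    by rewrite !andbF.
  by case: a a' b b' => [] [] [] [].
by move=> /andP[-> /IH].
Qed.

Lemma le_seq_inj s s' : le_seq s s' -> le_seq (inj s) (inj s').
Proof. by case: s s' => [|a s] [|a' s'] //= /andP[_ ->]. Qed.

Lemma le_seq_out s s' : le_seq s s' -> le_seq (out s) (out s').
Proof.
rewrite /le_seq; elim: s s' => [|a s IH] [|a' s'] //=.
case: s s' IH => [|b s] [|b' s'] IH //; try by rewrite /= !andbF.
by move=> /andP[aa /IH h]; rewrite [all2 _ (_ :: _) _]/= aa.
Qed.

Lemma le_seq_cupd N i s s' : le_seq s s' -> le_seq (cupd N i s) (cupd N i s').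
Proof.
by rewrite /cupd => ss'; case: ifP => _; [|case: ifP => _];
  [exact: le_seq_inj|exact: le_seq_out|exact: le_seq_bond].
Qed.

Lemma le_seq_trans : transitive le_seq.
Proof.
rewrite /le_seq; elim=> [|a s IH] [|b s'] [|c s''] //= /andP[ab s1] /andP[bc s2].
by rewrite (IH _ _ s1 s2) andbT; case: b a c ab bc => [] [] [].
Qed.

Lemma le_seq_injl s : le_seq s (inj s).
Proof. by case: s => //= a s; rewrite implybT; exact: le_seq_refl. Qed.

Lemma le_seq_outr s : le_seq (out s) s.
Proof. by rewrite /le_seq; elim: s => //= a [|b s] IH //=; rewrite implybb; exact: IH. Qed.

Lemma le_seq_count s s' : le_seq s s' -> (count id s <= count id s')%N.
Proof. by elim: s s' => [|[] s IH] [|[] s'] //= /IH; lia. Qed.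

Section Config.
Variable R : realFieldType.

Definition cchain N (alpha beta tau : R) m (f : seq bool -> R) :=
  chain (rate N alpha beta tau) (fun i : 'I_N.+1 => cupd N i) m f.

Lemma cchain_le N (alpha1 beta1 alpha2 beta2 tau : R) m f1 f2 s :
  (0 < N)%N -> 0 <= alpha1 <= alpha2 -> 0 <= beta2 <= beta1 -> 0 <= tau ->
  tau * (alpha2 + beta1 + N%:R) <= 1 ->
  (forall s1 s2, le_seq s1 s2 -> f1 s1 <= f2 s2) ->
  cchain N alpha1 beta1 tau m f1 s <= cchain N alpha2 beta2 tau m f2 s.
Proof.
move=> N0 /andP[a0 a12] /andP[b0 b12] t0 t1 f12.
apply: (@chain_couple _ _ _ _ _ _ _ _ le_seq) => //; last exact: le_seq_refl.
- by move=> i; apply: rate_ge0 => //; exact: le_trans b12.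
- by move=> i; apply: rate_ge0 => //; exact: le_trans a12.
- apply: le_trans (sum_rate_le N0 t0 t1); apply: ler_sum => i _.
  rewrite /rate; case: ifP => _; first by rewrite ge_max !ler_wpM2l.
  by case: ifP => _; rewrite ge_max !ler_wpM2l.
- by move=> i s1 s2; exact: le_seq_cupd.
- move=> i s1 s2; rewrite /rate /cupd; case: ifP => _ h s12.
    exact: le_seq_trans s12 (le_seq_injl _).
  by move: h; case: ifP => _; rewrite ltNge ler_wpM2l.
- move=> i s1 s2; rewrite /rate /cupd; case: ifP => _ h s12.
    by move: h; rewrite ltNge ler_wpM2l.
  move: h; case: ifP => _ h; first exact: le_seq_trans (le_seq_outr _) s12.
  by move: h; rewrite ltxx.
Qed.

Lemma hchain_cchain N (alpha beta tau : R) m f g s : (0 < N)%N -> size s = N ->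
  local N f -> (forall J s, size s = N -> f (hgt (J, s)) = g s) ->
  hchain N alpha beta tau m f (start s) = cchain N alpha beta tau m g s.
Proof.
move=> N0 sN fl fg; rewrite (@hchain_jchain _ _ _ _ _ _ _ s)//.
apply: (@chain_rel _ _ _ _ _ _ _ (fun x s => size s = N /\ x.2 = s)) => //.
  by move=> i x z [zN xz]; rewrite size_cupd zN; split=> //=; rewrite xz.
by move=> [J z'] z [zN /= ->]; rewrite fg.
Qed.

Lemma hchain_mirror N (alpha beta tau : R) m c f f' n n' : (0 < N)%N ->
  (forall v, (v <= N)%N -> n' v = mirror N c n v) ->
  (forall n n', (forall v, (v <= N)%N -> n' v = mirror N c n v) -> f n = f' n') ->
  hchain N alpha beta tau m f n = hchain N beta alpha tau m f' n'.
Proof.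
move=> N0 nn' ff'.
have -> : hchain N beta alpha tau m f' n' =
    chain (rate N alpha beta tau) (fun i : 'I_N.+1 => upd N (rev_ord i)) m f' n'.
  rewrite /hchain; elim: m n' {nn'} => [//|m IH] n'; rewrite !chainS IH; congr (_ + _).
  rewrite (reindex_inj rev_ord_inj) /=; apply: eq_bigr => i _; rewrite IH.
  congr (_ * _); rewrite /rate /= subSS; have iN : (i <= N)%N by rewrite -ltnS.
  congr (_ * _).
  have -> : (N - i == 0)%N = (i == N :> nat) by lia.
  have -> : (N - i == N)%N = (i == 0%N :> nat) by lia.
  by case: eqP => [->|//]; case: eqP => // e; move: N0; rewrite e.
apply: (@chain_rel _ _ _ _ _ _ _ (fun a b => forall v, (v <= N)%N -> b v = mirror N c a v)) => //.
move=> i a b ab v vN; have iN : (i <= N)%N by rewrite -ltnS.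
rewrite /= subSS -upd_mirror//; apply: upd_local => //; exact: leq_subr.
Qed.

Lemma bern_exchange (rs rs' : seq R) (G : seq bool -> seq bool -> R) :
  bern rs (fun u => bern rs' (G u)) = bern rs' (fun v => bern rs (G^~ v)).
Proof.
elim: rs G => [//|r rs IH] G /=; rewrite /comp !IH -!bernZ -bernD.
by [].
Qed.

End Config.

Lemma start_mirror s v : (v <= size s)%N ->
  start (rev (map negb s)) v = mirror (size s) (count id s)%:Z (start s) v.
Proof.
move=> vs; rewrite /mirror !startE /parts take_rev size_map -map_drop count_rev count_map.
have := count_cat id (take (size s - v) s) (drop (size s - v) s).
rewrite cat_take_drop.
have := count_predC id (drop (size s - v) s); rewrite size_drop.
have -> : count (preim negb id) (drop (size s - v) s) = count (predC id) (drop (size s - v) s).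
  exact: eq_count.
by move: (count _ _) (count _ _) (count _ _) (count _ _) => *; lia.
Qed.

Section CountDeficit.
Variable R : realType.

Definition law a b (x : R) : seq R :=
  nseq a 2^-1 ++ nseq b (2^-1 + x) ++ nseq a 2^-1.

Lemma size_law a b x : size (law a b x) = (a + b + a)%N.
Proof. by rewrite /law !size_cat !size_nseq addnA. Qed.

Lemma sum_law a b x : \sum_(r <- law a b x) r = (a + b + a)%:R / 2 + b%:R * x.
Proof.
rewrite /law !big_cat !big_nseq !iter_addr_0 /= !natrD.
by rewrite -(mulr_natl _ a) -(mulr_natl _ b); field.
Qed.

Lemma dens_law a b x : `|x| <= 4^-1 -> dens (law a b x).
Proof.
rewrite ler_norml => /andP[x1 x2]; rewrite /dens !all_cat !all_nseq.
by apply/and3P; split; apply/orP; right; lra.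
Qed.

Lemma rev_law a b x : rev [seq 1 - r | r <- law a b x] = law a b (- x).
Proof.
have rn k (y : R) : rev (nseq k y) = nseq k y.
  by elim: k => // k IH; rewrite /= rev_cons IH -cats1; elim: k {IH} => //= k ->.
rewrite /law !map_cat !rev_cat !map_nseq !rn -catA.
by congr (nseq _ _ ++ nseq _ _ ++ nseq _ _); field.
Qed.

(** The number of particles is the initial number plus entrances minus exits. Deviations K q, 2 K q
    and K q of the three cost 1 / K, 6 / K and 5 / K; the fifth K q covers the rounding to
    integers. *)
Lemma count_deficit n v0 b (K q B r beta tau t : R) m :
  t = m%:R * tau -> 0 <= tau -> 1 <= beta -> tau * (2^-1 + beta + n.+2%:R) <= 1 ->
  q ^+ 2 = n.+1%:R -> 1 <= K -> 4 * (20 * K + 1) <= q ->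
  8 * (20 * K + 1) ^+ 3 * t <= q ^+ 3 ->
  1 <= B -> `|r| <= B -> 96 * B <= q -> 8 * (16 * B) ^+ 3 * t <= q ^+ 3 ->
  (v0 <= n.+1 <= 4 * v0)%N -> (v0.+1 + b + v0.+1 = n.+2)%N ->
  bern (law v0.+1 b (r / q)) (fun s => hchain n.+2 2^-1 beta tau m
    (fun n' => ((n' 0%N - n' n.+2)%:~R < n.+2%:R / 2 + b%:R * (r / q) - 5 * (K * q))%R%:R)
    (start s)) <= 12 / K.
Proof.
move=> tE t0 b1 t1 qE K1 qK tq B1 rB Bq tB v0n abN.
have K0 : 0 < K by lra.
have q84 : 84 <= q by lra.
have q0 : 0 < q by lra.
have Kq0 : 0 < K * q by rewrite mulr_gt0.
have Kq4 : 84 <= K * q by nra.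
have tt0 : 0 <= t by rewrite tE mulr_ge0.
have Kinv : 0 < K^-1 by rewrite invr_gt0.
have h0 : 0 <= 2^-1 :> R by rewrite invr_ge0.
have b0 : 0 <= beta by lra.
have t1' : tau * (beta + 2^-1 + n.+2%:R) <= 1 by rewrite (addrC beta).
have rq : `|r / q| <= B / q by rewrite normrM normfV (gtr0_norm q0) ler_pM2r ?invr_gt0.
have Bq96 : B / q <= 96^-1 by rewrite ler_pdivrMr//; lra.
have sE : \sum_(r <- law v0.+1 b (r / q)) r = n.+2%:R / 2 + b%:R * (r / q).
  by rewrite sum_law abN.
have drs x : `|x| <= B / q -> dens (law v0.+1 b x).
  move=> xB; apply: dens_law; lra.
have szN x : size (law v0.+1 b x) = n.+2 by rewrite size_law.
move: sE; set EM : R := _ + b%:R * _ => sE.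
have [y /andP[y1 y2]] := int_between (t / 4 - 2 * (K * q) - 1).
have [y' yy'] := int_between (t / 4 + K * q).
have [c /andP[c1 c2]] := int_between (EM - K * q - 1).
pose F1 (n' : height) : R := (n' 0%N < y)%R%:R.
pose F2 (n' : height) : R := (y' + 1 < n' 0%N)%R%:R.
pose F (n' : height) : R := ((n' 0%N - n' n.+2)%:~R < EM - 5 * (K * q))%R%:R.
have key s : size s = n.+2 ->
   hchain n.+2 2^-1 beta tau m F (start s) <=
   hchain n.+2 2^-1 beta tau m F1 (start s) +
   ((pcount R s < c%:~R)%R%:R + hchain n.+2 beta 2^-1 tau m F2 (start (rev (map negb s)))).
  move=> sN.
  have nn a a' f s' : 0 <= a -> 0 <= a' -> tau * (a + a' + n.+2%:R) <= 1 ->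
      (forall x, 0 <= f x) -> 0 <= hchain n.+2 a a' tau m f (start s') :> R.
    move=> ha ha' hh f0.
    rewrite -[leLHS](hchain_cst n.+2 a a' tau m 0 (start s')).
    exact: hchain_pw.
  have n1 := @nn _ _ F1 s h0 b0 t1 (fun x => ler0n _ _).
  have n2 := @nn _ _ F2 (rev (map negb s)) b0 h0 t1' (fun x => ler0n _ _).
  case: (ltP (pcount R s) c%:~R) => sc.
    apply: (@le_trans _ _ 1); last by rewrite mulr1n; lra.
    rewrite -[leRHS](hchain_cst n.+2 2^-1 beta tau m 1 (start s)).
    by apply: hchain_pw => // x; rewrite /F; case: (_ < _).
  rewrite mulr0n add0r.
  rewrite -(@hchain_mirror R n.+2 2^-1 beta tau m (count id s)%:Z
    (fun x => (y' + 1 < x n.+2 + (count id s)%:Z)%R%:R) F2 (start s)) //.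
  - rewrite /hchain -chainD; apply: hchain_pw => // x; rewrite /F /F1.
    case: (ltP (x 0%N) y) => hy; first by rewrite mulr1n -[leLHS]addr0 lerD//; case: (_ < _).
    case: (ltP (y' + 1) _) => hy'; first by rewrite mulr1n mulr0n add0r; case: (_ < _).
    rewrite addr0; case: ltP => // hF; exfalso.
    move: sc hF hy hy' yy'; rewrite /pcount -(ler_int R y) -(ler_int R _ (y' + 1)) !rmorphB !rmorphD /=.
    rewrite -[(count id s)%:~R]/((count id s)%:R).
    move: (count id s)%:R => cs; move: (x 0%N)%:~R (x n.+2)%:~R => x0 xN sc hF hy hy' /andP[y1' y2'].
    lra.
  - by move=> v; rewrite -sN => vN; rewrite start_mirror.
  - by move=> x x' xx'; rewrite /F2 xx'// /mirror subn0 subr0.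
apply: (@le_trans _ _ (bern (law v0.+1 b (r / q)) (fun s => hchain n.+2 2^-1 beta tau m F1 (start s) +
   ((pcount R s < c%:~R)%R%:R + hchain n.+2 beta 2^-1 tau m F2 (start (rev (map negb s))))))).
  by apply: bern_le; [exact: drs|move=> s; rewrite szN => sN; exact: key].
rewrite !bernD.
have e1 : bern (law v0.+1 b (r / q)) (fun s => hchain n.+2 2^-1 beta tau m F1 (start s)) <= 6 / K.
  (* [left_lower] is used with x = 16 B / q, since it tolerates densities up to 1/2 + x / 16 and the
     bump is at most B / q. *)
  have x0 : 0 <= 16 * B / q <= 6^-1.
    by apply/andP; split; [rewrite divr_ge0//; lra|rewrite -mulrA; lra].
  have dl : all (fun r => 0 <= r <= 2^-1 + 16 * B / q / 16) (law v0.+1 b (r / q)).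
    have -> : 16 * B / q / 16 = B / q by field; rewrite gt_eqF.
    move: rq; rewrite ler_norml => /andP[rq1 rq2].
    by rewrite !all_cat !all_nseq; apply/and3P; split; apply/orP; right; lra.
  have xb : 2^-1 + 16 * B / q <= beta by move: x0 => /andP[_ x6]; lra.
  apply: le_trans (@left_lower R n.+1 (16 * B / q) (K * q) tau t m beta y _ tE x0 xb (ltW Kq0) t0 t1 (szN _) dl _) _.
    lra.
  have -> : 16 * B / q * (K * q) / 12 = 4 / 3 * (B * K) by field; rewrite gt_eqF.
  have -> : 4 * (16 * B / q) * (K * q) = 64 * (B * K) by field; rewrite gt_eqF.
  have BK : K <= B * K by rewrite ler_peMl// ltW.
  have xt : 8 * (16 * B / q) ^+ 3 * t <= 1.
    have -> : 8 * (16 * B / q) ^+ 3 * t = 8 * (16 * B) ^+ 3 * t / q ^+ 3.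
      by field; rewrite gt_eqF.
    by rewrite ler_pdivrMr ?exprn_gt0// mul1r.
  have eK : expR (- K) <= K^-1.
    by rewrite expRN lef_pV2 ?posrE ?expR_gt0//; have := expR_ge1Dx K; lra.
  have e3 : expR (- (4 / 3 * (B * K))) <= expR (- K) by rewrite ler_expR; lra.
  have e4 : expR (8 * (16 * B / q) ^+ 3 * t - 64 * (B * K)) <= expR (- K).
    by rewrite ler_expR; lra.
  lra.
have e2 : bern (law v0.+1 b (r / q)) (fun s => (pcount R s < c%:~R)%R%:R) <= 1 / K.
  apply: (@le_trans _ _ (bern (law v0.+1 b (r / q)) (fun s => (K * q <= `|pcount R s - EM|)%R%:R))).
    apply: bern_le; first exact: drs.
    move=> s _; case: ltP => // sc; rewrite mulr1n.
    have h : K * q <= EM - pcount R s.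
      by move: sc c2 => /ltW; move: (pcount R s) (c%:~R) (K * q) (EM); clear; move=> *; lra.
    by rewrite distrC ger0_norm ?h// (le_trans (ltW Kq0) h).
  have := @bern_cheb R (law v0.+1 b (r / q)) (K * q) (drs _ rq) Kq0.
  rewrite sE szN => e; apply: (le_trans e).
  rewrite ler_pdivrMr ?mulr_gt0 ?exprn_gt0//.
  have -> : 1 / K * (4 * (K * q) ^+ 2) = 4 * K * q ^+ 2 by field; rewrite gt_eqF.
  rewrite -(natr1 n.+1) -qE; nra.
have e3 : bern (law v0.+1 b (r / q)) (fun s => hchain n.+2 beta 2^-1 tau m F2 (start (rev (map negb s)))) <= 5 / K.
  pose G s := hchain n.+2 beta 2^-1 tau m F2 (start s).
  have -> : bern (law v0.+1 b (r / q)) (fun s => hchain n.+2 beta 2^-1 tau m F2 (start (rev (map negb s)))) =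
     bern (law v0.+1 b (- (r / q))) G.
    by rewrite -rev_law bern_rev bern_negb.
  (* [left_upper] holds for every configuration outside the first block, so that configuration, bump
     included, is fixed first. *)
  rewrite /law bern_cat bern_exchange.
  have drs' : dens (nseq b (2^-1 - r / q) ++ nseq v0.+1 2^-1).
    have := drs (- (r / q)); rewrite normrN => /(_ rq); rewrite /dens /law all_cat.
    by case/andP.
  apply: (@le_trans _ _ (bern (nseq b (2^-1 - r / q) ++ nseq v0.+1 2^-1) (fun=> 5 / K))); last first.
    by rewrite bern_cst.
  apply: bern_le => // r0; rewrite size_cat !size_nseq => r0N.
  have r0N' : size r0 = (n.+1 - v0)%N by move: r0N abN; clear; lia.
  exact: (left_upper tE b0 t0 t1' qE K1 qK tq v0n r0N' yy').
lra.
Qed.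

End CountDeficit.

Section Concentration.
Variable R : realType.

Lemma cchain_ge N (alpha1 beta1 alpha2 beta2 tau : R) m f1 f2 s :
  (0 < N)%N -> 0 <= alpha1 <= alpha2 -> 0 <= beta2 <= beta1 -> 0 <= tau ->
  tau * (alpha2 + beta1 + N%:R) <= 1 ->
  (forall s1 s2, le_seq s1 s2 -> f2 s2 <= f1 s1) ->
  cchain N alpha2 beta2 tau m f2 s <= cchain N alpha1 beta1 tau m f1 s.
Proof.
move=> N0 a12 b12 t0 t1 f12.
rewrite -lerN2 -[leLHS]mulN1r -[leRHS]mulN1r /cchain -!chainZ.
by apply: cchain_le => // s1 s2 /f12; rewrite !mulN1r lerN2.
Qed.

Lemma cchain_pw N (alpha beta tau : R) m f g s :
  (0 < N)%N -> 0 <= alpha -> 0 <= beta -> 0 <= tau ->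
  tau * (alpha + beta + N%:R) <= 1 ->
  (forall s', size s' = size s -> f s' <= g s') ->
  cchain N alpha beta tau m f s <= cchain N alpha beta tau m g s.
Proof.
move=> N0 a0 b0 t0 t1 fg.
have r0 i : 0 <= rate N alpha beta tau i by exact: rate_ge0.
apply: (chain_le r0 (sum_rate_le N0 t0 t1) (P := fun s' => size s' = size s)) => //.
by move=> i x; rewrite size_cupd.
Qed.

Lemma hgt_total J s : hgt (J, s) 0%N - hgt (J, s) (size s) = (count id s)%:Z.
Proof. by rewrite /hgt /= parts0 parts_size//; lia. Qed.

Lemma max1_le (x : R) : 2^-1 <= x -> Num.max x 1 <= x + 1.
Proof. by move=> x0; rewrite ge_max; apply/andP; split; lra. Qed.

Section Bounds.
Variables (n v0 b m : nat) (K q B alpha beta tau t : R).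
Hypotheses (tE : t = m%:R * tau) (t0 : 0 <= tau).
Hypotheses (a12 : 2^-1 <= alpha) (b12 : 2^-1 <= beta).
Hypothesis t1 : tau * (alpha + beta + 1 + n.+2%:R) <= 1.
Hypotheses (qE : q ^+ 2 = n.+1%:R) (K1 : 1 <= K) (qK : 4 * (20 * K + 1) <= q).
Hypothesis tq : 8 * (20 * K + 1) ^+ 3 * t <= q ^+ 3.
Hypotheses (B1 : 1 <= B) (Bq : 96 * B <= q) (tB : 8 * (16 * B) ^+ 3 * t <= q ^+ 3).
Hypotheses (v0n : (v0 <= n.+1 <= 4 * v0)%N) (abN : (v0.+1 + b + v0.+1 = n.+2)%N).

Let mean r : R := n.+2%:R / 2 + b%:R * (r / q).

(** Entrance rate 1/2 and exit rate at least 1 only remove particles; the extra 1 in [t1] leaves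
    room for the raised rate. *)
Lemma count_lower r : `|r| <= B ->
  bern (law v0.+1 b (r / q)) (fun s => cchain n.+2 alpha beta tau m
    (fun s' => (pcount R s' < mean r - 5 * (K * q))%R%:R) s) <= 12 / K.
Proof.
have ha := a12; have hb := b12; have hK := K1; have hqK := qK; have hB := B1; have hBq := Bq.
move=> rB; pose beta' := Num.max beta 1.
have b'1 : 1 <= beta' by rewrite le_max lexx orbT.
have b'b : beta <= beta' by rewrite le_max lexx.
have b'b1 : beta' <= beta + 1 by exact: max1_le.
have hlf : 0 <= 2^-1 :> R by rewrite invr_ge0.
have q0 : 0 < q by lra.
have t1' : tau * (2^-1 + beta' + n.+2%:R) <= 1.
  by apply: le_trans t1; rewrite ler_wpM2l//; lra.
have t1'' : tau * (alpha + beta' + n.+2%:R) <= 1.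
  by apply: le_trans t1; rewrite ler_wpM2l//; lra.
have drs : dens (law v0.+1 b (r / q)).
  apply: dens_law; rewrite normrM normfV (gtr0_norm q0) ler_pdivrMr//; lra.
apply: le_trans (count_deficit tE t0 b'1 t1' qE K1 qK tq B1 rB Bq tB v0n abN).
apply: bern_le => // s; rewrite size_law abN => sN.
rewrite (@hchain_cchain _ _ _ _ _ _ _ (fun s' => (pcount R s' < mean r - 5 * (K * q))%R%:R))//.
- apply: cchain_ge => //; [by rewrite hlf|by rewrite b'b andbT; lra|].
  move=> s1 s2 /le_seq_count h; case: (ltP (pcount R s2)) => // h2; case: (ltP (pcount R s1)) => // h1; exfalso.
  have h3 : pcount R s1 <= pcount R s2 by rewrite ler_nat.
  by have := lt_le_trans (le_lt_trans h3 h2) h1; rewrite ltxx.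
- by move=> x x' xx'; rewrite !xx'.
- by move=> J s' s'N; have := hgt_total J s'; rewrite s'N => ->.
Qed.

(** An excess of particles is a deficit of holes: in the reflected system the bump is [- r] and the
    holes leave at rate [alpha']. *)
Lemma count_upper r : `|r| <= B ->
  bern (law v0.+1 b (r / q)) (fun s => cchain n.+2 alpha beta tau m
    (fun s' => (mean r + 5 * (K * q) < pcount R s')%R%:R) s) <= 12 / K.
Proof.
have ha := a12; have hb := b12; have hK := K1; have hqK := qK; have hB := B1; have hBq := Bq.
move=> rB; pose alpha' := Num.max alpha 1.
have b'1 : 1 <= alpha' by rewrite le_max lexx orbT.
have b'b : alpha <= alpha' by rewrite le_max lexx.
have b'b1 : alpha' <= alpha + 1 by exact: max1_le.
have hlf : 0 <= 2^-1 :> R by rewrite invr_ge0.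
have q0 : 0 < q by lra.
have t1' : tau * (2^-1 + alpha' + n.+2%:R) <= 1.
  by apply: le_trans t1; rewrite ler_wpM2l//; lra.
have t1'' : tau * (alpha' + beta + n.+2%:R) <= 1.
  by apply: le_trans t1; rewrite ler_wpM2l//; lra.
have drs : dens (law v0.+1 b (r / q)).
  apply: dens_law; rewrite normrM normfV (gtr0_norm q0) ler_pdivrMr//; lra.
have rB' : `|- r| <= B by rewrite normrN.
apply: le_trans (count_deficit tE t0 b'1 t1' qE K1 qK tq B1 rB' Bq tB v0n abN).
rewrite mulNr -rev_law bern_rev bern_negb.
apply: bern_le => // s; rewrite size_law abN => sN.
apply: (@le_trans _ _ (cchain n.+2 alpha' 2^-1 tau m
    (fun s' => (mean r + 5 * (K * q) < pcount R s')%R%:R) s)).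
  apply: cchain_le => //; [by rewrite b'b andbT; lra|by rewrite hlf|].
  move=> s1 s2 /le_seq_count h; case: (ltP _ (pcount R s1)) => // h2; case: (ltP _ (pcount R s2)) => // h1; exfalso.
  have h3 : pcount R s1 <= pcount R s2 by rewrite ler_nat.
  by have := lt_le_trans (lt_le_trans h2 h3) h1; rewrite ltxx.
rewrite -(@hchain_cchain _ _ _ _ _ _ (fun x => (mean r + 5 * (K * q) < (x 0%N - x n.+2)%:~R)%R%:R))//.
- rewrite /= (@hchain_mirror R n.+2 alpha' 2^-1 tau m (count id s)%:Z _
   (fun n' => ((n' 0%N - n' n.+2)%:~R < n.+2%:R / 2 + b%:R * - (r / q) - 5 * (K * q))%R%:R)
   _ (start (rev (map negb s))))//.
  + by move=> v; rewrite -sN => vN; rewrite start_mirror.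
  + move=> x x' xx'; rewrite !xx'// /mirror subn0 subnn; congr (nat_of_bool _)%:R.
    rewrite /mean !(rmorphD, rmorphN) /=.
    rewrite -[(n.+2%:Z)%:~R]/(n.+2%:R) -[(count id s)%:~R]/((count id s)%:R) -[(0%:Z)%:~R]/(0%:R).
    apply/idP/idP; lra.
- by move=> x x' xx'; rewrite !xx'.
- by move=> J s' s'N; have := hgt_total J s'; rewrite s'N => ->.
Qed.

Lemma count_near r : `|r| <= B ->
  bern (law v0.+1 b (r / q)) (fun s => cchain n.+2 alpha beta tau m
    (fun s' => (`|pcount R s' - mean r| <= 5 * (K * q))%R%:R) s) >= 1 - 24 / K.
Proof.
have ha := a12; have hb := b12; have hK := K1; have hqK := qK; have hB := B1; have hBq := Bq.
move=> rB; have := count_lower rB; have := count_upper rB.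
set L := bern _ _; set U := bern _ _ => h1 h2; set M := bern _ _.
have q0 : 0 < q by lra.
have drs : dens (law v0.+1 b (r / q)).
  apply: dens_law; rewrite normrM normfV (gtr0_norm q0) ler_pdivrMr//; lra.
suff : 1 <= L + U + M by lra.
rewrite /L /U /M -!bernD -[leLHS](bern_cst (law v0.+1 b (r / q))).
apply: bern_le => // s _; rewrite /cchain -!chainD.
rewrite -[leLHS](@chain_cst _ _ (rate n.+2 alpha beta tau) _ (fun i : 'I_n.+3 => cupd n.+2 i) m 1 s).
apply: cchain_pw => //; try lra.
  by apply: le_trans t1; rewrite ler_wpM2l//; lra.
move=> s' _; rewrite ler_norml.
case: ltP => h3; first by rewrite -addrA lerDl addr_ge0.
case: ltP => h4; first by rewrite add0r lerDl.
rewrite !add0r; case: andP => // -[]; split; lra.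
Qed.

End Bounds.
End Concentration.

(** * The semigroup and its stationary distribution *)

Lemma nth_inj s v : (0 < size s)%N ->
  nth false (inj s) v = (v == 0%N) || nth false s v.
Proof. by case: s v => [|a s] [|v]. Qed.

Lemma nth_out s v : nth false (out s) v = (v.+1 != size s) && nth false s v.
Proof.
elim: s v => [|a [|b s] IH] v; first by rewrite !nth_nil andbF.
  by case: v => [|v] //=; rewrite !nth_nil andbF.
by case: v => [|v] //=; rewrite IH eqSS.
Qed.

Lemma nth_bond k s v : (k.+1 < size s)%N ->
  nth false (bond k s) v =
  if v == k then nth false s k && nth false s k.+1
  else if v == k.+1 then nth false s k || nth false s k.+1 else nth false s v.
Proof.
elim: k s v => [|k IH] [|a [|b s]] [|[|v]] //= ks.
- by rewrite IH.
- by rewrite IH //= eqSS.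
Qed.

(** * The generator in terms of random maps *)

Section Link.
Variables (n : nat).
Implicit Types (eta xi : config n) (s : seq bool).

Definition cseq eta : seq bool := mkseq (fun i => eta (inord i)) n.+1.

Lemma size_cseq eta : size (cseq eta) = n.+1. Proof. exact: size_mkseq. Qed.

Lemma nth_cseq eta (i : 'I_n.+1) : nth false (cseq eta) i = eta i.
Proof. by rewrite nth_mkseq// inord_val. Qed.

Lemma cseqP s : size s = n.+1 -> exists eta, cseq eta = s.
Proof.
move=> sN; exists [ffun i : 'I_n.+1 => nth false s i].
apply: (@eq_from_nth _ false); rewrite size_cseq ?sN// => i iN.
by rewrite nth_mkseq// ffunE inordK.
Qed.

Lemma cseq_flip0 eta : eta ord0 = false -> cseq (flip ord0 eta) = inj (cseq eta).
Proof.
move=> e0; apply: (@eq_from_nth _ false); rewrite ?size_inj !size_cseq// => i iN.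
rewrite -[i]/(nat_of_ord (Ordinal iN)) nth_inj ?size_cseq// !nth_cseq ffunE -val_eqE /=.
case: eqP => //= i0; have -> : Ordinal iN = ord0 by apply/val_inj.
by rewrite e0.
Qed.

Lemma cseq_inj1 eta : eta ord0 -> inj (cseq eta) = cseq eta.
Proof.
move=> e0; apply: (@eq_from_nth _ false); rewrite ?size_inj !size_cseq// => i iN.
rewrite -[i]/(nat_of_ord (Ordinal iN)) nth_inj ?size_cseq// !nth_cseq /=.
case: eqP => //= i0; have -> : Ordinal iN = ord0 by apply/val_inj.
by rewrite e0.
Qed.

Lemma cseq_flipN eta : eta ord_max -> cseq (flip ord_max eta) = out (cseq eta).
Proof.
move=> e0; apply: (@eq_from_nth _ false); rewrite ?size_out !size_cseq// => i iN.
rewrite -[i]/(nat_of_ord (Ordinal iN)) nth_out ?size_cseq// !nth_cseq ffunE -val_eqE /= eqSS.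
case: eqP => //= i0; have -> : Ordinal iN = ord_max by apply/val_inj.
by rewrite e0.
Qed.

Lemma cseq_out0 eta : eta ord_max = false -> out (cseq eta) = cseq eta.
Proof.
move=> e0; apply: (@eq_from_nth _ false); rewrite ?size_out !size_cseq// => i iN.
rewrite -[i]/(nat_of_ord (Ordinal iN)) nth_out ?size_cseq// !nth_cseq /= eqSS.
case: eqP => //= i0; have -> : Ordinal iN = ord_max by apply/val_inj.
by rewrite e0.
Qed.

Lemma nth_cseq_inord eta i : (i < n.+1)%N -> nth false (cseq eta) i = eta (inord i).
Proof. by move=> iN; rewrite nth_mkseq. Qed.

Lemma cseq_swap eta k : (k < n)%N -> eta (inord k) -> eta (inord k.+1) = false ->
  cseq (swap (inord k) (inord k.+1) eta) = bond k (cseq eta).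
Proof.
move=> kn e1 e2; apply: (@eq_from_nth _ false); rewrite ?size_bond !size_cseq// => i iN.
have k1 : (k < n.+1)%N by exact: ltnW.
rewrite nth_bond ?size_cseq// !nth_cseq_inord// e1 e2 ffunE.
case: tpermP => [/(congr1 val)|/(congr1 val)|].
- by rewrite /= !inordK// => ->; rewrite eqxx.
- by rewrite /= !inordK// => ->; rewrite eqxx; case: eqP => // h; exfalso; lia.
move=> h1 h2; case: eqP => [ik|_]; first by case: h1; rewrite ik.
by case: eqP => [ik|_] //; case: h2; rewrite ik.
Qed.

Lemma cseq_bond eta k : (k < n)%N -> ~~ (eta (inord k) && ~~ eta (inord k.+1)) ->
  bond k (cseq eta) = cseq eta.
Proof.
move=> kn e; apply: (@eq_from_nth _ false); rewrite ?size_bond !size_cseq// => i iN.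
have k1 : (k < n.+1)%N by exact: ltnW.
rewrite nth_bond ?size_cseq// !nth_cseq_inord//.
by case: eqP => [->|_]; [|case: eqP => [->|//]];
  case: (eta (inord k)) (eta (inord k.+1)) e => [] [].
Qed.

Variable R : realType.
Variables (alpha beta : R).

(** A blocked ring acts as the identity, which replaces the exclusion factors of the generator. *)
Lemma generatorE (F : seq bool -> R) eta :
  generator alpha beta (F \o cseq) eta =
  \sum_(i < n.+2) rate n.+1 alpha beta 1 i * (F (cupd n.+1 i (cseq eta)) - F (cseq eta)).
Proof.
rewrite big_ord_recl big_ord_recr /= /generator [RHS]addrCA addrA.
rewrite /rate /= !mul1r eqxx; congr (_ + _ + _).
- apply: eq_bigr => i _; rewrite /bump /= !add1n eqSS.
  have -> s : cupd n.+1 i.+1 s = bond i s.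
    by rewrite /cupd eqSS (ltn_eqF (ltn_ord i)).
  have -> : (i == n :> nat) = false by apply/negbTE; rewrite neq_ltn ltn_ord.
  rewrite /= mul1r; case: (boolP (eta (inord i) && ~~ eta (inord i.+1))) => h.
    by have /andP[e1 /negbTE e2] := h; rewrite cseq_swap// e1 e2 subr0 !mul1r.
  rewrite (cseq_bond (ltn_ord i) h) subrr.
  by move: h; case: (eta (inord i)) (eta (inord i.+1)) => [] [] //= _; rewrite ?subrr ?mulr0 ?mul0r.
- have -> s : cupd n.+1 0 s = inj s by [].
  case e0: (eta ord0).
    by rewrite cseq_inj1// !subrr !mulr0 mul0r.
  by rewrite cseq_flip0// subr0 mulr1.
- have -> s : cupd n.+1 (bump 0 n) s = out s by rewrite /cupd /bump /= add1n eqxx.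
  case e0: (eta ord_max).
    by rewrite cseq_flipN// mulr1.
  by rewrite cseq_out0// subrr !mulr0 mul0r.
Qed.

End Link.

Lemma ffact_le_exp m k : (m ^_ k <= m ^ k)%N.
Proof.
elim: k m => [|k IH] [|m] //; rewrite ffactnS expnS leq_mul2l /=.
apply: leq_trans (IH m) _; case: k {IH} => // k; by rewrite leq_exp2r.
Qed.

(** * The exponential of the generator as a limit of chains *)

Section Exponential.
Variable R : realType.

Lemma near_succ_ge (r : R) : \forall m \near \oo, r <= m.+1%:R.
Proof.
near=> m; apply: (@le_trans _ _ m%:R); last by rewrite ler_nat.
by near: m; exact: nbhs_infty_ger.
Unshelve. all: by end_near.
Qed.

Lemma bin_coeff_le (t : R) m k : 0 <= t ->
  'C(m, k)%:R * (t / m%:R) ^+ k <= t ^+ k / k`!%:R.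
Proof.
move=> t0; case: m => [|m].
  rewrite bin0n; case: k => [|k] /=; first by rewrite fact0 !expr0 mulr1 divr1.
  by rewrite mul0r divr_ge0 ?exprn_ge0.
have k0 : (0 : R) < k`!%:R by rewrite ltr0n fact_gt0.
have m0 : (0 : R) < m.+1%:R ^+ k by rewrite exprn_gt0 ?ltr0n.
rewrite expr_div_n mulrCA ler_wpM2l ?exprn_ge0// ler_pdivrMr// mulrC ler_pdivlMr//.
by rewrite -natrX -natrM ler_nat bin_ffact ffact_le_exp.
Qed.

Lemma exp1_binom (y : R) m M : (m < M)%N ->
  (1 + y) ^+ m = \sum_(k < M) 'C(m, k)%:R * y ^+ k.
Proof.
move=> mM; rewrite exprDn (big_ord_widen M (fun k => 1 ^+ (m - k) * y ^+ k *+ 'C(m, k)))//.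
rewrite [RHS](bigID (fun k : 'I_M => (k < m.+1)%N)) /= [X in _ + X]big1 ?addr0; last first.
  by move=> k; rewrite -leqNgt => mk; rewrite bin_small// mul0r.
by apply: eq_bigr => k _; rewrite expr1n mul1r mulr_natl.
Qed.

Lemma euler_exp (x : R) m : 0 <= x -> 4 * x <= m%:R -> (0 < m)%N ->
  expR x - (1 + x / m%:R) ^+ m <= expR x * (2 * x ^+ 2 / m%:R).
Proof.
move=> x0 xm m0; have mR : (0 : R) < m%:R by rewrite ltr0n.
set y := x / m%:R.
have y0 : 0 <= y by rewrite divr_ge0.
have y4 : y <= 4^-1 by rewrite ler_pdivrMr//; lra.
have h : expR (y - 2 * y ^+ 2) <= 1 + y.
  apply: le_trans (expR_le_quad _) _; first by nra.
  by nra.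
have : expR (x - 2 * x ^+ 2 / m%:R) <= (1 + y) ^+ m.
  have -> : x - 2 * x ^+ 2 / m%:R = m%:R * (y - 2 * y ^+ 2).
    by rewrite /y; field; rewrite gt_eqF.
  by rewrite expRM_natl lerXn2r ?nnegrE ?expR_ge0//; lra.
rewrite expRD => h2.
have := expR_ge1Dx (- (2 * x ^+ 2 / m%:R)).
have := expR_gt0 x; nra.
Qed.

Variables (I : finType) (S : Type) (a : I -> R) (U : I -> S -> S).
Hypothesis a_ge0 : forall i, 0 <= a i.

Definition gen (f : S -> R) s := \sum_i a i * (f (U i s) - f s).
Let C := 2 * \sum_i a i.

Lemma gen_bound (f : S -> R) c s : (forall s, `|f s| <= c) -> `|gen f s| <= C * c.
Proof.
move=> fc; rewrite /gen /C mulrAC mulr_sumr; apply: le_trans (ler_norm_sum _ _ _) _.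
apply: ler_sum => i _; rewrite normrM (ger0_norm (a_ge0 i)) mulrC ler_wpM2r//.
apply: le_trans (ler_normB _ _) _; have := fc (U i s); have := fc s; lra.
Qed.

Lemma gen_iter_bound (f : S -> R) c k s : (forall s, `|f s| <= c) ->
  `|iter k gen f s| <= C ^+ k * c.
Proof.
move=> fc; elim: k s => [|k IH] s; first by rewrite expr0 mul1r.
by rewrite iterS exprS -mulrA; apply: gen_bound.
Qed.

Lemma gen_sum M (b : 'I_M -> R) (g : 'I_M -> S -> R) s :
  gen (fun s => \sum_k b k * g k s) s = \sum_k b k * gen (g k) s.
Proof.
rewrite /gen; under eq_bigr => i _.
  rewrite -sumrB mulr_sumr; under eq_bigr do rewrite -mulrBr mulrCA; over.
rewrite exchange_big; apply: eq_bigr => k _; by rewrite mulr_sumr.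
Qed.

(** The sum may run to any M > m, so that it can be subtracted term by term from a partial sum of
    the exponential series. *)
Lemma chain_binom tau m M (f : S -> R) s : (m < M)%N ->
  chain (fun i => tau * a i) U m f s =
  \sum_(k < M) 'C(m, k)%:R * tau ^+ k * iter k gen f s.
Proof.
elim: m M s => [|m IH] M s mM.
  case: M mM => // M _; rewrite big_ord_recl big1 ?addr0 ?expr0 ?mulr1 ?mul1r//.
  by move=> k _; rewrite bin0n !mul0r.
case: M mM => // M mM; rewrite chainS.
have -> : \sum_i tau * a i * (chain (fun i => tau * a i) U m f (U i s) -
      chain (fun i => tau * a i) U m f s) =
    tau * gen (fun s => \sum_(k < M) 'C(m, k)%:R * tau ^+ k * iter k gen f s) s.
  rewrite /gen mulr_sumr; apply: eq_bigr => i _.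
  by rewrite !(IH M)// mulrA.
rewrite (IH M.+1 s) 1?ltnW// (@gen_sum M (fun k => 'C(m, k)%:R * tau ^+ k) (fun k => iter k gen f)).
rewrite !big_ord_recl !bin0 -addrA mulr_sumr -big_split; congr (_ + _).
by apply: eq_bigr => k _; rewrite /bump /= binS natrD exprS; ring.
Qed.

Definition expgen (t : R) (f : S -> R) s : R :=
  limn (series (fun k : nat => t ^+ k / k`!%:R * iter k gen f s)).

Section Error.
Variables (t c : R) (f : S -> R) (s : S).
Hypotheses (t0 : 0 <= t) (fc : forall s, `|f s| <= c).

Let u : R^nat := fun k => t ^+ k / k`!%:R * iter k gen f s.

Let C0 : 0 <= C. Proof. by rewrite mulr_ge0// sumr_ge0. Qed.
Let c0 : 0 <= c. Proof. exact: le_trans (fc s). Qed.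

Let u_le k : `|u k| <= c * exp_coeff (t * C) k.
Proof.
rewrite /u normrM ger0_norm ?divr_ge0 ?exprn_ge0//.
apply: le_trans (ler_wpM2l _ (gen_iter_bound k s fc)) _; first by rewrite divr_ge0 ?exprn_ge0.
by rewrite /exp_coeff /= [(t * C) ^+ k]exprMn; move: (C ^+ k) => y; rewrite le_eqVlt; apply/orP; left; apply/eqP; ring.
Qed.

Lemma cvg_expgen : cvgn (series u).
Proof.
apply: normed_cvg; apply: (@series_le_cvg _ _ (fun k => c * exp_coeff (t * C) k)) => //.
- by move=> k; rewrite normr_ge0.
- by move=> k; apply: mulr_ge0 => //; apply: exp_coeff_ge0; apply: mulr_ge0.
- exact: (is_cvg_seriesZ (k := c) (is_cvg_series_exp_coeff (t * C))).
Qed.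

(** The coefficients of the exponential series dominate those of the binomial expansion, so the
    error is at most the scalar one with the generator replaced by its norm bound [C]. *)
Lemma expgen_chain m : (0 < m)%N ->
  `|expgen t f s - chain (fun i => t / m%:R * a i) U m f s| <=
  c * (expR (t * C) - (1 + t * C / m%:R) ^+ m).
Proof.
move=> m0; set v := chain _ _ _ _ _; set e := c * _.
have near M : (m < M)%N -> `|series u M - v| <= e.
  move=> mM; rewrite /v (chain_binom _ _ _ mM) /series /= big_mkord -sumrB.
  apply: le_trans (ler_norm_sum _ _ _) _.
  apply: (@le_trans _ _ (c * (series (exp_coeff (t * C)) M - (1 + t * C / m%:R) ^+ m))).
    rewrite (exp1_binom _ mM) /series /= big_mkord -sumrB mulr_sumr; apply: ler_sum => k _.
    rewrite /u -mulrBl normrM.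
    have h := @bin_coeff_le t m k t0.
    rewrite ger0_norm ?subr_ge0//.
    apply: le_trans (ler_wpM2l _ (gen_iter_bound k s fc)) _; first by rewrite subr_ge0.
    rewrite /exp_coeff /= [(t * C) ^+ k]exprMn [t * C / _]mulrAC [(t / _ * C) ^+ _]exprMn.
    by move: (C ^+ k) => y; rewrite le_eqVlt; apply/orP; left; apply/eqP; ring.
  rewrite /e ler_wpM2l// lerD2r; apply: nondecreasing_cvgn_le; last exact: is_cvg_series_exp_coeff.
  apply: nondecreasing_series => k _ _; by apply: exp_coeff_ge0; apply: mulr_ge0.
rewrite ler_norml; apply/andP; split.
  rewrite lerBrDr addrC; apply: limr_ge; first exact: cvg_expgen.
  exists m.+1 => // M /= mM; have := near _ mM; rewrite ler_norml; lra.
rewrite lerBlDr addrC; apply: limr_le; first exact: cvg_expgen.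
exists m.+1 => // M /= mM; have := near _ mM; rewrite ler_norml; lra.
Qed.

End Error.

Lemma chain_cvg t (f : S -> R) s c : 0 <= t -> (forall s, `|f s| <= c) ->
  (fun m => chain (fun i => t / m.+1%:R * a i) U m.+1 f s) @ \oo --> expgen t f s.
Proof.
move=> t0 fc; set x := t * C.
have x0 : 0 <= x by rewrite mulr_ge0// mulr_ge0// sumr_ge0.
have c0 : 0 <= c := le_trans (normr_ge0 _) (fc s).
apply/cvgrPdist_le => e e0.
near=> m.
apply: le_trans (expgen_chain s t0 fc (ltn0Sn m)) _.
have m4 : 4 * x <= m.+1%:R by near: m; exact: near_succ_ge.
apply: le_trans (ler_wpM2l c0 (euler_exp x0 m4 (ltn0Sn m))) _.
have mR : (0 : R) < m.+1%:R by rewrite ltr0n.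
have -> : c * (expR x * (2 * x ^+ 2 / m.+1%:R)) = c * (expR x * (2 * x ^+ 2)) / m.+1%:R.
  by field; rewrite gt_eqF.
rewrite ler_pdivrMr// [e * _]mulrC -ler_pdivrMr//.
by near: m; exact: near_succ_ge.
Unshelve. all: by end_near.
Qed.

End Exponential.

(** P - 1 kills the constant vector on the right, so it is singular and also has a left null
    vector. *)
Lemma invariant_vector (F : fieldType) (T : finType) (x0 : T) (P : T -> T -> F) :
  (forall x, \sum_y P x y = 1) ->
  exists2 v : T -> F, (exists x, v x != 0) & forall y, \sum_x v x * P x y = v y.
Proof.
move=> P1; pose k := #|T|.
pose Q : 'M[F]_k := \matrix_(i, j) (P (enum_val i) (enum_val j) - (i == j)%:R).
have sumT (f : T -> F) : \sum_(i < k) f (enum_val i) = \sum_x f x.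
  by rewrite [RHS](reindex (@enum_val T T)) //; apply: onW_bij; exact: enum_val_bij.
have : \det Q == 0.
  rewrite -det_tr; apply/det0P; exists (const_mx 1).
    apply/negP => /eqP /rowP /(_ (enum_rank x0)); rewrite !mxE => /eqP.
    by rewrite oner_eq0.
  apply/rowP => j; rewrite !mxE.
  under eq_bigr do rewrite !mxE mul1r.
  rewrite sumrB (sumT (fun y => P (enum_val j) y)) P1 (bigD1 j) //= eqxx big1 ?addr0 ?subrr//.
  by move=> i ij; rewrite eq_sym (negbTE ij).
move=> /det0P[w w0 wQ]; exists (fun x => w ord0 (enum_rank x)).
  have /rV0Pn[j wj] := w0; exists (enum_val j); by rewrite enum_valK.
move=> y; move/rowP: wQ => /(_ (enum_rank y)); rewrite !mxE.
under eq_bigr do rewrite mxE enum_rankK mulrBr.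
rewrite sumrB => /eqP; rewrite subr_eq0 => /eqP.
rewrite [X in _ = X](bigD1 (enum_rank y)) //= eqxx mulr1 [X in _ = _ + X]big1 ?addr0; last first.
  by move=> i iy; rewrite (negbTE iy) mulr0.
move=> <-; rewrite -sumT; apply: eq_bigr => i _; by rewrite enum_valK.
Qed.

(* The absolute value of an invariant vector is subinvariant, hence invariant
   because a stochastic kernel preserves the total mass. *)
Lemma invariant_distribution (R : realFieldType) (T : finType) (x0 : T) (P : T -> T -> R) :
  (forall x y, 0 <= P x y) -> (forall x, \sum_y P x y = 1) ->
  exists mu : T -> R, [/\ forall x, 0 <= mu x, \sum_x mu x = 1 &
    forall y, \sum_x mu x * P x y = mu y].
Proof.
move=> P0 P1; have [v [x vx] vP] := invariant_vector x0 P1.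
pose S := \sum_x `|v x|.
have S0 : 0 < S.
  rewrite /S (bigD1 x)//= ltr_pwDl ?normr_gt0// sumr_ge0// => y _; exact: normr_ge0.
have le y : `|v y| <= \sum_x `|v x| * P x y.
  rewrite -{1}vP; apply: le_trans (ler_norm_sum _ _ _) _.
  by apply: ler_sum => z _; rewrite normrM (ger0_norm (P0 _ _)).
have tot : \sum_y (\sum_x `|v x| * P x y - `|v y|) = 0.
  rewrite sumrB exchange_big /=.
  under eq_bigr do rewrite -mulr_sumr P1 mulr1.
  by rewrite subrr.
have eqv y : \sum_x `|v x| * P x y = `|v y|.
  apply/eqP; rewrite -subr_eq0; move/eqP: tot; rewrite psumr_eq0.
    by move=> /allP /(_ y (mem_index_enum _)).
  by move=> z _; rewrite subr_ge0.
exists (fun x => `|v x| / S); split.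
- by move=> z; rewrite divr_ge0// ltW.
- by rewrite -mulr_suml divff// gt_eqF.
- move=> y; rewrite -eqv mulr_suml; apply: eq_bigr => z _; by rewrite mulrAC.
Qed.

Lemma half_l1_ge (R : realFieldType) (T : finType) (nu mu : T -> R) (A : pred T) :
  \sum_x nu x = \sum_x mu x ->
  \sum_x nu x * (A x)%:R - \sum_x mu x * (A x)%:R <= 2^-1 * \sum_x `|nu x - mu x|.
Proof.
move=> e; rewrite -sumrB -(ler_pM2l (ltr0Sn R 1)) mulrA divff// mul1r.
have e0 : \sum_x (nu x - mu x) = 0 by rewrite sumrB e subrr.
rewrite -[leLHS]subr0 -[X in _ - X]e0 mulr_sumr -sumrB; apply: ler_sum => x _.
by case: (A x); [rewrite !mulr1|rewrite !mulr0]; have := ler_norm (nu x - mu x);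
  have := ler_norm (- (nu x - mu x)); rewrite normrN; lra.
Qed.

Lemma bern_cvg (R : realType) (rs : seq R) (G : nat -> seq bool -> R) H :
  (forall s, size s = size rs -> G^~ s @ \oo --> H s) ->
  (fun m => bern rs (G m)) @ \oo --> bern rs H.
Proof.
elim: rs G H => [|r rs IH] G H GH /=; first exact: GH.
have h b : (fun m => bern rs (G m \o cons b)) @ \oo --> bern rs (H \o cons b).
  by apply: IH => s sN; apply: GH; rewrite /= sN.
by apply: cvgD; apply: cvgMr => //; exact: h.
Qed.

Lemma disjoint_small (R : realFieldType) (T : finType) (mu : T -> R) k (A : 'I_k.+1 -> pred T) :
  (forall x, 0 <= mu x) -> \sum_x mu x = 1 ->
  (forall i j x, A i x -> A j x -> i = j) ->
  exists i, \sum_x mu x * (A i x)%:R <= k.+1%:R^-1.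
Proof.
move=> mu0 mu1 dA; apply/existsP; rewrite -[X in is_true X]negbK negb_exists.
apply/negP => /forallP h.
have k0 : (0 : R) < k.+1%:R by rewrite ltr0n.
have : \sum_(i < k.+1) (k.+1%:R^-1 : R) < \sum_i \sum_x mu x * (A i x)%:R.
  apply: ltr_sum; last by move=> i _; have := h i; rewrite -ltNge.
  by rewrite /index_enum -enumT; apply/hasP; exists ord0 => //; rewrite mem_enum.
rewrite sumr_const card_ord -[_^-1 *+ _]mulr_natl divff ?gt_eqF// exchange_big /=.
suff : \sum_x \sum_(i < k.+1) mu x * (A i x)%:R <= 1 by move=> /le_lt_trans /[apply]; rewrite ltxx.
rewrite -[leRHS]mu1; apply: ler_sum => x _; rewrite -mulr_sumr -[leRHS]mulr1 ler_wpM2l//.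
case: (pickP (fun i => A i x)) => [i Ai|nA].
  rewrite (bigD1 i)//= Ai big1 ?addr0// => j /negP ji.
  by case Aj: (A j x) => //; case: ji; apply/eqP; apply: dA Aj Ai.
by rewrite big1// => i _; rewrite nA.
Qed.

Lemma cvg_sumr (R : realType) I (l : seq I) (F : I -> nat -> R) (G : I -> R) :
  (forall i, F i @ \oo --> G i) ->
  (fun m => \sum_(i <- l) F i m) @ \oo --> \sum_(i <- l) G i.
Proof.
move=> FG; elim: l => [|i l IH].
  by rewrite big_nil; under eq_fun do rewrite big_nil; exact: cvg_cst.
by rewrite big_cons; under eq_fun do rewrite big_cons; apply: cvgD.
Qed.

Lemma cvgn_inj (R : realType) (u : R^nat) (a b : R) :
  u @ \oo --> a -> u @ \oo --> b -> a = b.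
Proof. by move=> ua ub; exact: (@norm_cvg_unique _ _ _ _ _ _ ua ub). Qed.

Section Semigroup.
Variables (R : realType) (n : nat) (alpha beta : R).
Hypotheses (a0 : 0 <= alpha) (b0 : 0 <= beta).
Implicit Types (eta xi : config n) (f : config n -> R) (F : seq bool -> R).

Definition cfg (s : seq bool) : config n := [ffun i : 'I_n.+1 => nth false s i].

Lemma cseqK eta : cfg (cseq eta) = eta.
Proof. by apply/ffunP => i; rewrite ffunE nth_cseq. Qed.

Lemma cfgK s : size s = n.+1 -> cseq (cfg s) = s.
Proof. by move=> /cseqP[eta <-]; rewrite cseqK. Qed.

Definition psem (t : R) F s : R :=
  expgen (rate n.+1 alpha beta 1) (fun i : 'I_n.+2 => cupd n.+1 i) t F s.

Lemma semigroupE t F eta : semigroup alpha beta t (F \o @cseq n) eta = psem t F (cseq eta).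
Proof.
have e k : iter k (generator alpha beta) (F \o @cseq n) =
    iter k (gen (rate n.+1 alpha beta 1) (fun i : 'I_n.+2 => cupd n.+1 i)) F \o @cseq n.
  by elim: k => // k IH; rewrite iterS IH; apply/funext => xi; rewrite generatorE.
rewrite /semigroup /psem /expgen; congr (limn (series _)).
by apply/funext => k; rewrite e.
Qed.

Lemma psem_cvg t c F s : 0 <= t -> (forall s, `|F s| <= c) ->
  (fun m => cchain n.+1 alpha beta (t / m.+1%:R) m.+1 F s) @ \oo --> psem t F s.
Proof.
move=> t0 Fc; have r0 i : 0 <= rate n.+1 alpha beta 1 i by exact: rate_ge0.
have e : (fun m => cchain n.+1 alpha beta (t / m.+1%:R) m.+1 F s) =
   (fun m => chain (fun i => t / m.+1%:R * rate n.+1 alpha beta 1 i)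
     (fun i : 'I_n.+2 => cupd n.+1 i) m.+1 F s).
  apply/funext => m; rewrite /cchain.
  have -> // : rate n.+1 alpha beta (t / m.+1%:R) =
      (fun i => t / m.+1%:R * rate n.+1 alpha beta 1 i).
  by apply/funext => i; rewrite /rate mul1r.
by rewrite e; exact: chain_cvg Fc.
Qed.

Lemma cfg_bound f s : `|f (cfg s)| <= \sum_xi `|f xi|.
Proof. by rewrite (bigD1 (cfg s))//= lerDl sumr_ge0. Qed.

Lemma semigroup_cvg t f eta : 0 <= t ->
  (fun m => cchain n.+1 alpha beta (t / m.+1%:R) m.+1 (f \o cfg) (cseq eta)) @ \oo
    --> semigroup alpha beta t f eta.
Proof.
move=> t0; have -> : f = (f \o cfg) \o @cseq n.
  by apply/funext => xi; rewrite /= cseqK.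
have -> : ((f \o cfg) \o @cseq n) \o cfg = f \o cfg.
  by apply/funext => s; rewrite /= cseqK.
by rewrite semigroupE; apply: psem_cvg => // s; exact: cfg_bound.
Qed.

Lemma semigroup_transition t f eta : 0 <= t ->
  \sum_xi transition alpha beta t eta xi * f xi = semigroup alpha beta t f eta.
Proof.
move=> t0; apply: (cvgn_inj _ (@semigroup_cvg t f eta t0)).
have -> : (fun m => cchain n.+1 alpha beta (t / m.+1%:R) m.+1 (f \o cfg) (cseq eta)) =
   (fun m => \sum_xi cchain n.+1 alpha beta (t / m.+1%:R) m.+1
     ((fun zeta => (zeta == xi)%:R) \o cfg) (cseq eta) * f xi).
  apply/funext => m; rewrite /cchain.
  under [RHS]eq_bigr do rewrite mulrC -chainZ.
  rewrite -chain_sum; apply: eq_chain => s /=.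
  rewrite (bigD1 (cfg s))//= eqxx mulr1 big1 ?addr0// => xi xis.
  by rewrite eq_sym (negbTE xis) mulr0.
apply: cvg_sumr => xi; apply: cvgMl; exact: semigroup_cvg.
Qed.

Lemma small_step t : \forall m \near \oo, t / m.+1%:R * (alpha + beta + n.+1%:R) <= 1.
Proof.
near=> m; have mR : (0 : R) < m.+1%:R by rewrite ltr0n.
rewrite mulrAC ler_pdivrMr// mul1r.
by near: m; exact: near_succ_ge.
Unshelve. all: by end_near.
Qed.

Lemma semigroup_cst t eta k : 0 <= t -> semigroup alpha beta t (fun=> k) eta = k.
Proof.
move=> t0; apply: (cvgn_inj _ (cvg_cst k)).
have := @semigroup_cvg t (fun=> k) eta t0.
by under eq_fun do rewrite /cchain chain_cst.
Qed.

Lemma transition_sum t eta : 0 <= t -> \sum_xi transition alpha beta t eta xi = 1.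
Proof.
move=> t0; rewrite -[RHS](@semigroup_cst t eta 1 t0) -semigroup_transition//.
by apply: eq_bigr => xi _; rewrite mulr1.
Qed.

(** A measure invariant under one step of size [tau] is annihilated by the generator, hence
    invariant under steps of every size and, in the limit, under the semigroup. *)
Lemma stationary_exists : exists mu : config n -> R, is_stationary alpha beta mu.
Proof.
pose tau := (alpha + beta + n.+1%:R)^-1.
have den0 : 0 < alpha + beta + n.+1%:R by rewrite ltr_wpDl ?ltr0n// addr_ge0.
have tau0 : 0 < tau by rewrite invr_gt0.
have tau1 : tau * (alpha + beta + n.+1%:R) <= 1 by rewrite mulVf// gt_eqF.
pose P (x y : config n) := cchain n.+1 alpha beta tau 1 ((fun z => (z == y)%:R) \o cfg) (cseq x).
have P0 x y : 0 <= P x y.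
  rewrite -[leLHS](@chain_cst _ _ (rate n.+1 alpha beta tau) _ (fun i : 'I_n.+2 => cupd n.+1 i) 1 0 (cseq x)).
  exact: (@cchain_pw R n.+1 alpha beta tau 1 (fun=> 0) _ (cseq x) isT a0 b0 (ltW tau0) tau1 (fun s' _ => ler0n _ _)).
have Pf x f : \sum_y P x y * f y = cchain n.+1 alpha beta tau 1 (f \o cfg) (cseq x).
  rewrite /P /cchain; under eq_bigr do rewrite mulrC -chainZ.
  rewrite -chain_sum; apply: eq_chain => s /=.
  rewrite (bigD1 (cfg s))//= eqxx mulr1 big1 ?addr0// => xi xis.
  by rewrite eq_sym (negbTE xis) mulr0.
have P1 x : \sum_y P x y = 1.
  transitivity (\sum_y P x y * 1); first by apply: eq_bigr => y _; rewrite mulr1.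
  by rewrite (Pf x (fun=> 1)) /cchain chain_cst.
have [mu [mu0 mu1 muP]] := invariant_distribution [ffun=> false] P0 P1.
exists mu; split=> // t t0 xi.
pose U := fun i : 'I_n.+2 => cupd n.+1 i.
have gen0 (G : seq bool -> R) : \sum_x mu x * gen (rate n.+1 alpha beta 1) U G (cseq x) = 0.
  have e x : gen (rate n.+1 alpha beta 1) U G (cseq x) =
     tau^-1 * (\sum_y P x y * (G \o @cseq n) y - (G \o @cseq n) x).
    rewrite Pf /cchain chainS /= cseqK addrAC subrr add0r mulr_sumr.
    apply: eq_bigr => i _; rewrite cfgK ?size_cupd ?size_cseq// mulrA /rate mul1r mulrA.
    by rewrite mulVf ?mul1r// gt_eqF.
  under eq_bigr do rewrite e mulrCA mulrBr.
  rewrite -mulr_sumr sumrB; apply/eqP; rewrite mulf_eq0 subr_eq0; apply/orP; right; apply/eqP.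
  under eq_bigr do rewrite mulr_sumr.
  rewrite exchange_big; apply: eq_bigr => y _.
  by under eq_bigr do rewrite mulrA; rewrite -mulr_suml muP.
have inv tau' m (G : seq bool -> R) :
    \sum_x mu x * cchain n.+1 alpha beta tau' m G (cseq x) = \sum_x mu x * G (cseq x).
  elim: m => // m <-.
  have e x : mu x * cchain n.+1 alpha beta tau' m.+1 G (cseq x) =
     mu x * cchain n.+1 alpha beta tau' m G (cseq x) +
     tau' * (mu x * gen (rate n.+1 alpha beta 1) U (cchain n.+1 alpha beta tau' m G) (cseq x)).
    rewrite {1}/cchain chainS mulrDr; congr (_ + _); rewrite mulrCA; congr (_ * _).
    rewrite mulr_sumr; apply: eq_bigr => i _; rewrite mulrA /rate mul1r; congr (_ * _).
  under eq_bigr do rewrite e.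
  by rewrite big_split /= -mulr_sumr gen0 mulr0 addr0.
apply: (@cvgn_inj _ (fun m => \sum_x mu x * cchain n.+1 alpha beta (t / m.+1%:R) m.+1
   ((fun z => (z == xi)%:R) \o cfg) (cseq x))).
  by apply: cvg_sumr => x; apply: cvgMr; exact: semigroup_cvg.
under eq_fun do rewrite inv.
rewrite (bigD1 xi)//= cseqK eqxx mulr1 big1 ?addr0; first exact: cvg_cst.
by move=> x /negbTE xxi; rewrite cseqK xxi mulr0.
Qed.

Lemma stationary_is_distribution : is_distribution (@stationary_distribution R n alpha beta).
Proof. by have [] := getPex stationary_exists. Qed.

Lemma max_tv_ge t eta (A : pred (config n)) : 0 <= t ->
  semigroup alpha beta t (fun xi => (A xi)%:R) eta -
  \sum_xi stationary_distribution alpha beta xi * (A xi)%:R <= @max_tv R n alpha beta t.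
Proof.
move=> t0; apply: (@le_trans _ _ (tv_distance (transition alpha beta t eta) (stationary_distribution alpha beta))); last first.
  by rewrite /max_tv; exact: le_bigmax.
rewrite -semigroup_transition//; apply: half_l1_ge.
by rewrite transition_sum//; have [_ ->] := stationary_is_distribution.
Qed.

End Semigroup.

(** * The mixing time *)

Section Final.
Variable R : realType.

(** With b >= q ^ 2 / 3 the spacing 31 K separates consecutive means by at least 31 K q / 3, more
    than the width 10 K q of the windows. *)
Lemma near_disjoint (K q b c : R) k (i j : 'I_k) (z : R) : 1 <= K -> 0 < q -> q ^+ 2 <= 3 * b ->
  `|z - (c + b * (31 * K * i%:R / q))| <= 5 * (K * q) ->
  `|z - (c + b * (31 * K * j%:R / q))| <= 5 * (K * q) -> i = j.
Proof.
move=> K1 q0 bq.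
wlog ij : i j / (i <= j)%N.
  by case: (leqP i j) => [h|/ltnW h] w h1 h2; [exact: w|apply/esym; exact: w].
rewrite !ler_norml => /andP[h1 h2] /andP[h3 h4].
case: (ltngtP i j) ij => // [ij _|ij _]; last exact: val_inj.
exfalso.
have ijR : i%:R + 1 <= j%:R :> R by rewrite natr1 ler_nat.
have Kq : 0 < K * q by rewrite mulr_gt0//; lra.
have e : b * (31 * K * j%:R / q) - b * (31 * K * i%:R / q) =
   31 * (K / q * (b * (j%:R - i%:R))) by field; rewrite gt_eqF.
have b0 : 0 <= b by have := sqr_ge0 q; lra.
have h5 : b <= b * (j%:R - i%:R) by rewrite ler_peMr//; lra.
have h6 : K / q * q ^+ 2 <= K / q * (3 * (b * (j%:R - i%:R))).
  by apply: ler_wpM2l; [rewrite divr_ge0//; lra|lra].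
have h7 : K / q * q ^+ 2 = K * q by field; rewrite gt_eqF.
lra.
Qed.

Lemma max_tv_lower n k (K q alpha beta t : R) :
  0 <= t -> 2^-1 <= alpha -> 2^-1 <= beta -> 0 <= q -> q ^+ 2 = n.+1%:R ->
  1 <= K -> 4 * (20 * K + 1) <= q -> 8 * (20 * K + 1) ^+ 3 * t <= q ^+ 3 ->
  96 * (31 * K * k.+1%:R) <= q -> 8 * (16 * (31 * K * k.+1%:R)) ^+ 3 * t <= q ^+ 3 ->
  1 - 24 / K - k.+1%:R^-1 <= @max_tv R n.+1 alpha beta t.
Proof.
move=> t0 a12 b12 q0 qE K1 qK tq Bq tB.
have a0 : 0 <= alpha by apply: le_trans a12; rewrite invr_ge0.
have b0 : 0 <= beta by apply: le_trans b12; rewrite invr_ge0.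
have kR : 1 <= k.+1%:R :> R by rewrite ler1n.
have q84 : 84 <= q by lra.
have n84 : (84 < n)%N.
  have : (84 ^ 2 <= n.+1)%N.
    by rewrite -(ler_nat R) natrX -qE lerXn2r ?nnegrE//; lra.
  by rewrite -mulnn; clear; lia.
set B := 31 * K * k.+1%:R in Bq tB.
have B1 : 1 <= B by rewrite /B; nra.
pose v0 := (n.+2 %/ 3).-1; pose b := (n.+2 - 2 * (n.+2 %/ 3))%N.
have v0n : (v0 <= n.+1 <= 4 * v0)%N by rewrite /v0; clear -n84; lia.
have abN : (v0.+1 + b + v0.+1 = n.+2)%N by rewrite /v0 /b; clear -n84; lia.
have bq : q ^+ 2 <= 3 * b%:R by rewrite qE -natrM ler_nat /b; clear; lia.
pose r (i : 'I_k.+1) : R := 31 * K * i%:R.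
pose mean i := n.+2%:R / 2 + b%:R * (r i / q).
pose F i (s : seq bool) : bool := `|pcount R s - mean i| <= 5 * (K * q).
have [mu0 mu1] := @stationary_is_distribution R n.+1 alpha beta a0 b0.
have qp : 0 < q by lra.
have [i mui] := @disjoint_small R _ _ k (fun i xi => F i (cseq xi)) mu0 mu1
  (fun i j xi => @near_disjoint K q b%:R (n.+2%:R / 2) k.+1 i j _ K1 qp bq).
have rB : `|r i| <= B.
  rewrite /r ger0_norm; last by rewrite !mulr_ge0//; lra.
  by rewrite /B ler_wpM2l; [|lra|rewrite ler_nat ltnW].
have lim : 1 - 24 / K <= bern (law v0.+1 b (r i / q))
    (psem n.+1 alpha beta t (fun s => (F i s)%:R)).
  have h : (fun m => bern (law v0.+1 b (r i / q))
      (cchain n.+2 alpha beta (t / m.+1%:R) m.+1 (fun s => (F i s)%:R))) @ \oo -->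
      bern (law v0.+1 b (r i / q)) (psem n.+1 alpha beta t (fun s => (F i s)%:R)).
    apply: (@bern_cvg R (law v0.+1 b (r i / q)) (fun m => cchain n.+2 alpha beta (t / m.+1%:R) m.+1 (fun s => (F i s)%:R))) => s _.
    by apply: (@psem_cvg R n.+1 alpha beta a0 b0 t 1) => // s'; case: (F i s'); rewrite ?normr1 ?normr0.
  apply: (cvgr_to_ge h); have := @small_step R n.+1 (alpha + beta) 1 t.
  apply: filterS => m hm.
  have tE : t = m.+1%:R * (t / m.+1%:R) by rewrite mulrCA divff ?mulr1.
  have tau0 : 0 <= t / m.+1%:R by rewrite divr_ge0.
  exact: (@count_near R n v0 b m.+1 K q B alpha beta (t / m.+1%:R) t tE tau0 a12 b12 hm qE
    K1 qK tq B1 Bq tB v0n abN (r i) rB).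
rewrite lerBlDr; apply: (le_trans lim).
have drs : dens (law v0.+1 b (r i / q)).
  apply: dens_law; rewrite normrM normfV (gtr0_norm qp) ler_pdivrMr//; lra.
(* [max_tv] bounds the discrepancy for each initial configuration, hence also the average over
   [law]. *)
rewrite -[leRHS](bern_cst (law v0.+1 b (r i / q))); apply: bern_le => // s.
rewrite size_law abN => sN; rewrite -(cfgK sN) -semigroupE -lerBlDr.
apply: le_trans (@max_tv_ge R n.+1 alpha beta a0 b0 t (cfg n.+1 s) (fun xi => F i (cseq xi)) t0).
by rewrite lerB.
Qed.

Lemma powR_3half (x : R) : 0 <= x -> x `^ (3 / 2) = Num.sqrt x ^+ 3.
Proof.
by move=> x0; rewrite mulrC powRrM powR12_sqrt// powR_mulrn// sqrtr_ge0.
Qed.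

Lemma limn_einf_ge (u : (\bar R)^nat) (c : \bar R) N :
  (forall n, (N <= n)%N -> (c <= u n)%E) -> (c <= limn_einf u)%E.
Proof.
move=> cu; rewrite limn_einf_lim; apply: lime_ge; first exact: is_cvg_einfs.
exists N => // n /= Nn; apply: le_ereal_inf_tmp => _ [m /= nm <-].
by apply: cu; exact: leq_trans nm.
Qed.

End Final.

Unset Implicit Arguments.

Theorem theorem1p3 (R : realType) (eps : R) (eps_gt0 : 0 < eps)
    (eps_lt1 : eps < 1) :
  exists C3 : R, 0 < C3 /\
    forall alpha beta : R, 2^-1 <= alpha -> 2^-1 <= beta ->
      (C3%:E <= limn_einf (fun n : nat =>
         mixing_time n alpha beta eps / (n.+1%:R `^ (3 / 2))%:E))%E.
Proof.
have d0 : 0 < 1 - eps by rewrite subr_gt0.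
(* With this choice 24 / K is 0.24 (1 - eps), and 1 / (k + 1) will be at most (1 - eps) / 2, so the
   distance stays above eps. *)
have [K KE] : exists K, K = 100 / (1 - eps) by eexists.
have K1 : 1 <= K by rewrite KE ler_pdivlMr//; lra.
have [k kE] : exists k : nat, 2 / (1 - eps) <= k.+1%:R.
  exists (Num.bound (2 / (1 - eps))); apply: ltW; apply: lt_trans (archi_boundP _) _.
    by rewrite divr_ge0// ltW.
  by rewrite ltr_nat.
have kR : 1 <= k.+1%:R :> R by rewrite ler1n.
have [B BE] : exists B, B = 31 * K * k.+1%:R by eexists.
have B0 : 0 <= B by rewrite BE !mulr_ge0//; lra.
(* [D] dominates both [20 * K + 1] and [16 * B], so a single bound on t gives both conditions on
   time. *)
have [D DE] : exists D, D = 20 * K + 1 + 16 * B by eexists.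
have D1 : 1 <= D by lra.
have D3 : 1 <= D ^+ 3 by rewrite exprn_ege1.
pose c := (8 * D ^+ 3)^-1.
have c0 : 0 < c by rewrite invr_gt0; lra.
(* There are n + 2 sites while q is the square root of n + 1; sqrt (n + 2) <= 2 q costs the factor
   8. *)
exists (c / 8); split; first by rewrite divr_gt0.
move=> alpha beta a12 b12.
pose N := Num.bound ((80 * K + 4 + 96 * B) ^+ 2).
apply: (@limn_einf_ge _ _ _ N.+1) => -[//|n] nN.
have NE : (80 * K + 4 + 96 * B) ^+ 2 <= n.+1%:R.
  apply: ltW; apply: lt_le_trans (archi_boundP (sqr_ge0 _)) _.
  by rewrite ler_nat ltnW.
pose q := Num.sqrt (n.+1%:R : R).
have q0 : 0 <= q by exact: sqrtr_ge0.
have qE : q ^+ 2 = n.+1%:R by rewrite sqr_sqrtr.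
have qN : 80 * K + 4 + 96 * B <= q.
  have K0 : 0 <= K by exact: le_trans K1.
  by rewrite -(@ler_pXn2r _ 2) ?nnegrE ?qE// !addr_ge0 ?mulr_ge0.
have q3 : 0 <= q ^+ 3 by exact: exprn_ge0.
have mix : ((c * q ^+ 3)%:E <= mixing_time n.+1 alpha beta eps)%E.
  apply: le_ereal_inf_tmp => _ [t [t0 tv] <-]; rewrite lee_fin leNgt; apply/negP => tc.
  have tD : 8 * D ^+ 3 * t <= q ^+ 3.
    by rewrite -ler_pdivlMl -/c ?ltW//; lra.
  have le3 x : 0 <= x -> x <= D -> 8 * x ^+ 3 * t <= q ^+ 3.
    move=> x0 xD; apply: le_trans tD; rewrite ler_wpM2r// ler_wpM2l//.
    by rewrite lerXn2r ?nnegrE//; lra.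
  have h1 : 4 * (20 * K + 1) <= q by lra.
  have h2 : 8 * (20 * K + 1) ^+ 3 * t <= q ^+ 3 by apply: le3; lra.
  have h3 : 96 * B <= q by lra.
  have h4 : 8 * (16 * B) ^+ 3 * t <= q ^+ 3 by apply: le3; lra.
  rewrite BE in h3 h4.
  have := le_lt_trans (@max_tv_lower _ n k K q alpha beta t t0 a12 b12 q0 qE K1 h1 h2 h3 h4) tv.
  have -> : 24 / K = 24 * (1 - eps) / 100 by rewrite KE; field; lra.
  have : k.+1%:R^-1 <= (1 - eps) / 2.
    by rewrite -[leRHS]invrK lef_pV2 ?posrE ?invr_gt0 ?divr_gt0// invf_div; lra.
  move: (k.+1%:R^-1) => z u1 u2. lra.
have pow0 : 0 < (n.+2%:R : R) `^ (3 / 2) by rewrite powR_gt0.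
rewrite inver gt_eqF// lee_pdivlMr//; apply: le_trans mix.
rewrite -EFinM lee_fin powR_3half//.
have : Num.sqrt (n.+2%:R : R) <= 2 * q.
  rewrite -(@ler_pXn2r _ 2) ?nnegrE ?sqrtr_ge0 ?mulr_ge0// sqr_sqrtr// exprMn qE.
  by rewrite -(natr1 n.+1); have : 1 <= n.+1%:R :> R by [rewrite ler1n]; lra.
move=> h; have h3 : Num.sqrt (n.+2%:R : R) ^+ 3 <= (2 * q) ^+ 3.
  by rewrite lerXn2r ?nnegrE ?sqrtr_ge0 ?mulr_ge0.
apply: (@le_trans _ _ (c / 8 * (2 * q) ^+ 3)); first by rewrite ler_wpM2l// divr_ge0// ltW.
by rewrite exprMn le_eqVlt; apply/orP; left; apply/eqP; field.
Qed.
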